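(* Consider the one-dimensional pressureless Euler alignment system with control $$\partial_t \rho + \partial_x(\rho u) = 0,\qquad \partial_t u + u\,\partial_x u = \int_{\mathbb R}\psi(x-y)\,(u(y,t)-u(x,t))\,\rho(y,t)\,dy + \frac1\gamma(\bar u - u),\qquad x\in\mathbb R,\ t>0,$$ with initial data $(\rho,u)|_{t=0}=(\rho_0,u_0)$. Then: (Supercritical region) If there exists $x\in\mathbb R$ such that $\partial_x u_0(x) < -(\psi\star\rho_0)(x) - \frac1\gamma$, then the solution blows up in finite time. (Subcritical region) If $\partial_x u_0(x)\ge -(\psi\star\rho_0)(x)-\frac1\gamma$ for all $x\in\mathbb R$, then the system has a global strong solution $(\rho,u)\in \mathcal C(\mathbb R_+;L^\infty(\mathbb R))\times \mathcal C(\mathbb R_+;\dot W^{1,\infty}(\mathbb R))$.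
   Context: Here $\gamma>0$ is a constant and $\bar u\in\mathbb R$ is a constant reference velocity. The communication weight $\psi\in (W^{1,\infty}\cap \mathcal C^1)(\mathbb R)$ satisfies $0\le\psi(x)=\psi(-x)$ and $\psi(x)\le\psi(y)$ whenever $|x|\ge|y|$. The density is nonnegative, the initial density $\rho_0$ is compactly supported (with finite mass $\|\rho_0\|_{L^1}$), and the initial velocity $u_0$ is uniformly bounded. $(\psi\star\rho)(x,t)=\int_{\mathbb R}\psi(x-y)\rho(y,t)\,dy$ denotes convolution in $x$. The initial data are assumed regular enough that the system has a local-in-time strong solution in the class $\mathcal C([0,T);L^\infty(\mathbb R))\times\mathcal C([0,T);\dot W^{1,\infty}(\mathbb R))$, with $\partial_x u_0$ evaluated pointwise. ''Blows up in finite time'' means that the strong solution cannot be continued for all times ($\partial_x u$ becomes unbounded from below in finite time). $\dot W^{1,\infty}$ is the homogeneous Sobolev space of functions with bounded first derivative.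
   Formalization: The initial data are taken with ρ0 continuous and u0 continuously differentiable with bounded, uniformly continuous derivative, since mere local existence in the class does not suffice: a jump of ρ0 initially at rest may move later and destroy continuity in L^∞. *)

(* Defs.v *)
From HB Require Import structures.
From mathcomp Require Import all_boot all_order all_algebra.
From mathcomp Require Import all_classical all_reals all_analysis.
Import Order.TTheory GRing.Theory Num.Theory.
Import numFieldNormedType.Exports.

Set Implicit Arguments.
Unset Strict Implicit.
Unset Printing Implicit Defensive.

Local Open Scope classical_set_scope.
Local Open Scope ring_scope.

(* Space-time functions are curried with time first: [u t x], [rho t x]. *)

Section EulerAlignment.
Context {R : realType}.
Implicit Types (f psi phi : R -> R) (rho u : R -> R -> R) (T : \bar R).

Local Notation mu := (@lebesgue_measure R).

Definition compactly_supported f := compact (closure [set x | f x != 0]).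

Definition C1 f := (forall x, derivable f x 1) /\ continuous (derive1 f).

(* In dimension one, f belongs to the homogeneous Sobolev space when it is
   the primitive of an essentially bounded function; by Lebesgue's theorem
   that function is derive1 f almost everywhere. *)
Definition dotW1oo f :=
  derive1 f \in Lfun mu +oo%E /\
  forall a b, a <= b -> f b - f a = \int[mu]_(x in `[a, b]) derive1 f x.

Definition W1oo f := f \in Lfun mu +oo%E /\ dotW1oo f.

Definition convolution f (rho0 : R -> R) (x : R) : R :=
  \int[mu]_y (f (x - y) * rho0 y).

Definition communication_weight psi :=
  [/\ W1oo psi, C1 psi, (forall x, 0 <= psi x), (forall x, psi (- x) = psi x)
    & forall x y, `|y| <= `|x| -> psi x <= psi y].

(* Densities in C([0,T); L^oo) are transported along characteristics, and a
   bounded function moves continuously in the L^oo norm under translations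
   exactly when it is uniformly continuous (up to a null set).  So rho0 and
   derive1 u0 are taken uniformly continuous; for the compactly supported rho0
   this is just continuity. *)
Definition admissible_data (rho0 u0 : R -> R) :=
  [/\ (forall x, 0 <= rho0 x), continuous rho0 & compactly_supported rho0] /\
  [/\ [bounded u0 x | x in [set: R]], C1 u0, dotW1oo u0
    & unif_continuous (derive1 u0)].

Definition time_interval T : set R := [set t | 0 <= t /\ (t%:E < T)%E].

(* Continuity into L^oo, for the norm topology *)
Definition C_Loo T rho :=
  (forall t, time_interval T t -> rho t \in Lfun mu +oo%E) /\
  forall t, time_interval T t ->
    'N[mu]_+oo[EFin \o (rho s \- rho t)%R]%E
      @[s --> within (time_interval T) (nbhs t)] --> (0 : \bar R).

(* The seminorm of the homogeneous space does not see constants, hence the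
   separate requirement of pointwise continuity in time. *)
Definition C_dotW1oo T u :=
  [/\ (forall t, time_interval T t -> dotW1oo (u t)),
      C_Loo T (fun t => derive1 (u t))
    & forall x, {within time_interval T, continuous (u^~ x)}].

(* Since rho is continuous in time with values in L^oo, testing at each time
   against C^1_c functions of x is the same as the equation in the sense of
   distributions on R x (0,T). *)
Definition continuity_equation T rho u :=
  forall phi, C1 phi -> compactly_supported phi ->
  forall t, 0 < t -> (t%:E < T)%E ->
    let mass s := \int[mu]_x (rho s x * phi x) in
    derivable mass t 1 /\
    derive1 mass t = \int[mu]_x (rho t x * u t x * derive1 phi x).

Definition momentum_equation (gamma ubar : R) psi T rho u :=
  forall t x, 0 < t -> (t%:E < T)%E ->
    let alignment y := psi (x - y) * (u t y - u t x) * rho t y in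
    [/\ derivable (u^~ x) t 1, derivable (u t) x 1,
        mu.-integrable setT (EFin \o alignment)
      & derive1 (u^~ x) t + u t x * derive1 (u t) x =
        (\int[mu]_y alignment y) + gamma^-1 * (ubar - u t x)].

(* Strong solution on the time interval [0,T), 0 < T <= +oo *)
Definition strong_solution (gamma ubar : R) psi (rho0 u0 : R -> R) T rho u :=
  [/\ [/\ C_Loo T rho, C_dotW1oo T u
        & forall t, time_interval T t -> {ae mu, forall x, 0 <= rho t x}],
      continuity_equation T rho u,
      momentum_equation gamma ubar psi T rho u,
      {ae mu, forall x, rho 0 x = rho0 x}
    & forall x, u 0 x = u0 x].

Definition blows_up_in_finite_time (gamma ubar : R) psi (rho0 u0 : R -> R) :=
  exists Tmax : R,
    [/\ 0 < Tmax,
        exists rho u, strong_solution gamma ubar psi rho0 u0 Tmax%:E rho u,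
        forall rho u, strong_solution gamma ubar psi rho0 u0 Tmax%:E rho u ->
          forall M, exists t x, [/\ 0 <= t, t < Tmax & derive1 (u t) x < M]
      & forall T rho u, (Tmax%:E < T)%E ->
          ~ strong_solution gamma ubar psi rho0 u0 T rho u].

End EulerAlignment.

(* Main.v *)
(* Let [Psi] be an antiderivative of [psi], put [ga = 1 / gamma], and let
   [X t a] be the characteristic issued from [a].  Since the density is carried
   by the flow, the momentum equation says that
     d/dt X + ga * X + \int Psi (X t a - X t b) rho0 b db - ga * ubar * t
   is constant along characteristics, equal to its initial value [w0 a].  Hence
   the flow obeys a first-order equation with Lipschitz right-hand side that
   involves only the initial data, and it is defined for all times whether or
   not the solution survives.  The Jacobian [J] of the flow in [a] satisfies
     d/dt J = w1 a - (ga + (psi * rho) (t, X t a)) J,    J (0, a) = 1,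
   with [w1 = u0' + ga + psi * rho0]: it is bounded below, locally uniformly in
   time, when [w1 >= 0], and vanishes by time [- 1 / w1 a] when [w1 a < 0].
   As long as [inf J > 0] on [0, t], the velocity [d/dt X] and the density
   [rho0 / J], read in the Eulerian variable, form a strong solution.
   Conversely the characteristics of any strong solution obey the same
   equation, hence coincide with [X], and a lower bound on the slope of the
   velocity gives one on [J].  The lifespan is therefore exactly the supremum
   of the times up to which [inf J > 0]. *)

(* The flow [X] is built from the data alone because blow-up is a claim about every strong solution,
   and uniqueness is not given. A strong solution supplies little: [rho t] is merely essentially
   bounded and solves its equation weakly, and [u t] is not known to be bounded in space. That the
   density is carried by the characteristics is therefore obtained in two stages: moving test
   functions show that the mass between two characteristics is conserved, and matching masses on
   small label intervals then gives the integral of any continuous function. The infimum of [J] over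
   all labels matters, rather than its sign at each label, since the line of labels is not compact
   and the slope [w1 / J - q] has to stay bounded. The estimates on [J] are for this reason uniform
   in the label. In particular [J] is uniformly Lipschitz in time, so a positive lower bound before
   a time persists a little beyond it; hence [inf J] must vanish at the supremum of good times.
   Continuity in time in the uniform norm is where the uniform continuity of [rho0] and [u0']
   enters. *)
Require Import Defs.
From mathcomp Require Import all_boot all_order all_algebra.
From mathcomp Require Import all_classical all_reals all_analysis.
From mathcomp Require Import measurable_realfun ess_sup_inf ring lra.
Import Order.TTheory GRing.Theory Num.Theory.
Import numFieldNormedType.Exports.
Local Open Scope classical_set_scope.
Local Open Scope ring_scope.
Set Implicit Arguments.
Unset Strict Implicit.
Unset Printing Implicit Defensive.

(** * Calculus on the line *)

Section Calculus.
Context {R : realType}.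
Implicit Types (f g F G : R -> R) (a b c x l m t s A B T : R).

Lemma eq_ler (x y : R) : x = y -> x <= y.
Proof. by move=> ->. Qed.

Lemma continuousP_eps f x :
  {for x, continuous f} <->
  forall e, 0 < e -> exists2 d, 0 < d & forall y, `|y - x| < d -> `|f y - f x| <= e.
Proof.
split.
  move=> /cvgrPdist_le fx e e0; have [d /= d0 H] := fx _ e0.
  exists d => // y yd; rewrite distrC; apply: H.
  by rewrite /ball_/= distrC.
move=> H; apply/cvgrPdist_le => e e0; have [d d0 Hd] := H _ e0.
by exists d => // y /= yd; rewrite distrC; apply: Hd; rewrite distrC.
Qed.

Lemma is_deriveP_eps f x l :
  is_derive x 1 f l <->
  forall e, 0 < e -> exists2 d, 0 < d &
    forall y, `|y - x| < d -> `|f y - f x - l * (y - x)| <= e * `|y - x|.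
Proof.
split.
  move=> [df <-] e e0.
  move: df => /derivableP/@ex_derive/cvgrPdist_le/(_ _ e0)[d /= d0 H].
  exists d => // y yd; have [->|yx] := eqVneq y x.
    by rewrite !subrr mulr0 subrr !normr0 mulr0.
  have yx0 : y - x != 0 by rewrite subr_eq0.
  have := H (y - x); rewrite /ball_/= sub0r normrN => /(_ yd yx0).
  rewrite scaler1 subrK -[(y - x)^-1 *: _]/((y - x)^-1 * _) -[lim _]/('D_1 f x).
  have -> : 'D_1 f x - (y - x)^-1 * (f y - f x) =
    - ((f y - f x - 'D_1 f x * (y - x)) / (y - x)) by field.
  by rewrite normrN normrM normfV ler_pdivrMr ?normr_gt0.
move=> H.
have cv : h^-1 *: ((f \o shift x) (h *: 1) - f x) @[h --> 0^'] --> l.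
  apply/cvgrPdist_le => e e0; have [d d0 Hd] := H _ e0.
  exists d => //= h; rewrite /ball_/= sub0r normrN => hd h0.
  rewrite scaler1 -[h^-1 *: _]/(h^-1 * _).
  have := Hd (h + x); rewrite addrK => /(_ hd) {}Hd.
  have -> : l - h^-1 * (f (h + x) - f x) = - ((f (h + x) - f x - l * h) / h) by field.
  by rewrite normrN normrM normfV ler_pdivrMr ?normr_gt0.
split; first by apply/cvg_ex; exists l.
exact/cvg_lim.
Qed.

Lemma is_derive_continuous f x l : is_derive x 1 f l -> {for x, continuous f}.
Proof. by case=> df _; exact/differentiable_continuous/derivable1_diffP. Qed.

Lemma is_derive_derive1 f x l : is_derive x 1 f l -> derive1 f x = l.
Proof. by case=> _ <-; rewrite derive1E. Qed.

Lemma derivable_is_derive f x : derivable f x 1 -> is_derive x 1 f (derive1 f x).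
Proof. by move=> df; rewrite derive1E; exact/derivableP. Qed.

Lemma is_deriveDf f g x l m : is_derive x 1 f l -> is_derive x 1 g m ->
  is_derive x 1 (fun y => f y + g y) (l + m).
Proof. by move=> df dg; exact: (is_deriveD df dg). Qed.

Lemma is_deriveNf f x l : is_derive x 1 f l -> is_derive x 1 (fun y => - f y) (- l).
Proof. by move=> df; exact: (is_deriveN df). Qed.

Lemma is_deriveBf f g x l m : is_derive x 1 f l -> is_derive x 1 g m ->
  is_derive x 1 (fun y => f y - g y) (l - m).
Proof. by move=> df dg; exact: (is_deriveB df dg). Qed.

Lemma is_deriveMf f g x l m : is_derive x 1 f l -> is_derive x 1 g m ->
  is_derive x 1 (fun y => f y * g y) (l * g x + f x * m).
Proof.
move=> df dg; apply: is_derive_eq (is_deriveM df dg) _.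
by rewrite addrC /GRing.scale/= (mulrC (g x)).
Qed.

Lemma is_deriveZf c f x l : is_derive x 1 f l -> is_derive x 1 (fun y => c * f y) (c * l).
Proof. by move=> df; exact: (is_deriveZ c df). Qed.

Lemma is_derive_cstf c x : is_derive x 1 (fun _ => c) 0.
Proof. exact: is_derive_cst. Qed.

Lemma is_derive_idf x : is_derive x 1 (fun y => y) 1.
Proof. exact: is_derive_id. Qed.

Lemma is_derive_compf f g x l m : is_derive (g x) 1 f l -> is_derive x 1 g m ->
  is_derive x 1 (fun y => f (g y)) (l * m).
Proof. by move=> df dg; exact: (is_derive1_comp df dg). Qed.

Lemma is_derive_exp_lin c x :
  is_derive x 1 (fun y => expR (c * y)) (c * expR (c * x)).
Proof.
have := is_derive_compf (is_derive_expR _) (is_deriveZf c (is_derive_idf x)).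
by rewrite mulr1 mulrC.
Qed.

Lemma continuous_within f (A : set R) : continuous f -> {within A, continuous f}.
Proof. by move=> cf; apply: continuous_subspaceT. Qed.

Lemma within_continuousP_eps f (A : set R) :
  {within A, continuous f} <->
  forall x, A x -> forall e, 0 < e -> exists2 d, 0 < d &
    forall y, A y -> `|y - x| < d -> `|f y - f x| <= e.
Proof.
split.
  move=> /subspace_continuousP cf x Ax e e0.
  have /cvgrPdist_le/(_ _ e0)[d /= d0 H] := cf x Ax.
  exists d => // y Ay yx; rewrite distrC; apply: H => //=.
  by rewrite distrC.
move=> H; apply/subspace_continuousP => x Ax; apply/cvgrPdist_le => e e0.
have [d d0 Hd] := H _ Ax _ e0; exists d => // y /= yx Ay.
by rewrite distrC; apply: Hd => //; rewrite distrC.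
Qed.

(** Derivatives are asked for only in the open interval, because the equations of a strong solution
    hold only at positive times; continuity bridges the endpoints. *)
Lemma ler_of_derive f g a b : a <= b ->
  {within `[a, b], continuous f} -> {within `[a, b], continuous g} ->
  (forall x, a < x < b -> exists l m,
     [/\ is_derive x 1 f l, is_derive x 1 g m & l <= m]) ->
  f b - f a <= g b - g a.
Proof.
move=> ab cf cg H; rewrite -subr_ge0.
have -> : g b - g a - (f b - f a) = (g b - f b) - (g a - f a) by ring.
rewrite subr_ge0.
apply: (@ger0_derive1_ndecr _ (fun x => g x - f x) a b) => // [x|x|x].
- rewrite in_itv/= => /H[l [m [df dg _]]].
  exact: (ex_derive (is_derive := is_deriveBf dg df)).
- rewrite in_itv/= => /H[l [m [df dg lm]]].
  by rewrite (is_derive_derive1 (is_deriveBf dg df)) subr_ge0.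
- exact: continuousB (cg x) (cf x).
Qed.

Lemma normr_ler_of_derive f g a b : a <= b ->
  {within `[a, b], continuous f} -> {within `[a, b], continuous g} ->
  (forall x, a < x < b -> exists l m,
     [/\ is_derive x 1 f l, is_derive x 1 g m & `|l| <= m]) ->
  `|f b - f a| <= g b - g a.
Proof.
move=> ab cf cg H; rewrite ler_norml; apply/andP; split.
  have := @ler_of_derive (fun x => - f x) g a b ab.
  rewrite lerNl opprB => H'.
  have -> : f a - f b = - f b - - f a by ring.
  apply: H' => //.
    by move=> x; exact: continuousN (cf x).
  move=> x /H[l [m [df dg lm]]]; exists (- l), m; split => //; first exact: is_deriveNf.
  by rewrite (le_trans _ lm)// -normrN ler_norm.
apply: ler_of_derive => // x /H[l [m [df dg lm]]]; exists l, m; split => //.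
by rewrite (le_trans _ lm)// ler_norm.
Qed.

Lemma is_derive_within f (D : set R) f' :
  (forall x, D x -> is_derive x 1 f (f' x)) -> {within D, continuous f}.
Proof.
move=> H; apply/within_continuousP_eps => x Dx e e0.
have /is_derive_continuous/continuousP_eps/(_ _ e0)[d d0 Hd] := H _ Dx.
by exists d => // y _; exact: Hd.
Qed.

Lemma eq_of_derive0 f a b : a <= b -> {within `[a, b], continuous f} ->
  (forall x, a < x < b -> is_derive x 1 f 0) -> f b = f a.
Proof.
move=> ab cf H; apply/eqP; rewrite -subr_eq0 -normr_le0.
have := @normr_ler_of_derive f (fun _ => 0) a b ab cf.
rewrite subrr; apply => //; first exact: cst_continuous.
by move=> x /H df; exists 0, 0; split => //; [exact: is_derive_cstf|rewrite normr0].
Qed.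

Lemma lipschitz_of_derive f f' l : (forall x, is_derive x 1 f (f' x)) ->
  (forall x, `|f' x| <= l) -> forall x y, `|f x - f y| <= l * `|x - y|.
Proof.
move=> df f'l; suff H x y : x <= y -> `|f y - f x| <= l * (y - x).
  move=> x y; have [xy|/ltW yx] := leP x y.
    by rewrite distrC (distrC x) (ger0_norm (x := y - x)) ?subr_ge0// H.
  by rewrite (ger0_norm (x := x - y)) ?subr_ge0// H.
move=> xy; rewrite mulrBr; apply: (@normr_ler_of_derive f (fun t => l * t)) => //.
- exact: (@is_derive_within _ _ f').
- by apply: (@is_derive_within _ _ (fun=> l * 1)) => t _; exact: (is_deriveZf _ (is_derive_idf _)).
- move=> t _; exists (f' t), (l * 1); split;
    [exact: df|exact: (is_deriveZf _ (is_derive_idf _))|by rewrite mulr1].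
Qed.

(** Squares are used because [|y|] need not be differentiable where [y] vanishes. Young's inequality
    [2 * A * |y| <= A ^+ 2 + y ^+ 2] accounts for the extra [1] in the rate. *)
Lemma gronwall_sqr (y y' : R -> R) A B T : 0 <= A -> 0 <= B -> 0 <= T ->
  (forall t, 0 <= t <= T -> is_derive t 1 y (y' t)) ->
  (forall t, 0 <= t <= T -> `|y' t| <= A + B * `|y t|) ->
  y T ^+ 2 <= (y 0 ^+ 2 + A ^+ 2 * T) * expR ((2 * B + 1) * T).
Proof.
move=> A0 B0 T0 dy Hy; set c := 2 * B + 1.
pose z t := expR (- c * t) * (y t * y t).
have dz t : 0 <= t <= T -> is_derive t 1 z
    (- c * expR (- c * t) * (y t * y t) + expR (- c * t) * (y' t * y t + y t * y' t)).
  move=> tT; apply: is_deriveMf; first exact: is_derive_exp_lin.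
  exact: is_deriveMf (dy _ tT) (dy _ tT).
have dA t : is_derive t 1 (fun t => A ^+ 2 * t) (A ^+ 2 * 1).
  exact: (is_deriveZf _ (is_derive_idf _)).
have H : z T - z 0 <= A ^+ 2 * T - A ^+ 2 * 0.
  apply: ler_of_derive => //.
  - by apply: is_derive_within => t /= tT; apply: dz; rewrite in_itv/= in tT.
  - by apply: is_derive_within => t /= tT; exact: dA.
  move=> t /andP[t0 tT]; have tT' : 0 <= t <= T by rewrite !ltW.
  exists (- c * expR (- c * t) * (y t * y t) + expR (- c * t) * (y' t * y t + y t * y' t)),
    (A ^+ 2 * 1); split => //; first exact: dz.
  have -> : - c * expR (- c * t) * (y t * y t) + expR (- c * t) * (y' t * y t + y t * y' t)
     = expR (- c * t) * (2 * (y t * y' t) - c * (y t) ^+ 2) by ring.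
  have e1 : expR (- c * t) <= 1.
    by rewrite expR_le1 mulNr oppr_le0 mulr_ge0// ltW// /c; lra.
  apply: (@le_trans _ _ (expR (- c * t) * A ^+ 2)); last first.
    by rewrite mulr1; have := sqr_ge0 A; nra.
  rewrite ler_pM2l ?expR_gt0//.
  have h1 : y t * y' t <= `|y t| * (A + B * `|y t|).
    apply: le_trans (ler_norm _) _; rewrite normrM ler_wpM2l//; exact: Hy.
  have h2 : `|y t| ^+ 2 = y t ^+ 2 by rewrite -normrX ger0_norm// sqr_ge0.
  have := sqr_ge0 (A - `|y t|); rewrite /c; nra.
rewrite /z !mulr0 expR0 mul1r subr0 lerBlDr in H.
have eT := expR_gt0 (c * T).
have := ler_wpM2l (ltW eT) H.
have -> : expR (c * T) * (expR (- c * T) * (y T * y T)) = y T ^+ 2.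
  by rewrite mulrA -expRD mulNr subrr expR0 mul1r expr2.
by move=> /le_trans; apply; rewrite mulrC addrC -expr2.
Qed.

(** Linearity in the source [A] is the point: small sources give small solutions. The square root of
    the constant [C] that [gronwall_sqr] leaves is majorized by [1 + C]. *)
Lemma gronwall0 (y y' : R -> R) A B T t : 0 <= A -> 0 <= B -> 0 <= t <= T ->
  (forall t, 0 <= t <= T -> is_derive t 1 y (y' t)) -> y 0 = 0 ->
  (forall t, 0 <= t <= T -> `|y' t| <= A + B * `|y t|) ->
  `|y t| <= A * (1 + T * expR ((2 * B + 1) * T)).
Proof.
move=> A0 B0 /andP[t0 tT] dy y0 Hy.
have T0 := le_trans t0 tT.
have s_in s : 0 <= s <= t -> 0 <= s <= T.
  by move=> /andP[-> st]; exact: le_trans st tT.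
have := @gronwall_sqr y y' A B t A0 B0 t0 (fun s st => dy s (s_in _ st))
  (fun s st => Hy s (s_in _ st)).
rewrite y0 expr0n/= add0r => H.
set C := T * expR ((2 * B + 1) * T).
have C0 : 0 <= C by rewrite mulr_ge0// expR_ge0.
have tC : t * expR ((2 * B + 1) * t) <= C.
  apply: ler_pM; [exact: t0|exact: expR_ge0|exact: tT|].
  by rewrite ler_expR ler_wpM2l//; lra.
have : `|y t| ^+ 2 <= (A * (1 + C)) ^+ 2.
  rewrite -normrX ger0_norm ?sqr_ge0//.
  apply: (le_trans H); rewrite -mulrA exprMn ler_wpM2l ?sqr_ge0//.
  by apply: (le_trans tC); nra.
rewrite ler_sqr// nnegrE ?mulr_ge0//; lra.
Qed.
End Calculus.

(** * Primitives and Picard iteration *)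

Section Primitive.
Context {R : realType}.
Implicit Types (f g F G : R -> R) (a b c x l m t s A B T : R).
Notation mu := (@lebesgue_measure R).

Lemma continuous_integrable_itv f a b : continuous f ->
  mu.-integrable `[a, b] (EFin \o f).
Proof.
move=> cf; apply: continuous_compact_integrable; first exact: segment_compact.
exact: continuous_within.
Qed.

(** The interval [[0, t]] is empty for negative [t], so the orientation of the integral is put in by
    hand; this makes the primitive differentiable across [0]. *)
Definition primitive f t : R :=
  if 0 <= t then \int[mu]_(s in `[0, t]) f s else - \int[mu]_(s in `[t, 0]) f s.

Lemma primitive0 f : primitive f 0 = 0.
Proof. by rewrite /primitive lexx set_itv1 Rintegral_set1. Qed.

Lemma Rintegral_itv_split f a b c : mu.-integrable `[a, c] (EFin \o f) ->
  a <= b -> b <= c ->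
  \int[mu]_(s in `[a, c]) f s =
  \int[mu]_(s in `[a, b]) f s + \int[mu]_(s in `[b, c]) f s.
Proof.
move=> fi ab bc.
have := @Rintegral_itvB _ f (BLeft a) (BRight c) b fi.
rewrite !bnd_simp => /(_ ab bc) H.
rewrite -(Rintegral_itv_obnd_cbnd (r := b) (b := BRight c)); last first.
  by apply: integrableS fi => //; apply: subset_itv; rewrite bnd_simp.
by rewrite -H addrC subrK.
Qed.

(** The fundamental theorem is applied from a base point [- N] to the left of both [0] and [t]; near
    [t] the primitive differs from that integral by a constant, whichever branch it is in. *)
Lemma is_derive_primitive f t : continuous f -> is_derive t 1 (primitive f) (f t).
Proof.
move=> cf; pose N := `|t| + 1.
have /ltr_normlP[Nt tN] : `|t| < N by rewrite /N ltrDl.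
have N0 : 0 < N by rewrite /N; have := normr_ge0 t; lra.
have H := @continuous_FTC1_closed _ f (- N) t N tN
  (continuous_integrable_itv _ _ cf).
have {H}[|//|dF F'] := H; first by lra.
 exact: cf.
have {dF F'} dF : is_derive t 1 (fun x => \int[mu]_(s in `[- N, x]) f s) (f t).
  by rewrite -F'; exact: derivable_is_derive.
have := is_deriveBf dF (is_derive_cstf (\int[mu]_(s in `[- N, 0]) f s) t).
rewrite subr0; apply: near_eq_is_derive.
have : (- N) < t < N by apply/andP; split; lra.
move=> /andP[Nt' tN'].
near=> x.
have xN : - N <= x by apply/ltW; near: x; exact: lt_nbhsr.
rewrite /primitive; case: ifPn => [x0|].
  by rewrite (@Rintegral_itv_split f (- N) 0 x) //; [ring|exact: continuous_integrable_itv|lra].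
rewrite -ltNge => /ltW x0.
by rewrite (@Rintegral_itv_split f (- N) x 0) //; [ring|exact: continuous_integrable_itv].
Unshelve. all: by end_near. Qed.
End Primitive.

(** * Picard iteration for a family of coupled trajectories *)

Section Picard.
Context {R : realType}.
Implicit Types (t s : R).

(* The weight [expR (2 * L * t)] makes the Picard map halve distances on time
   intervals of any length. *)
Lemma contraction_step (y y' : R -> R) L M T t : 0 < L -> 0 <= t <= T -> y 0 = 0 ->
  {within `[0, t], continuous y} ->
  (forall s, 0 < s < T -> is_derive s 1 y (y' s)) ->
  (forall s, 0 < s < T -> `|y' s| <= L * (M * expR (2 * L * s))) ->
  0 <= M ->
  `|y t| <= M / 2 * expR (2 * L * t).
Proof.
move=> L0 /andP[t0 tT] y0 cy dy Hy M0.
have dg s : is_derive s 1 (fun s => M / 2 * expR (2 * L * s))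
    (M / 2 * (2 * L * expR (2 * L * s))).
  exact: is_deriveZf (is_derive_exp_lin _ _).
have : `|y t - y 0| <= M / 2 * expR (2 * L * t) - M / 2 * expR (2 * L * 0).
  apply: (@normr_ler_of_derive _ y (fun s => M / 2 * expR (2 * L * s)) 0 t t0 cy) => //.
    by apply: is_derive_within => s _; exact: dg.
  move=> s /andP[s0 st]; have sT : 0 < s < T by rewrite s0 (lt_le_trans st).
  exists (y' s), (M / 2 * (2 * L * expR (2 * L * s))); split; [exact: dy|exact: dg|].
  by apply: le_trans (Hy _ sT) _; rewrite le_eqVlt; apply/orP; left; apply/eqP; field.
rewrite y0 subr0 mulr0 expR0 => /le_trans; apply; lra.
Qed.

(** With [c n] the tail of the geometric series, every [u n - c n] lies below every [u m + c m], so
    the supremum of the lower ends is the limit. The explicit rate is kept because it carries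
    uniform bounds to the limit. *)
Lemma geometric_limit (u : nat -> R) C :
  (forall n, `|u n.+1 - u n| <= C / 2 ^+ n) ->
  exists l, forall n, `|l - u n| <= 2 * C / 2 ^+ n.
Proof.
move=> H.
have p2 n : 0 < 2 ^+ n :> R by rewrite exprn_gt0.
have C0 : 0 <= C by have := H 0%N; rewrite expr0 divr1; apply: le_trans.
have Hk n k : `|u (n + k)%N - u n| <= 2 * C / 2 ^+ n - 2 * C / 2 ^+ (n + k).
  elim: k => [|k IH]; first by rewrite addn0 !subrr normr0.
  rewrite addnS (_ : u _ - u n = (u (n + k).+1 - u (n + k)%N) + (u (n + k)%N - u n)); last by ring.
  apply: le_trans (ler_normD _ _) _.
  have := H (n + k)%N; move: IH; rewrite exprS.
  have -> : 2 * C / (2 * 2 ^+ (n + k)) = C / 2 ^+ (n + k).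
    by field; rewrite gt_eqF.
  have -> : 2 * C / 2 ^+ (n + k) = 2 * (C / 2 ^+ (n + k)) by rewrite mulrA.
  lra.
have Hn n k : `|u (n + k)%N - u n| <= 2 * C / 2 ^+ n.
  apply: le_trans (Hk n k) _; rewrite gerBl divr_ge0 ?mulr_ge0// ltW//.
pose c n : R := 2 * C / 2 ^+ n.
have c0 n : 0 <= c n by rewrite /c divr_ge0 ?mulr_ge0// ltW.
have Hnm n m : u n - c n <= u m + c m.
  have [nm|mn] := leqP n m.
    have := Hn n (m - n)%N; rewrite subnKC// ler_norml -/(c n) => /andP[+ _].
    by have := c0 m; lra.
  have := Hn m (n - m)%N; rewrite subnKC ?(ltnW mn)// ler_norml -/(c m) => /andP[_].
  by have := c0 n; lra.
pose S := [set u n - c n | n in [set: nat]].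
have ubS m : ubound S (u m + c m) by move=> _ [n _ <-]; exact: Hnm.
have supS : has_sup S by split; [exists (u 0%N - c 0%N), 0%N|exists (u 0%N + c 0%N)].
exists (sup S) => n; rewrite -/(c n) ler_distl; apply/andP; split.
  by apply: ub_le_sup; [exact: supS.2|exists n].
by apply: ge_sup => //; exact: supS.1.
Qed.

Lemma expr2_gt0 n : 0 < 2 ^+ n :> R.
Proof. by rewrite exprn_gt0. Qed.

Lemma half_pow_small (C e : R) : 0 < e -> exists n : nat, C / 2 ^+ n <= e.
Proof.
move=> e0; pose n := Num.truncn (C / e); exists n.+1.
have h : C / e < n.+1%:R.
  have [Ce|Ce] := leP 0 (C / e); first by have /andP[] := truncn_itv Ce.
  by apply: lt_le_trans Ce _.
rewrite ler_pdivrMr ?expr2_gt0// mulrC -ler_pdivrMr//.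
apply: le_trans (ltW h) _; rewrite -natrX ler_nat.
exact/ltnW/ltn_expl.
Qed.

Variables (I : Type) (L A : R) (x0 : I -> R) (G : R -> (I -> R) -> I -> R).
Variable Q : R -> (I -> R) -> Prop.

(** A primitive of [2 * A * expR (2 * L * t)], which bounds the speed: one [A] comes from the speed
    at the initial profile, the other from [L] times the displacement [A / L * expR (2 * L * t)].
    The bound thus reproduces itself under iteration. *)
Definition picard_modulus t := A / L * expR (2 * L * t).

(** [Q] is an invariant of the profile at each time, preserved by the iteration and by limits at a
    geometric rate. For the flow it is a Lipschitz bound in the label; for a single characteristic
    it is trivial. *)
Definition picard_class (f : R -> I -> R) :=
  [/\ forall t, 0 <= t -> Q t (f t), forall i, f 0 i = x0 i
    & forall s t i, 0 <= s -> s <= t ->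
      `|f t i - f s i| <= picard_modulus t - picard_modulus s].

Hypothesis L0 : 0 < L.
Hypothesis A0 : 0 <= A.
Hypothesis G_init : forall t i, 0 <= t -> `|G t x0 i| <= A * expR (2 * L * t).
Hypothesis G_lip : forall t f g (M : R), 0 <= t -> Q t f -> Q t g ->
  (forall i, `|f i - g i| <= M) -> forall i, `|G t f i - G t g i| <= L * M.
Hypothesis G_cont : forall f, picard_class f -> forall i,
  continuous (fun s => G (Num.max 0 s) (f (Num.max 0 s)) i).
Hypothesis Q_init : forall t, 0 <= t -> Q t x0.
Hypothesis Q_lim : forall t (fn : nat -> I -> R) f (C : R), 0 <= t -> (forall n, Q t (fn n)) ->
  (forall n i, `|f i - fn n i| <= C / 2 ^+ n) -> Q t f.
Hypothesis Q_step : forall f (F : R -> I -> R), picard_class f -> (forall i, F 0 i = x0 i) ->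
  (forall t i, 0 <= t -> is_derive t 1 (F^~ i) (G t (f t) i)) ->
  forall t, 0 <= t -> Q t (F t).

Definition picard_map (f : R -> I -> R) t i : R :=
  x0 i + primitive (fun s => G (Num.max 0 s) (f (Num.max 0 s)) i) t.

Lemma picard_map_init f i : picard_map f 0 i = x0 i.
Proof. by rewrite /picard_map primitive0 addr0. Qed.

Lemma picard_map_derive f : picard_class f -> forall t i, 0 <= t ->
  is_derive t 1 ((picard_map f)^~ i) (G t (f t) i).
Proof.
move=> Sf t i t0.
have := is_deriveDf (is_derive_cstf (x0 i) t) (is_derive_primitive t (@G_cont f Sf i)).
by rewrite add0r max_r.
Qed.

Lemma is_derive_picard_modulus t :
  is_derive t 1 picard_modulus (2 * A * expR (2 * L * t)).
Proof.
have := is_deriveZf (A / L) (is_derive_exp_lin (2 * L) t).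
by rewrite (_ : A / L * (2 * L * _) = 2 * A * expR (2 * L * t)) //; field; rewrite gt_eqF.
Qed.

Lemma picard_map_class f : picard_class f -> picard_class (picard_map f).
Proof.
move=> Sf; have [fQ f0 fB] := Sf; have dF := picard_map_derive Sf; split.
- by apply: Q_step => // i; exact: picard_map_init.
- exact: picard_map_init.
move=> s t i s0 st.
apply: (normr_ler_of_derive (f := (picard_map f)^~ i)) => //.
- apply: (is_derive_within (f' := fun r => G r (f r) i)) => r /=.
  by rewrite in_itv/= => /andP[sr _]; apply: dF; exact: le_trans sr.
- by apply: is_derive_within => r _; exact: is_derive_picard_modulus.
move=> r /andP[sr rt]; have r0 : 0 <= r by rewrite (le_trans s0)// ltW.
exists (G r (f r) i), (2 * A * expR (2 * L * r)); split; [exact: dF|exact: is_derive_picard_modulus|].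
rewrite -(subrK (G r x0 i) (G r (f r) i)); apply: le_trans (ler_normD _ _) _.
have H1 : forall i, `|f r i - x0 i| <= A / L * expR (2 * L * r).
  move=> j; have := fB 0 r j (lexx _) r0; rewrite f0 => /le_trans; apply.
  by rewrite /picard_modulus gerBl mulr_ge0 ?divr_ge0 ?expR_ge0// ltW.
have := G_lip r0 (fQ _ r0) (Q_init r0) H1 i; have := G_init i r0.
rewrite (_ : L * _ = A * expR (2 * L * r)); last by field; rewrite gt_eqF.
lra.
Qed.

Lemma picard : exists X, picard_class X /\
  forall t i, 0 <= t -> is_derive t 1 (X^~ i) (G t (X t) i).
Proof.
pose X n := iter n picard_map (fun _ => x0).
have SX n : picard_class (X n).
  elim: n => [|n IH]; last exact: picard_map_class.
  split => // s t i s0 st; rewrite subrr normr0 subr_ge0 /picard_modulus.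
  apply: ler_wpM2l; first by rewrite divr_ge0// ltW.
  by rewrite ler_expR ler_wpM2l// mulr_ge0// ltW.
have step f g M : picard_class f -> picard_class g -> 0 <= M ->
    (forall t i, 0 <= t -> `|f t i - g t i| <= M * expR (2 * L * t)) ->
    forall t i, 0 <= t -> `|picard_map f t i - picard_map g t i| <= M / 2 * expR (2 * L * t).
  move=> Sf Sg M0 fg t i t0.
  have dfg s : 0 <= s -> is_derive s 1 (fun s => picard_map f s i - picard_map g s i)
     (G s (f s) i - G s (g s) i).
    by move=> s0; apply: is_deriveBf; exact: picard_map_derive.
  apply: (contraction_step (T := t + 1) (y := fun s => picard_map f s i - picard_map g s i)
    (y' := fun s => G s (f s) i - G s (g s) i)) => //.
  - by rewrite t0/= lerDl.
  - by rewrite !picard_map_init subrr.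
  - by apply: is_derive_within => s /=; rewrite in_itv/= => /andP[s0 _]; exact: dfg.
  - by move=> s /andP[/ltW s0 _]; exact: dfg.
  move=> s /andP[/ltW s0 _]; apply: G_lip => // [||j]; last exact: fg.
    by have [+ _ _] := Sf; exact.
  by have [+ _ _] := Sg; exact.
have AL : 0 <= A / L by rewrite divr_ge0// ltW.
have XX n t i : 0 <= t -> `|X n.+1 t i - X n t i| <= A / L / 2 ^+ n * expR (2 * L * t).
  elim: n t i => [|n IH] t i t0.
    have [_ X0 XB] := SX 1%N.
    have := XB 0 t i (lexx _) t0; rewrite X0 => /le_trans; apply.
    by rewrite /picard_modulus mulr0 expR0 expr0 divr1; lra.
  have -> : A / L / 2 ^+ n.+1 = A / L / 2 ^+ n / 2.
    by rewrite exprS invfM; ring.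
  by apply: (step _ _ _ (SX n.+1) (SX n)) => //; apply: divr_ge0; [|exact/ltW/expr2_gt0].
have Xlim t i : exists l, 0 <= t -> forall n, `|l - X n t i| <= 2 * (A / L * expR (2 * L * t)) / 2 ^+ n.
  have [t0|_] := boolP (0 <= t); last by exists 0.
  have [|l Hl] := @geometric_limit (fun n => X n t i) (A / L * expR (2 * L * t)).
    by move=> n; apply: le_trans (XX n t i t0) _; rewrite mulrAC.
  by exists l => _.
pose Y t i := sval (cid (Xlim t i)).
have HY t i n : 0 <= t -> `|Y t i - X n t i| <= 2 * (A / L * expR (2 * L * t)) / 2 ^+ n.
  by move=> t0; exact: (svalP (cid (Xlim t i))).
have lim_le (z : R) (C : R) b : (forall n, z <= b + C / 2 ^+ n) -> z <= b.
  move=> H; apply/ler_addgt0Pr => e /(half_pow_small C)[n Hn].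
  by apply: le_trans (H n) _; rewrite lerD2l.
have SY : picard_class Y.
  split.
  - move=> t t0; apply: (Q_lim (fn := fun n => X n t) (C := 2 * (A / L * expR (2 * L * t)))) => // [n|n i].
      by have [+ _ _] := SX n; exact.
    exact: HY.
  - move=> i; apply/eqP; rewrite -subr_eq0 -normr_le0.
    apply: (lim_le _ (2 * (A / L * expR (2 * L * 0)))) => n; rewrite add0r.
    by have := HY 0 i n (lexx _); have [_ -> _] := SX n.
  move=> s t i s0 st; have t0 := le_trans s0 st.
  apply: (lim_le _ (2 * (A / L * expR (2 * L * t)) + 2 * (A / L * expR (2 * L * s)))) => n.
  have -> : Y t i - Y s i = (X n t i - X n s i) + ((Y t i - X n t i) - (Y s i - X n s i)) by ring.
  apply: le_trans (ler_normD _ _) _; apply: lerD.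
    by have [_ _ +] := SX n; exact.
  apply: le_trans (ler_normB _ _) _; rewrite mulrDl; apply: lerD; exact: HY.
have fix_Y t i : 0 <= t -> picard_map Y t i = Y t i.
  move=> t0; apply/eqP; rewrite -subr_eq0 -normr_le0.
  apply: (lim_le _ (2 * (A / L * expR (2 * L * t)))) => n; rewrite add0r.
  have -> : picard_map Y t i - Y t i = (picard_map Y t i - X n.+1 t i) - (Y t i - X n.+1 t i) by ring.
  apply: le_trans (ler_normB _ _) _.
  have H1 := HY t i n.+1 t0.
  have H2 : `|picard_map Y t i - picard_map (X n) t i| <= 2 * (A / L) / 2 ^+ n / 2 * expR (2 * L * t).
    apply: (step _ _ _ SY (SX n)) => //; first by apply: divr_ge0; [exact: mulr_ge0|exact/ltW/expr2_gt0].
    by move=> s j s0; apply: le_trans (HY s j n s0) _; apply: eq_ler; ring.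
  have -> : 2 * (A / L * expR (2 * L * t)) / 2 ^+ n =
     2 * (A / L) / 2 ^+ n / 2 * expR (2 * L * t) + 2 * (A / L * expR (2 * L * t)) / 2 ^+ n.+1.
    by rewrite exprS invfM; field; rewrite !gt_eqF ?expr2_gt0.
  exact: lerD.
(* [Y] is arbitrary at negative times, so it need not be differentiable at [0]. Its image under the
   Picard map agrees with it for [t >= 0] and reads it only there, so it has a two-sided derivative
   at [0] too. *)
exists (picard_map Y); split; first exact: picard_map_class.
move=> t i t0; have -> : G t (picard_map Y t) i = G t (Y t) i.
  by congr (G t _ i); apply/funext => j; exact: fix_Y.
exact: picard_map_derive.
Qed.
End Picard.

(** * Integrals against a fixed weight *)

Lemma Rintegral_itv_setT {R : realType} (f : R -> R) (a b : R) :
  (forall y, y \notin `[a, b] -> f y = 0) ->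
  \int[lebesgue_measure]_y f y = \int[lebesgue_measure]_(y in `[a, b]) f y.
Proof.
move=> f0; rewrite [RHS]Rintegral_mkcond; apply: eq_Rintegral => y _.
rewrite patchE; case: ifPn => // yab; rewrite f0//.
by apply: contraNN yab => /= H; exact/mem_set.
Qed.

Section Weight.
Context {R : realType}.
Notation mu := (@lebesgue_measure R).
Variables (a b : R) (w : R -> R).
Implicit Types (g h : R -> R) (t s x y C M : R).
Hypothesis iw : mu.-integrable `[a, b] (EFin \o w).

(** The weight stands for a density, [rho0] or [rho t]. Its sign is left free, also because
    differences of densities occur as weights; hence the absolute value in [wmass]. *)
Definition wint g : R := \int[mu]_(y in `[a, b]) (g y * w y).
Definition wmass : R := \int[mu]_(y in `[a, b]) `|w y|.

Lemma continuous_bounded_itv g : continuous g ->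
  exists2 C, 0 <= C & forall y, y \in `[a, b] -> `|g y| <= C.
Proof.
move=> cg; have [ab|ba] := leP a b; last first.
  by exists 0 => // y; rewrite in_itv/= => /andP[ay yb]; have := le_trans ay yb; rewrite leNgt ba.
have cn : {within `[a, b], continuous (fun y => `|g y|)}.
  by apply: continuous_within => y; apply: continuous_comp; [exact: cg|exact: norm_continuous].
by have [c _ H] := EVT_max ab cn; exists `|g c|.
Qed.

Lemma bounded_mul_integrable g C : measurable_fun [set: R] g ->
  (forall y, y \in `[a, b] -> `|g y| <= C) ->
  mu.-integrable `[a, b] (EFin \o (fun y => g y * w y)).
Proof.
move=> mg gC.
have : mu.-integrable `[a, b] ((EFin \o g) \* (EFin \o w))%E.
  apply: integrableMr => //; first exact: measurable_funTS.
  exists C; split; first exact: num_real.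
  by move=> M CM y yab; apply: le_trans (ltW CM); apply: gC.
exact: eq_integrable.
Qed.

Lemma wint_integrable g : continuous g ->
  mu.-integrable `[a, b] (EFin \o (fun y => g y * w y)).
Proof.
move=> cg; have [C _ gC] := continuous_bounded_itv cg.
exact: (bounded_mul_integrable (measurable_realfun.continuous_measurable_fun cg) gC).
Qed.

Lemma integrable_scaled_norm C :
  mu.-integrable `[a, b] (EFin \o (fun y => C * `|w y|)).
Proof.
have /(integrableZl _ C) H := integrable_norm iw.
exact: eq_integrable (H _).
Qed.

Lemma wintD g h : continuous g -> continuous h ->
  wint (fun y => g y + h y) = wint g + wint h.
Proof.
move=> cg ch; rewrite /wint -RintegralD//; try exact: wint_integrable.
by apply: eq_Rintegral => y _; rewrite mulrDl.
Qed.

Lemma wintB g h : continuous g -> continuous h ->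
  wint (fun y => g y - h y) = wint g - wint h.
Proof.
move=> cg ch; rewrite /wint -RintegralB//; try exact: wint_integrable.
by apply: eq_Rintegral => y _; rewrite mulrBl.
Qed.

Lemma wintZ x g : continuous g -> wint (fun y => x * g y) = x * wint g.
Proof.
move=> cg; rewrite /wint -RintegralZl//; try exact: wint_integrable.
by apply: eq_Rintegral => y _; rewrite mulrA.
Qed.

Lemma eq_wint g h : (forall y, y \in `[a, b] -> g y = h y) -> wint g = wint h.
Proof. by move=> gh; apply: eq_Rintegral => y /set_mem yab; rewrite gh. Qed.

Lemma wmass_ge0 : 0 <= wmass.
Proof. exact: Rintegral_ge0. Qed.

Lemma normr_wint g C : continuous g -> (forall y, y \in `[a, b] -> `|g y| <= C) ->
  `|wint g| <= wmass * C.
Proof.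
move=> cg gC; apply: (le_trans (le_normr_Rintegral _ (wint_integrable cg))) => //.
rewrite mulrC /wmass -RintegralZl//; last exact: integrable_norm.
apply: le_Rintegral => //.
- exact: (integrable_norm (wint_integrable cg)).
- exact: integrable_scaled_norm.
- by move=> y yab; rewrite normrM ler_wpM2r// gC.
Qed.

Lemma normr_wintB g h C : continuous g -> continuous h ->
  (forall y, y \in `[a, b] -> `|g y - h y| <= C) -> `|wint g - wint h| <= wmass * C.
Proof.
move=> cg ch H; rewrite -wintB//; apply: normr_wint => //.
by move=> y; exact: continuousB (cg y) (ch y).
Qed.

Lemma wint_ge0 g : (forall y, 0 <= w y) -> (forall y, 0 <= g y) -> 0 <= wint g.
Proof. by move=> w0 g0; apply: Rintegral_ge0 => y _; rewrite mulr_ge0. Qed.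

Lemma is_derive_wint (F F' : R -> R -> R) u v t C : u < t < v ->
  (forall s, u < s < v -> continuous (F s)) ->
  (forall s y, u < s < v -> y \in `[a, b] -> is_derive s 1 (F^~ y) (F' s y)) ->
  (forall s y, u < s < v -> y \in `[a, b] -> `|F' s y| <= C) ->
  is_derive t 1 (fun s => wint (F s)) (wint (F' t)).
Proof.
move=> utv cF dF F'C.
pose f s y := F s y * w y.
have tI : t \in `]u, v[ by rewrite in_itv.
have H1 s : `]u, v[%classic s -> mu.-integrable `[a, b] (EFin \o f s).
  by rewrite /= in_itv/= => /cF; exact: wint_integrable.
have df s y : `]u, v[%classic s -> `[a, b]%classic y ->
    is_derive s 1 (f^~ y) (F' s y * w y).
  rewrite /= in_itv/= => sI yI.
  have := is_deriveMf (dF _ _ sI yI) (is_derive_cstf (w y) s).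
  by rewrite mulr0 addr0.
have H2 s y : `]u, v[%classic s -> `[a, b]%classic y -> derivable (f^~ y) s 1.
  by move=> sI yI; exact: (ex_derive (is_derive := df _ _ sI yI)).
have iG : mu.-integrable `[a, b] (EFin \o (fun y => `|C| * `|w y|)).
  exact: integrable_scaled_norm.
have H3 s y : `]u, v[%classic s -> `[a, b]%classic y ->
    `|partial1of2 f s y| <= `|C| * `|w y|.
  move=> sI yI; rewrite partial1of2E -derive1E (is_derive_derive1 (df _ _ sI yI)) normrM.
  rewrite ler_wpM2r//; apply: le_trans (ler_norm _).
  by apply: F'C => //; move: sI; rewrite /= in_itv.
have G0 y : 0 <= `|C| * `|w y| by rewrite mulr_ge0.
have mI : measurable (`[a, b]%classic : set (measurableTypeR R)) by [].
have := derivable_under_integral (mu := mu) mI tI H1 H2 G0 iG H3.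
have := differentiation_under_integral (mu := mu) mI tI H1 H2 G0 iG H3.
move=> E D; have := derivable_is_derive D; rewrite E; congr is_derive.
apply: eq_Rintegral => y /set_mem yI.
by rewrite partial1of2E -derive1E (is_derive_derive1 (df _ _ _ yI)).
Qed.

Lemma wint_setT g : (forall y, y \notin `[a, b] -> w y = 0) ->
  \int[mu]_y (g y * w y) = wint g.
Proof.
move=> w0; rewrite /wint; apply: Rintegral_itv_setT => y /w0 ->; exact: mulr0.
Qed.
End Weight.

(** * The flow in Lagrangian coordinates *)

Section MoreCalculus.
Context {R : realType}.
Implicit Types (f g h : R -> R) (a b c x y z l t s : R).

Lemma continuous_compf f g : continuous f -> continuous g -> continuous (fun x => f (g x)).
Proof. by move=> cf cg x; apply: continuous_comp; [exact: cg|exact: cf]. Qed.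

Lemma continuousDf f g : continuous f -> continuous g -> continuous (fun x => f x + g x).
Proof. by move=> cf cg x; exact: continuousD (cf x) (cg x). Qed.

Lemma continuousBf f g : continuous f -> continuous g -> continuous (fun x => f x - g x).
Proof. by move=> cf cg x; exact: continuousB (cf x) (cg x). Qed.

Lemma continuousMf f g : continuous f -> continuous g -> continuous (fun x => f x * g x).
Proof. by move=> cf cg x; exact: continuousM (cf x) (cg x). Qed.

Lemma continuousZf c f : continuous f -> continuous (fun x => c * f x).
Proof. by move=> cf; apply: continuousMf => // x; exact: cst_continuous. Qed.

Lemma is_derive_all_continuous f (f' : R -> R) : (forall x, is_derive x 1 f (f' x)) -> continuous f.
Proof. by move=> H x; exact: is_derive_continuous (H x). Qed.

Lemma lipschitz_continuous l f : (forall x y, `|f x - f y| <= l * `|x - y|) -> continuous f.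
Proof.
move=> H x; apply/continuousP_eps => e e0.
exists (e / (`|l| + 1)) => [|y]; first exact: divr_gt0.
rewrite ltr_pdivlMr// => yx; apply: le_trans (H _ _) _; apply: le_trans (ltW yx).
by rewrite mulrC ler_wpM2l// (le_trans (ler_norm _))// lerDl.
Qed.

Lemma continuous_dominated g h : continuous h ->
  (forall x y, x <= y -> `|g y - g x| <= h y - h x) -> continuous g.
Proof.
move=> ch H x; apply/continuousP_eps => e e0.
have /continuousP_eps/(_ _ e0)[d d0 Hd] := ch x.
exists d => // y /Hd; apply: le_trans.
have [xy|/ltW yx] := leP x y; first by apply: le_trans (H _ _ xy) (ler_norm _).
by rewrite distrC (distrC (h y)); apply: le_trans (H _ _ yx) (ler_norm _).
Qed.

Lemma max0_lip x y : x <= y -> `|Num.max 0 y - Num.max 0 x| <= y - x.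
Proof.
move=> xy; rewrite ger0_norm; last first.
  by rewrite subr_ge0 ge_max !le_max lexx/= xy orbT.
by rewrite /Num.max; case: ifPn; case: ifPn; rewrite -?leNgt; lra.
Qed.

Lemma continuous_max0 : continuous (fun s : R => Num.max 0 s : R).
Proof.
apply: (@continuous_dominated (fun s => Num.max 0 s) id) => [x|x y]; [exact: cvg_id|exact: max0_lip].
Qed.

Lemma max0_ge0 s : 0 <= Num.max 0 s.
Proof. by rewrite le_max lexx. Qed.

Lemma max0_homo s t : s <= t -> Num.max 0 s <= Num.max 0 t.
Proof. by move=> st; rewrite ge_max !le_max lexx/= st orbT. Qed.

Lemma mean_value f (f' : R -> R) x y : (forall z : R, is_derive z 1 f (f' z)) ->
  exists2 c, `|c - x| <= `|y - x| & f y - f x = f' c * (y - x).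
Proof.
move=> df; have cf := is_derive_all_continuous df.
have [xy|yx|<-] := ltgtP x y; last first.
- by exists x; rewrite ?subrr ?mulr0.
- have [c] := MVT yx (fun z _ => df z) (@continuous_within _ f _ cf).
  rewrite in_itv/= => /andP[yc cx] E; exists c; last by rewrite -opprB E; ring.
  by rewrite !ler0_norm; lra.
- have [c] := MVT xy (fun z _ => df z) (@continuous_within _ f _ cf).
  rewrite in_itv/= => /andP[yc cx] E; exists c; last by rewrite E.
  by rewrite !ger0_norm; lra.
Qed.

Lemma taylor1_lip f (f' : R -> R) l x y : (forall z : R, is_derive z 1 f (f' z)) ->
  (forall z z', `|f' z - f' z'| <= l * `|z - z'|) ->
  `|f y - f x - f' x * (y - x)| <= l * (y - x) ^+ 2.
Proof.
move=> df lf; have [c cx ->] := mean_value x y df.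
rewrite -mulrBl normrM -[_ ^+ 2]ger0_norm ?sqr_ge0// normrX expr2 mulrA ler_wpM2r//.
have [yx|yx] := eqVneq y x.
  move: cx; rewrite yx subrr normr0 normr_le0 subr_eq0 => /eqP ->.
  by rewrite subrr normr0 mulr0.
have l0 : 0 <= l.
  have := le_trans (normr_ge0 _) (lf y x).
  by rewrite pmulr_lge0// normr_gt0 subr_eq0.
by apply: le_trans (lf _ _) _; rewrite ler_wpM2l.
Qed.
Lemma dist_lt_le (r s t : R) : `|s - t| < r - t -> s <= r.
Proof. by rewrite ltr_norml => /andP[_]; lra. Qed.

Lemma itv_near_itv (K D x b : R) : b \in `[(- K), K] -> `|x - b| <= D ->
  x \in `[(- K - D), (K + D)].
Proof.
rewrite !in_itv/= ler_norml => /andP[h1 h2] /andP[h3 h4].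
by apply/andP; split; lra.
Qed.

Lemma quotient_close (c N D h n1 n2 d1 d2 : R) : 0 < c -> c <= d1 -> c <= d2 ->
  `|n2| <= N -> `|n1 - n2| <= h -> `|d1 - d2| <= D * h ->
  `|n1 / d1 - n2 / d2| <= (c^-1 + N * D * (c^-1 * c^-1)) * h.
Proof.
move=> c0 cd1 cd2 nN n12 d12.
have d10 : 0 < d1 by exact: lt_le_trans cd1.
have d20 : 0 < d2 by exact: lt_le_trans cd2.
have -> : n1 / d1 - n2 / d2 = d1^-1 * (n1 - n2) - n2 * (d1 - d2) * (d1^-1 * d2^-1).
  by field; rewrite !gt_eqF.
have ic (d : R) : c <= d -> `|d^-1| <= c^-1.
  by move=> cd; rewrite gtr0_norm ?invr_gt0 ?(lt_le_trans c0)// lef_pV2// posrE// (lt_le_trans c0).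
apply: le_trans (ler_normB _ _) _; rewrite mulrDl; apply: lerD.
  by rewrite normrM; apply: ler_pM => //; exact: ic.
rewrite !normrM [leRHS]mulrAC; apply: ler_pM; [exact: mulr_ge0|exact: mulr_ge0| |].
  by rewrite -mulrA; apply: ler_pM.
by apply: ler_pM => //; exact: ic.
Qed.
End MoreCalculus.

(** * Global existence of the flow *)

Section LagrangianFlow.
Context {R : realType}.
Notation mu := (@lebesgue_measure R).
Implicit Types (a b c x y l t s T : R).
Variables (K : R) (w : R -> R).
Hypothesis iw : mu.-integrable `[(- K), K] (EFin \o w).
Notation E := (wint (- K) K w).
Notation m := (wmass (- K) K w).
Variables (ga ubar : R) (Psi psi w0 w1 : R -> R) (p0 W U : R).
Hypothesis ga0 : 0 < ga.
Hypothesis dPsi : forall y, is_derive y 1 Psi (psi y).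
Hypothesis psi_le : forall y, `|psi y| <= p0.
Hypothesis dw0 : forall a, is_derive a 1 w0 (w1 a).
Hypothesis w1_le : forall a, `|w1 a| <= W.
Hypothesis u0_le : forall a, `|w0 a - ga * a - E (fun b => Psi (a - b))| <= U.

Let m0 : 0 <= m := wmass_ge0 _ _ _.
Let p00 : 0 <= p0 := le_trans (normr_ge0 _) (psi_le 0).
Let W0 : 0 <= W := le_trans (normr_ge0 _) (w1_le 0).
Let U0 : 0 <= U := le_trans (normr_ge0 _) (u0_le 0).
Let cPsi : continuous Psi := is_derive_all_continuous dPsi.

Lemma kernel_primitive_lip x y : `|Psi x - Psi y| <= p0 * `|x - y|.
Proof. exact: lipschitz_of_derive. Qed.

Definition flow_rhs t (f : R -> R) a : R :=
  w0 a + ubar * ga * t - ga * f a - E (fun b => Psi (f a - f b)).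

(** The factor 2 arises because both [f a] and [f b] vary inside [Psi (f a - f b)]. The added 1
    ensures [t <= 1 + 2 * flow_rate * t], so that the linear drift [ubar * ga * t] is absorbed by
    the exponential. In [flow_size], [U] bounds the initial velocity. *)
Definition flow_rate : R := ga + 2 * p0 * m + 1.
Definition flow_size : R := U + `|ubar * ga|.
(** Growth rate of the Lipschitz constant in the label. When two labels are compared, the integrated
    position [f c] is common to both and cancels, hence [m * p0] without the factor 2. *)
Definition flow_lip : R := W + ga + m * p0.
Definition flow_modulus : R -> R := picard_modulus flow_rate flow_size.

Definition is_flow (X : R -> R -> R) :=
  [/\ forall a, X 0 a = a,
      forall t a b, 0 <= t -> `|X t a - X t b| <= expR (flow_lip * t) * `|a - b|,
      forall s t a, 0 <= s -> s <= t -> `|X t a - X s a| <= flow_modulus t - flow_modulus s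
    & forall t a, 0 <= t -> is_derive t 1 (X^~ a) (flow_rhs t (X t) a)].

Let rate0 : 0 < flow_rate.
Proof. by rewrite /flow_rate addr_gt0// ltr_wpDr// mulr_ge0// mulr_ge0. Qed.
Let lip0 : 0 <= flow_lip.
Proof. by rewrite /flow_lip addr_ge0 ?mulr_ge0// addr_ge0// ltW. Qed.
Let size0 : 0 <= flow_size.
Proof. by rewrite addr_ge0. Qed.

Lemma continuous_kernel_comp (k f : R -> R) x : continuous k -> continuous f ->
  continuous (fun b => k (x - f b)).
Proof.
move=> ck cf; apply: (continuous_compf ck) => y.
by apply: continuousB; [exact: cst_continuous|exact: cf].
Qed.

(** Closeness is asked only on the support of the weight and at [a]: the uniqueness argument
    controls trajectories of bounded labels only. *)
Lemma flow_rhs_lip t f g M : continuous f -> continuous g ->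
  (forall b, b \in `[(- K), K] -> `|f b - g b| <= M) ->
  forall a, `|f a - g a| <= M -> `|flow_rhs t f a - flow_rhs t g a| <= flow_rate * M.
Proof.
move=> cf cg fg a fga; have M0 : 0 <= M := le_trans (normr_ge0 _) fga.
have H : `|E (fun b => Psi (f a - f b)) - E (fun b => Psi (g a - g b))| <= m * (p0 * (2 * M)).
  apply: normr_wintB => //; try exact: continuous_kernel_comp.
  move=> b bK; apply: le_trans (kernel_primitive_lip _ _) _; rewrite ler_wpM2l//.
  have -> : f a - f b - (g a - g b) = (f a - g a) - (f b - g b) by ring.
  by apply: le_trans (ler_normB _ _) _; have := fg b bK; lra.
have -> : flow_rhs t f a - flow_rhs t g a = - (ga * (f a - g a)) -
   (E (fun b => Psi (f a - f b)) - E (fun b => Psi (g a - g b))) by rewrite /flow_rhs; ring.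
apply: le_trans (ler_normB _ _) _; rewrite normrN normrM (gtr0_norm ga0).
apply: le_trans (lerD (ler_wpM2l (ltW ga0) fga) H) _; rewrite /flow_rate.
have -> : (ga + 2 * p0 * m + 1) * M = ga * M + m * (p0 * (2 * M)) + M by ring.
by rewrite lerDl.
Qed.

(** The iteration starts from the identity. It carries along a Lipschitz bound in the label with
    constant [expR (flow_lip * t)]: continuity of the profile makes the integrals over labels
    meaningful, and an explicit constant, unlike bare continuity, passes to the limit. *)
Lemma flow_exists : exists X, is_flow X.
Proof.
pose Q t (f : R -> R) := forall a b, `|f a - f b| <= expR (flow_lip * t) * `|a - b|.
have Qc t f : Q t f -> continuous f by exact: lipschitz_continuous.
have e1 (c t : R) : 0 <= c -> 0 <= t -> 1 <= expR (c * t).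
  by move=> c0 t0; rewrite -(@expR0 R) ler_expR mulr_ge0.
have Q0 t : 0 <= t -> Q t id by move=> t0 a b; rewrite ler_peMl// e1.
have Qlim t (fn : nat -> R -> R) f (C : R) : 0 <= t -> (forall n, Q t (fn n)) ->
    (forall n i, `|f i - fn n i| <= C / 2 ^+ n) -> Q t f.
  move=> t0 Qn H a b; apply/ler_addgt0Pr => e /(half_pow_small (2 * C))[n Hn].
  have -> : f a - f b = (fn n a - fn n b) + ((f a - fn n a) - (f b - fn n b)) by ring.
  apply: le_trans (ler_normD _ _) _; apply: lerD; first exact: Qn.
  apply: le_trans (ler_normB _ _) _; apply: le_trans Hn.
  by have := H n a; have := H n b; rewrite -mulrA; lra.
have Ginit t a : 0 <= t -> `|flow_rhs t id a| <= flow_size * expR (2 * flow_rate * t).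
  move=> t0; have -> : flow_rhs t id a =
     (w0 a - ga * a - E (fun b => Psi (a - b))) + ubar * ga * t by rewrite /flow_rhs; ring.
  apply: le_trans (ler_normD _ _) _; rewrite /flow_size mulrDl; apply: lerD.
    by apply: (le_trans (u0_le a)); rewrite ler_peMr// e1// mulr_ge0// ltW.
  rewrite normrM ler_wpM2l// ger0_norm//.
  apply: le_trans (_ : 1 + 2 * flow_rate * t <= _); last exact: expR_ge1Dx.
  by have := rate0; have := mulr_ge0 (mulr_ge0 p00 m0) t0; have := mulr_ge0 (ltW ga0) t0;
    rewrite /flow_rate; nra.
have Glip t f g M : 0 <= t -> Q t f -> Q t g -> (forall i, `|f i - g i| <= M) ->
    forall i, `|flow_rhs t f i - flow_rhs t g i| <= flow_rate * M.
  by move=> t0 Qf Qg fg a; apply: flow_rhs_lip => //; exact: Qc.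
have Gcont f : picard_class flow_rate flow_size id Q f -> forall i,
    continuous (fun s => flow_rhs (Num.max 0 s) (f (Num.max 0 s)) i).
  move=> [Qf f0 fB] a.
  pose h s := `|ubar * ga| * Num.max 0 s + flow_rate * flow_modulus (Num.max 0 s).
  have cB : continuous flow_modulus by apply: is_derive_all_continuous => t; exact: is_derive_picard_modulus.
  have ch : continuous h.
    apply: continuousDf; apply: continuousZf; first exact: continuous_max0.
    exact: (continuous_compf cB continuous_max0).
  apply: (continuous_dominated ch) => s t /max0_homo; rewrite /h.
  move: (max0_ge0 s) (max0_ge0 t); move: (Num.max 0 s) (Num.max 0 t) => {}s {}t s0 t0 st.
  have -> : flow_rhs t (f t) a - flow_rhs s (f s) a =
     ubar * ga * (t - s) + (flow_rhs t (f t) a - flow_rhs t (f s) a).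
    by rewrite /flow_rhs; ring.
  apply: le_trans (ler_normD _ _) _.
  have H1 : `|flow_rhs t (f t) a - flow_rhs t (f s) a| <= flow_rate * (flow_modulus t - flow_modulus s).
    apply: flow_rhs_lip; [exact: Qc (Qf _ t0)|exact: Qc (Qf _ s0)| |].
      by move=> b _; exact: fB.
    exact: fB.
  rewrite normrM (ger0_norm (x := t - s)) ?subr_ge0//; nra.
have Qstep f F : picard_class flow_rate flow_size id Q f -> (forall i, F 0 i = i) ->
    (forall t i, 0 <= t -> is_derive t 1 (F^~ i) (flow_rhs t (f t) i)) ->
    forall t, 0 <= t -> Q t (F t).
  move=> [Qf f0 fB] F0 dF t t0 a b.
  have dd s : 0 <= s -> is_derive s 1 (fun s => F s a - F s b)
      (flow_rhs s (f s) a - flow_rhs s (f s) b).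
    by move=> s0; apply: is_deriveBf; exact: dF.
  have de s : is_derive s 1 (fun s => `|a - b| * expR (flow_lip * s))
     (`|a - b| * (flow_lip * expR (flow_lip * s))) by exact: is_deriveZf (is_derive_exp_lin _ _).
  have H : `|(F t a - F t b) - (F 0 a - F 0 b)| <=
     `|a - b| * expR (flow_lip * t) - `|a - b| * expR (flow_lip * 0).
    apply: (normr_ler_of_derive (f := fun s => F s a - F s b)
      (g := fun s => `|a - b| * expR (flow_lip * s))) => //.
    - by apply: is_derive_within => s /=; rewrite in_itv/= => /andP[s0 _]; exact: dd.
    - by apply: is_derive_within => s _; exact: de.
    move=> s /andP[/ltW s0 _].
    exists (flow_rhs s (f s) a - flow_rhs s (f s) b), (`|a - b| * (flow_lip * expR (flow_lip * s))).
    split; [exact: dd|exact: de|].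
    have cfs := Qc _ _ (Qf _ s0).
    have H1 : `|E (fun c => Psi (f s a - f s c)) - E (fun c => Psi (f s b - f s c))|
       <= m * (p0 * `|f s a - f s b|).
      apply: normr_wintB => //; try exact: continuous_kernel_comp.
      move=> c _; apply: le_trans (kernel_primitive_lip _ _) _.
      by have -> : f s a - f s c - (f s b - f s c) = f s a - f s b by ring.
    have -> : flow_rhs s (f s) a - flow_rhs s (f s) b = (w0 a - w0 b) - ga * (f s a - f s b)
      - (E (fun c => Psi (f s a - f s c)) - E (fun c => Psi (f s b - f s c))).
      by rewrite /flow_rhs; ring.
    apply: le_trans (ler_normB _ _) _; apply: le_trans (lerD (ler_normB _ _) H1) _.
    rewrite normrM (gtr0_norm ga0) -addrA mulrA -mulrDl.
    have H2 := lipschitz_of_derive dw0 w1_le a b.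
    have H3 : (ga + m * p0) * `|f s a - f s b| <= (ga + m * p0) * (expR (flow_lip * s) * `|a - b|).
      by rewrite ler_wpM2l ?Qf// addr_ge0 ?mulr_ge0// ltW.
    have H4 : W * `|a - b| <= W * (expR (flow_lip * s) * `|a - b|).
      by rewrite ler_wpM2l// ler_peMl// e1.
    apply: (le_trans (lerD (le_trans H2 H4) H3)); apply: eq_ler; rewrite /flow_lip; ring.
  rewrite !F0 mulr0 expR0 mulr1 in H.
  have -> : F t a - F t b = (F t a - F t b - (a - b)) + (a - b) by ring.
  by apply: le_trans (ler_normD _ _) _; rewrite mulrC; lra.
have [X [[QX X0 BX] dX]] := picard rate0 size0 Ginit Glip Gcont Q0 Qlim Qstep.
by exists X; split => // t a b t0; exact: QX.
Qed.
End LagrangianFlow.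

(** * Essential bounds *)

Section EssentialBounds.
Context {R : realType}.
Notation mu := (@lebesgue_measure R).
Implicit Types (f g : R -> R) (x y t s C e d : R) (T : \bar R).

(** The norm of exponent [+oo] is the essential supremum only on a space of positive measure, so
    this fact is what unfolds it. *)
Lemma lebesgue_measure_setT_gt0 : (0 < mu [set: R])%E.
Proof.
apply: (@lt_le_trans _ _ (mu `[0, 1]%classic)); last by apply: le_measure; rewrite ?inE.
by rewrite lebesgue_measure_itv/= lte_fin ltr01 -EFinB lte_fin subr0 ltr01.
Qed.

Lemma ae_imply (P Q : R -> Prop) : (forall x, P x -> Q x) ->
  {ae mu, forall x, P x} -> {ae mu, forall x, Q x}.
Proof. by move=> PQ; apply: filterS PQ; exact: (ae_filter_ringOfSetsType mu). Qed.

Lemma ae_imply2 (P Q S : R -> Prop) : (forall x, P x -> Q x -> S x) ->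
  {ae mu, forall x, P x} -> {ae mu, forall x, Q x} -> {ae mu, forall x, S x}.
Proof. by move=> PQS; apply: filterS2 PQS; exact: (ae_filter_ringOfSetsType mu). Qed.

Lemma ae_all (P : R -> Prop) : (forall x, P x) -> {ae mu, forall x, P x}.
Proof. by move=> H; exact: aeW. Qed.

Lemma Lnormoo_le f C :
  ('N[mu]_+oo[EFin \o f] <= C%:E)%E <-> {ae mu, forall x, `|f x| <= C}.
Proof.
rewrite unlock /Lnorm lebesgue_measure_setT_gt0; split.
  by move=> /ess_supP; apply: ae_imply => x /=; rewrite lee_fin.
by move=> H; apply/ess_supP; apply: ae_imply H => x /=; rewrite lee_fin.
Qed.

Lemma Lfun_oo_of_bounded f C : continuous f -> (forall x, `|f x| <= C) ->
  f \in Lfun mu +oo%E.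
Proof.
move=> cf fC; rewrite inE; apply/andP; split; rewrite inE/=.
  exact: measurable_realfun.continuous_measurable_fun.
by rewrite /finite_norm; apply: (@le_lt_trans _ _ C%:E); [exact/Lnormoo_le/ae_all|exact: ltry].
Qed.

Lemma Lfun_oo_ae f : f \in Lfun mu +oo%E ->
  measurable_fun [set: R] f /\ exists2 C, 0 <= C & {ae mu, forall x, `|f x| <= C}.
Proof.
rewrite inE => /andP[]; rewrite !inE/= => mf; rewrite /finite_norm => foo; split => //.
exists (fine 'N[mu]_+oo[EFin \o f]%E); first by rewrite fine_ge0// Lnorm_ge0.
apply/Lnormoo_le.
by rewrite fineK// ge0_fin_numE// Lnorm_ge0.
Qed.

Lemma C_Loo_of_uniform T (f : R -> R -> R) :
  (forall t, time_interval T t -> continuous (f t)) ->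
  (forall t, time_interval T t -> exists C, forall x, `|f t x| <= C) ->
  (forall t e, time_interval T t -> 0 < e -> exists2 d, 0 < d &
     forall s, time_interval T s -> `|s - t| < d -> forall x, `|f s x - f t x| <= e) ->
  C_Loo T f.
Proof.
move=> cf bf uf; split=> t It.
  by have [C HC] := bf t It; exact: Lfun_oo_of_bounded (cf t It) HC.
apply/fine_cvgP; split.
  have [d d0 Hd] := uf t 1 It ltr01.
  exists d => // s /= std Is; rewrite ge0_fin_numE ?Lnorm_ge0//.
  apply: (@le_lt_trans _ _ 1%:E); last exact: ltry.
  by apply/Lnormoo_le/ae_all => x /=; apply: Hd => //; rewrite distrC.
apply/cvgrPdist_le => e e0; have [d d0 Hd] := uf t e It e0.
exists d => // s /= std Is; rewrite sub0r normrN.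
have H : ('N[mu]_+oo[EFin \o (f s \- f t)%R] <= e%:E)%E.
  by apply/Lnormoo_le/ae_all => x /=; apply: Hd => //; rewrite distrC.
rewrite ger0_norm ?fine_ge0 ?Lnorm_ge0// -lee_fin fineK//.
by rewrite ge0_fin_numE ?Lnorm_ge0// (le_lt_trans H)// ltry.
Qed.

Lemma C_Loo_ae T (f : R -> R -> R) t e : C_Loo T f -> time_interval T t -> 0 < e ->
  exists2 d, 0 < d & forall s, time_interval T s -> `|s - t| < d ->
    {ae mu, forall x, `|f s x - f t x| <= e}.
Proof.
move=> [_ /(_ t)] + It e0 => /(_ It)/fine_cvgP[[d1 /= d10 H1] /cvgrPdist_le/(_ _ e0)[d2 /= d20 H2]].
exists (Num.min d1 d2) => [|s Is]; first by rewrite lt_min d10.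
rewrite lt_min distrC => /andP[sd1 sd2].
have := H2 s sd2 Is; rewrite sub0r normrN ger0_norm ?fine_ge0 ?Lnorm_ge0// => H.
suff /Lnormoo_le : ('N[mu]_+oo[EFin \o (f s \- f t)%R] <= e%:E)%E by [].
by rewrite -(fineK (H1 s sd1 Is)) lee_fin.
Qed.

Lemma ae_bounded_integrable f a b C : 0 <= C -> measurable_fun [set: R] f ->
  {ae mu, forall x, `|f x| <= C} -> mu.-integrable `[a, b] (EFin \o f).
Proof.
move=> C0 mf fC; apply/integrableP; split.
  by apply/measurable_EFinP; exact: measurable_funTS.
apply: (@le_lt_trans _ _ (\int[mu]_(x in `[a, b]) C%:E)%E).
  apply: ae_ge0_le_integral => //.
  - by apply: measurableT_comp => //; apply/measurable_EFinP; exact: measurable_funTS.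
  - by apply: ae_imply fC => x fx _ /=; rewrite lee_fin.
rewrite integral_cst//= lebesgue_measure_itv/=; case: ifPn => _; last by rewrite mule0 ltry.
by rewrite -EFinB -EFinM ltry.
Qed.

Lemma ae_normr_Rintegral_le f a b C : 0 <= C -> a <= b -> measurable_fun [set: R] f ->
  {ae mu, forall x, x \in `[a, b] -> `|f x| <= C} ->
  mu.-integrable `[a, b] (EFin \o f) ->
  `|\int[mu]_(x in `[a, b]) f x| <= C * (b - a).
Proof.
move=> C0 ab mf fC fi.
apply: (le_trans (le_normr_Rintegral _ fi)) => //.
have -> : C * (b - a) = \int[mu]_(x in `[a, b]) C.
  rewrite Rintegral_cst; last exact: measurable_itv.
  have := @lebesgue_measure_itv R `[a, b]; rewrite /= lte_fin => ->.
  by move: ab; rewrite le_eqVlt => /predU1P[->|->]; rewrite ?ltxx ?subrr// -EFinB.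
rewrite /Rintegral; apply: fine_le.
- exact: integrable_fin_num (integrable_norm fi).
- have cC : continuous (fun _ : R => C) by move=> x; exact: cst_continuous.
  exact: integrable_fin_num (continuous_integrable_itv a b cC).
apply: ae_ge0_le_integral => //.
by apply/measurable_EFinP; apply: measurableT_comp => //; exact: measurable_funTS.
Qed.

Lemma dotW1oo_lipschitz f C : 0 <= C -> dotW1oo f ->
  {ae mu, forall x, `|derive1 f x| <= C} -> forall x y, `|f x - f y| <= C * `|x - y|.
Proof.
move=> C0 [/Lfun_oo_ae[mf' _] Hf] f'C.
have H x y : x <= y -> `|f y - f x| <= C * (y - x).
  move=> xy; rewrite Hf//; apply: ae_normr_Rintegral_le => //; last exact: ae_bounded_integrable f'C.
  by apply: ae_imply f'C.
move=> x y; have [xy|/ltW yx] := leP x y.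
  by rewrite distrC (distrC x) (ger0_norm (x := y - x)) ?subr_ge0// H.
by rewrite (ger0_norm (x := x - y)) ?subr_ge0// H.
Qed.

Lemma dotW1oo_bounded_derive f C : (forall x, derivable f x 1) ->
  (forall x y, `|f x - f y| <= C * `|x - y|) -> forall x, `|derive1 f x| <= C.
Proof.
move=> df lf x; apply/ler_addgt0Pr => e e0.
have /is_deriveP_eps/(_ _ e0)[d d0 Hd] := derivable_is_derive (df x).
have d2 : 0 < d / 2 by rewrite divr_gt0.
have := Hd (x + d / 2); rewrite addrAC subrr add0r (gtr0_norm d2) => /(_ _) H.
have {}H := H (ltac:(lra)).
rewrite -(ler_pM2r d2) mulrDl.
have -> : `|derive1 f x| * (d / 2) = `|derive1 f x * (d / 2)|.
  by rewrite normrM (gtr0_norm d2).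
have -> : derive1 f x * (d / 2) = (f (x + d / 2) - f x)
    - (f (x + d / 2) - f x - derive1 f x * (d / 2)) by ring.
apply: le_trans (ler_normB _ _) (lerD _ H).
by apply: le_trans (lf _ _) _; rewrite addrAC subrr add0r (gtr0_norm d2).
Qed.

Lemma dotW1oo_of_continuous f f' C : (forall x, is_derive x 1 f (f' x)) ->
  continuous f' -> (forall x, `|f' x| <= C) -> dotW1oo f.
Proof.
move=> df cf' f'C.
have -> : dotW1oo f = (f' \in Lfun mu +oo%E /\
  forall a b, a <= b -> f b - f a = \int[mu]_(x in `[a, b]) f' x).
  by rewrite /dotW1oo; have -> : derive1 f = f' by apply/funext => x; exact: is_derive_derive1.
split; first exact: Lfun_oo_of_bounded f'C.
move=> a b; rewrite le_eqVlt => /predU1P[->|ab].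
  by rewrite subrr set_itv1 Rintegral_set1.
have cf := is_derive_all_continuous df.
rewrite /Rintegral (@continuous_FTC2 _ f' f a b ab).
- by [].
- exact: continuous_within.
- split.
  + by move=> x _; exact: (ex_derive (is_derive := df x)).
  + by apply: cvg_at_right_filter; exact: cf.
  + by apply: cvg_at_left_filter; exact: cf.
- by move=> x _; exact: is_derive_derive1.
Qed.
End EssentialBounds.

(** * The strong solution carried by the flow *)

Section LagrangianSolution.
Context {R : realType}.
Notation mu := (@lebesgue_measure R).
Implicit Types (a b c x y l t s T : R).
Variables (K : R) (w : R -> R).
Hypothesis iw : mu.-integrable `[(- K), K] (EFin \o w).
Notation E := (wint (- K) K w).
Notation m := (wmass (- K) K w).
Variables (ga ubar : R) (Psi psi w0 w1 : R -> R) (p0 Lp W U : R).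
Hypothesis ga0 : 0 < ga.
Hypothesis w_ge0 : forall y, 0 <= w y.
Hypothesis dPsi : forall y, is_derive y 1 Psi (psi y).
Hypothesis psi_ge0 : forall y, 0 <= psi y.
Hypothesis psi_le : forall y, `|psi y| <= p0.
Hypothesis psi_lip : forall x y, `|psi x - psi y| <= Lp * `|x - y|.
Hypothesis dw0 : forall a, is_derive a 1 w0 (w1 a).
Hypothesis w1_le : forall a, `|w1 a| <= W.
Variable X : R -> R -> R.
Hypothesis flowX : is_flow K w ga ubar Psi w0 p0 W U X.

Notation B := (flow_modulus K w ga ubar p0 U).
Notation Lam := (flow_lip K w ga p0 W).

Let m0 : 0 <= m := wmass_ge0 _ _ _.
Let p00 : 0 <= p0 := le_trans (normr_ge0 _) (psi_le 0).
Let W0 : 0 <= W := le_trans (normr_ge0 _) (w1_le 0).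
Let Lp0 : 0 <= Lp.
Proof. by have := le_trans (normr_ge0 _) (psi_lip 1 0); rewrite subr0 normr1 mulr1. Qed.
Let cPsi : continuous Psi := is_derive_all_continuous dPsi.
Let cpsi : continuous psi := lipschitz_continuous psi_lip.
Let lip0 : 0 <= Lam.
Proof. by rewrite /flow_lip addr_ge0 ?mulr_ge0// addr_ge0// ltW. Qed.

Lemma flow_init a : X 0 a = a.
Proof. by case: flowX. Qed.

Lemma flow_continuous t : 0 <= t -> continuous (X t).
Proof.
move=> t0; case: flowX => _ H _ _.
by apply: (lipschitz_continuous (l := expR (Lam * t))) => a b; exact: H.
Qed.

Lemma flow_space_lip T t a b : 0 <= t <= T -> `|X t a - X t b| <= expR (Lam * T) * `|a - b|.
Proof.
move=> /andP[t0 tT]; case: flowX => _ H _ _; apply: le_trans (H _ _ _ t0) _.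
by rewrite ler_wpM2r// ler_expR ler_wpM2l.
Qed.

Lemma flow_time s t a : 0 <= s -> s <= t -> `|X t a - X s a| <= B t - B s.
Proof. by case: flowX => _ _ H _; exact: H. Qed.

Lemma flow_modulus_continuous : continuous B.
Proof.
apply: is_derive_all_continuous => t; apply: is_derive_picard_modulus.
Qed.

Lemma flow_modulus_homo s t : 0 <= s -> s <= t -> B s <= B t.
Proof. by move=> s0 st; rewrite -subr_ge0; apply: le_trans (flow_time 0 s0 st). Qed.

Definition flow_damping t x : R := ga + E (fun b => psi (x - X t b)).
Definition flow_potential t x : R := ga * x + E (fun b => Psi (x - X t b)) - ubar * ga * t.
Definition flow_speed t a : R := w0 a - flow_potential t (X t a).
Notation q := flow_damping.
Notation P := flow_potential.
Notation V := flow_speed.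
Let cst := ga + m * p0.
Let cst0 : 0 <= cst.
Proof. by rewrite /cst addr_ge0 ?(ltW ga0)// mulr_ge0. Qed.

Lemma is_derive_flow t a : 0 <= t -> is_derive t 1 (X^~ a) (V t a).
Proof.
move=> t0; have -> : V t a = flow_rhs K w ga ubar Psi w0 t (X t) a.
  by rewrite /V /P /flow_rhs; ring.
by case: flowX => _ _ _; exact.
Qed.

Lemma flow_damping_lip t x y : 0 <= t -> `|q t x - q t y| <= m * Lp * `|x - y|.
Proof.
move=> t0; rewrite /q opprD addrACA subrr add0r -mulrA.
have cX := flow_continuous t0.
apply: normr_wintB => //; try exact: continuous_kernel_comp.
move=> b _; apply: le_trans (psi_lip _ _) _; apply: eq_ler.
by have -> : x - X t b - (y - X t b) = x - y by ring.
Qed.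

Lemma flow_damping_time s t x : 0 <= s -> s <= t -> `|q t x - q s x| <= m * Lp * (B t - B s).
Proof.
move=> s0 st; rewrite /q opprD addrACA subrr add0r -mulrA.
have cXt := flow_continuous (le_trans s0 st); have cXs := flow_continuous s0.
apply: normr_wintB => //; try exact: continuous_kernel_comp.
move=> b _; apply: le_trans (psi_lip _ _) _; rewrite ler_wpM2l//.
have -> : x - X t b - (x - X s b) = - (X t b - X s b) by ring.
by rewrite normrN; exact: flow_time.
Qed.

Lemma flow_damping_ge t x : ga <= q t x.
Proof. by rewrite /q lerDl; apply: wint_ge0. Qed.

Lemma flow_damping_le t x : 0 <= t -> `|q t x| <= cst.
Proof.
move=> t0; apply: le_trans (ler_normD _ _) _; rewrite (gtr0_norm ga0) lerD2l.
by apply: normr_wint => //; apply: continuous_kernel_comp => //; exact: flow_continuous.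
Qed.

Lemma is_derive_potential t x : 0 <= t -> is_derive x 1 (P t) (q t x).
Proof.
move=> t0; have cX := flow_continuous t0.
have dE : is_derive x 1 (fun x => E (fun b => Psi (x - X t b))) (E (fun b => psi (x - X t b))).
  apply: (is_derive_wint (F := fun x b => Psi (x - X t b)) (F' := fun x b => psi (x - X t b))
     iw (u := x - 1) (v := x + 1) (C := p0)) => //.
  - by apply/andP; split; lra.
  - by move=> s _; exact: continuous_kernel_comp.
  move=> s b _ _; have := is_derive_compf (dPsi _) (is_deriveBf (is_derive_idf s) (is_derive_cstf (X t b) s)).
  by rewrite subr0 mulr1.
have := is_deriveBf (is_deriveDf (is_deriveZf ga (is_derive_idf x)) dE)
  (is_derive_cstf (ubar * ga * t) x).
by rewrite subr0 mulr1.
Qed.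

(* Negative times are truncated to [0], so that integrands in time are continuous
   on the whole line. *)
Let qX a s := q (Num.max 0 s) (X (Num.max 0 s) a).
Let cqX a : continuous (qX a).
Proof.
have cB := flow_modulus_continuous.
apply: (continuous_dominated (h := fun s => 2 * (m * Lp) * B (Num.max 0 s))).
  by apply: continuousZf; exact: continuous_compf cB continuous_max0.
move=> s t /max0_homo; rewrite /qX.
move: (max0_ge0 s) (max0_ge0 t); move: (Num.max 0 s) (Num.max 0 t) => {}s {}t s0 t0 st.
have -> : q t (X t a) - q s (X s a) = (q t (X t a) - q t (X s a)) + (q t (X s a) - q s (X s a)) by ring.
apply: le_trans (ler_normD _ _) _.
have H1 := flow_damping_time (X s a) s0 st.
have H2 := le_trans (flow_damping_lip (X t a) (X s a) t0)
  (ler_wpM2l (mulr_ge0 m0 Lp0) (flow_time a s0 st)).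
apply: le_trans (lerD H2 H1) _; apply: eq_ler; ring.
Qed.

(** Variation of constants for the linear equation of the Jacobian, with [Q] the damping accumulated
    along the trajectory. The formula comes first, and [is_derive_flow_space] shows that it is the
    derivative of the flow in the label. *)
Definition jacobian t a : R :=
  let Q := primitive (qX a) in
  expR (- Q t) * (1 + w1 a * primitive (fun s => expR (Q s)) t).
Notation J := jacobian.

Let ceQ a : continuous (fun s => expR (primitive (qX a) s)).
Proof.
apply: continuous_compf; first exact: continuous_expR.
by apply: is_derive_all_continuous => s; exact: is_derive_primitive _ (@cqX a).
Qed.

Lemma jacobian_init a : J 0 a = 1.
Proof. by rewrite /J !primitive0 oppr0 expR0 mulr0 addr0 mulr1. Qed.

Lemma is_derive_jacobian t a : 0 <= t ->
  is_derive t 1 (J^~ a) (w1 a - q t (X t a) * J t a).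
Proof.
move=> t0; set Q := primitive (qX a).
have dQ : is_derive t 1 Q (qX a t) by exact: is_derive_primitive _ (@cqX a).
have d1 := is_derive_compf (is_derive_expR _) (is_deriveNf dQ).
have d2 := is_deriveDf (is_derive_cstf 1 t) (is_deriveZf (w1 a) (is_derive_primitive t (@ceQ a))).
have := is_deriveMf d1 d2; congr is_derive.
rewrite /J -/Q add0r.
have -> : q t (X t a) = qX a t by rewrite /qX max_r.
have e1 : expR (- Q t) * expR (Q t) = 1 by rewrite -expRD addNr expR0.
rewrite [expR (- Q t) * (w1 a * _)]mulrCA e1; ring.
Qed.

(** The damping is at least [ga > 0], so [Q >= 0] and the integral of [expR Q] over [[0, t]] is at
    least [t]. *)
Lemma jacobian_supercritical t a : 0 <= t -> w1 a <= 0 ->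
  J t a <= expR (- primitive (qX a) t) * (1 + w1 a * t).
Proof.
move=> t0 w10; rewrite /J ler_wpM2l ?expR_ge0// lerD2l ler_wnM2l//.
have dQ s : is_derive s 1 (primitive (qX a)) (qX a s) by exact: is_derive_primitive _ (@cqX a).
have Qge s : 0 <= s -> 0 <= primitive (qX a) s.
  move=> s0; have : 0 - 0 <= primitive (qX a) s - primitive (qX a) 0.
    apply: (ler_of_derive (f := fun _ => 0)) => //.
    - by apply: continuous_within; exact: cst_continuous.
    - by apply: is_derive_within => r _; exact: dQ.
    move=> r _; exists 0, (qX a r); split; [exact: is_derive_cstf|exact: dQ|].
    exact: le_trans (ltW ga0) (flow_damping_ge (Num.max 0 r) _).
  by rewrite primitive0 !subr0.
have : t - 0 <= primitive (fun s => expR (primitive (qX a) s)) t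
    - primitive (fun s => expR (primitive (qX a) s)) 0.
  apply: (ler_of_derive (f := fun s => s)) => //.
  - by apply: continuous_within => x; exact: cvg_id.
  - by apply: is_derive_within => r _; exact: is_derive_primitive _ (@ceQ a).
  move=> r /andP[/ltW r0 _]; exists 1, (expR (primitive (qX a) r)); split;
    [exact: is_derive_idf|exact: is_derive_primitive _ (@ceQ a)|].
  by rewrite -(@expR0 R) ler_expR Qge.
by rewrite primitive0 !subr0.
Qed.

(** The term in [w1] only helps, and [Q t] is at most [cst * t]; the resulting bound does not see
    the label. *)
Lemma jacobian_subcritical t a : 0 <= t -> 0 <= w1 a -> expR (- (cst * t)) <= J t a.
Proof.
move=> t0 w10.
have dQ s : is_derive s 1 (primitive (qX a)) (qX a s) by exact: is_derive_primitive _ (@cqX a).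
have Qle : primitive (qX a) t <= cst * t.
  have : primitive (qX a) t - primitive (qX a) 0 <= cst * t - cst * 0.
    apply: (ler_of_derive (g := fun s => cst * s)) => //.
    - by apply: is_derive_within => r _; exact: dQ.
    - by apply: continuous_within; apply: continuousZf => x; exact: cvg_id.
    move=> r _; exists (qX a r), (cst * 1); split; [exact: dQ|exact: is_deriveZf (is_derive_idf _)|].
    by rewrite mulr1; apply: le_trans (ler_norm _) (flow_damping_le _ (max0_ge0 _)).
  by rewrite primitive0 mulr0 !subr0.
have Ige : 0 <= primitive (fun s => expR (primitive (qX a) s)) t.
  by rewrite /primitive t0; apply: Rintegral_ge0 => s _; exact: expR_ge0.
rewrite /J; apply: (@le_trans _ _ (expR (- primitive (qX a) t))).
  by rewrite ler_expR lerN2.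
by rewrite ler_peMr ?expR_ge0// lerDl mulr_ge0.
Qed.

Lemma jacobian_bounded T : 0 <= T ->
  exists2 C, 0 <= C & forall t a, 0 <= t <= T -> `|J t a| <= C.
Proof.
move=> T0; set D := 1 + T * expR ((2 * cst + 1) * T).
have D0 : 0 <= D by rewrite addr_ge0// mulr_ge0// expR_ge0.
exists ((W + cst) * D + 1); first by rewrite addr_ge0// mulr_ge0// addr_ge0.
move=> t a tT; rewrite -[J t a](subrK 1); apply: le_trans (ler_normD _ _) _.
rewrite normr1 lerD2r.
(* The estimate is made on [J - 1], which vanishes at time [0]. *)
apply: (gronwall0 (y := fun t => J t a - 1) (y' := fun t => w1 a - q t (X t a) * J t a) (B := cst)) => //.
- by rewrite addr_ge0.
- move=> s /andP[s0 _]; have := is_deriveBf (is_derive_jacobian a s0) (is_derive_cstf 1 s).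
  by rewrite subr0.
- by rewrite jacobian_init subrr.
move=> s /andP[s0 _]; apply: le_trans (ler_normB _ _) _; rewrite normrM -addrA; apply: lerD => //.
rewrite -[X in X + _]mulr1 -mulrDr; apply: ler_pM => //; first exact: flow_damping_le.
by rewrite -[J s a in leLHS](subrK 1) addrC; apply: le_trans (ler_normD _ _) _; rewrite normr1 addrC.
Qed.

(** The difference of two Jacobians solves a linear equation with source [w1 a - w1 b] plus a term
    of order [a - b]. The two are kept apart because [w1] contains the slope of [u0], which is only
    uniformly continuous. *)
Lemma jacobian_space_lip T : 0 <= T ->
  exists2 C, 0 <= C & forall t a b, 0 <= t <= T ->
    `|J t a - J t b| <= C * (`|w1 a - w1 b| + `|a - b|).
Proof.
move=> T0; have [C C0 HC] := jacobian_bounded T0.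
set D := 1 + T * expR ((2 * cst + 1) * T).
have D0 : 0 <= D by rewrite addr_ge0// mulr_ge0// expR_ge0.
set M := m * Lp * expR (Lam * T) * C.
have M0 : 0 <= M by rewrite !mulr_ge0// expR_ge0.
exists ((1 + M) * D); first by rewrite mulr_ge0// addr_ge0.
move=> t a b tT; set N := `|w1 a - w1 b| + `|a - b|.
rewrite mulrAC.
apply: (gronwall0 (y := fun t => J t a - J t b) (B := cst)
  (y' := fun t => (w1 a - q t (X t a) * J t a) - (w1 b - q t (X t b) * J t b))) => //.
- by rewrite mulr_ge0 ?addr_ge0.
- by move=> s /andP[s0 _]; apply: is_deriveBf; exact: is_derive_jacobian.
- by rewrite !jacobian_init subrr.
move=> s sT; have [s0 _] := andP sT.
have rearr (k1 k2 qa qb ja jb : R) : k1 - qa * ja - (k2 - qb * jb) =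
  (k1 - k2) - (qa - qb) * jb - qa * (ja - jb) by ring.
rewrite rearr.
apply: le_trans (ler_normB _ _) _; apply: lerD; last first.
  by rewrite normrM; apply: ler_wpM2r => //; exact: flow_damping_le.
apply: le_trans (ler_normB _ _) _; rewrite normrM.
have H1 : `|q s (X s a) - q s (X s b)| * `|J s b| <= M * `|a - b|.
  rewrite /M [leRHS]mulrAC; apply: ler_pM => //; last exact: HC.
  apply: le_trans (flow_damping_lip _ _ s0) _; rewrite -[leRHS]mulrA.
  by rewrite ler_wpM2l ?mulr_ge0//; exact: flow_space_lip.
apply: le_trans (lerD (lexx _) H1) _; rewrite /N.
have := mulr_ge0 M0 (normr_ge0 (w1 a - w1 b)); have := normr_ge0 (a - b); lra.
Qed.

Lemma jacobian_time_lip T : 0 <= T ->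
  exists2 C, 0 <= C & forall s t a, 0 <= s -> s <= t -> t <= T ->
    `|J t a - J s a| <= C * (t - s).
Proof.
move=> T0; have [C C0 HC] := jacobian_bounded T0.
exists (W + cst * C); first by rewrite addr_ge0 ?mulr_ge0.
move=> s t a s0 st tT; rewrite mulrBr.
have dJ r : s <= r -> is_derive r 1 (J^~ a) (w1 a - q r (X r a) * J r a).
  by move=> sr; apply: is_derive_jacobian; exact: le_trans sr.
apply: (normr_ler_of_derive (f := J^~ a) (g := fun r => (W + cst * C) * r)) => //.
- by apply: is_derive_within => r /=; rewrite in_itv/= => /andP[sr _]; exact: dJ.
- by apply: continuous_within; apply: continuousZf => x; exact: cvg_id.
move=> r /andP[sr rt]; exists (w1 a - q r (X r a) * J r a), ((W + cst * C) * 1).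
split; [exact/dJ/ltW|exact: is_deriveZf (is_derive_idf _)|rewrite mulr1].
have r0 : 0 <= r by rewrite (le_trans s0)// ltW.
apply: le_trans (ler_normB _ _) _; apply: lerD => //; rewrite normrM.
apply: ler_pM => //; first exact: flow_damping_le.
by apply: HC; rewrite r0/= (le_trans _ tT)// ltW.
Qed.

(** Gronwall's inequality for the defect [X s b - X s a - J s a * (b - a)]. Its source consists of
    the first-order remainder of [w0], small relative to [b - a], and that of the potential,
    quadratic because the damping is Lipschitz. The two smallness conditions on [b - a] give each
    part half of [e]. *)
Lemma is_derive_flow_space t a : 0 <= t -> is_derive a 1 (X t) (J t a).
Proof.
move=> t0.
set D := 1 + t * expR ((2 * cst + 1) * t).
have D1 : 1 <= D by rewrite lerDl mulr_ge0// expR_ge0.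
have D0 : 0 < D by exact: lt_le_trans D1.
set M := m * Lp * expR (Lam * t) ^+ 2.
have M0 : 0 <= M by rewrite !mulr_ge0// exprn_ge0// expR_ge0.
apply/is_deriveP_eps => e e0.
have e1 : 0 < e / (2 * D) by rewrite divr_gt0// mulr_gt0.
have /is_deriveP_eps/(_ _ e1)[d d0 Hd] := dw0 a.
exists (Num.min d (e / (2 * D * (M + 1)))) => [|b].
  by rewrite lt_min d0 divr_gt0// !mulr_gt0// ltr_wpDl.
rewrite lt_min => /andP[bd be].
have H : `|X t b - X t a - J t a * (b - a)| <=
    (e / (2 * D) * `|b - a| + M * `|b - a| ^+ 2) * D.
  apply: (gronwall0 (y := fun s => X s b - X s a - J s a * (b - a)) (B := cst)
    (y' := fun s => V s b - V s a - (w1 a - q s (X s a) * J s a) * (b - a))) => //.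
  - by apply: addr_ge0; apply: mulr_ge0 => //; exact: ltW.
  - by rewrite t0 lexx.
  - move=> s /andP[s0 _].
    have := is_deriveBf (is_deriveBf (is_derive_flow b s0) (is_derive_flow a s0))
      (is_deriveMf (is_derive_jacobian a s0) (is_derive_cstf (b - a) s)).
    by rewrite mulr0 addr0.
  - by rewrite !flow_init jacobian_init mul1r subrr.
  move=> s sT; have [s0 _] := andP sT.
  have rearr (kb ka k1 pb pa qa ja xb xa h : R) :
    kb - pb - (ka - pa) - (k1 - qa * ja) * h = (kb - ka - k1 * h)
    - (pb - pa - qa * (xb - xa)) - qa * (xb - xa - ja * h) by ring.
  rewrite /V (rearr _ _ _ _ _ _ _ (X s b) (X s a)).
  apply: le_trans (ler_normB _ _) _; apply: lerD; last first.
    by rewrite normrM; apply: ler_wpM2r => //; exact: flow_damping_le.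
  apply: le_trans (ler_normB _ _) _; apply: lerD; first exact: Hd.
  apply: le_trans (taylor1_lip (l := m * Lp) _ _ (fun z => is_derive_potential z s0)
    (fun z z' => flow_damping_lip z z' s0)) _.
  rewrite /M -[leRHS]mulrA ler_wpM2l ?mulr_ge0// -exprMn -[_ ^+ 2]ger0_norm ?sqr_ge0// normrX.
  by rewrite ler_sqr ?nnegrE ?mulr_ge0 ?expR_ge0//; exact: flow_space_lip.
apply: (le_trans H).
have -> : (e / (2 * D) * `|b - a| + M * `|b - a| ^+ 2) * D =
   (e / 2 + M * D * `|b - a|) * `|b - a| by field; rewrite gt_eqF.
rewrite ler_wpM2r//.
have : M * D * `|b - a| <= (M + 1) * D * (e / (2 * D * (M + 1))).
  apply: ler_pM => //; [by rewrite mulr_ge0// ltW| |exact: ltW].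
  by rewrite ler_wpM2r// ?(ltW D0)// lerDl.
have -> : (M + 1) * D * (e / (2 * D * (M + 1))) = e / 2.
  by field; rewrite !gt_eqF// ltr_wpDl.
lra.
Qed.

(** * The inverse of the flow while the Jacobian is bounded below *)

Hypothesis K0 : 0 <= K.
Hypothesis cw : continuous w.
Hypothesis w_supp : forall y, y \notin `[(- K), K] -> w y = 0.
Hypothesis w1_unif : forall e, 0 < e -> exists2 d, 0 < d &
  forall a b, `|a - b| < d -> `|w1 a - w1 b| <= e.
Hypothesis w_unif : forall e, 0 < e -> exists2 d, 0 < d &
  forall a b, `|a - b| < d -> `|w a - w b| <= e.
Hypothesis u0_le : forall a, `|w0 a - ga * a - E (fun b => Psi (a - b))| <= U.
Variable T : \bar R.
Hypothesis good : forall t, time_interval T t ->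
  exists2 c, 0 < c & forall s a, 0 <= s <= t -> c <= J s a.

Let cX t : 0 <= t -> continuous (X t).
Proof. by move=> t0; exact: flow_continuous. Qed.
Let dX t a : 0 <= t -> is_derive t 1 (X^~ a) (V t a).
Proof. by move=> t0; exact: is_derive_flow. Qed.
Let dXa t a : 0 <= t -> is_derive a 1 (X t) (J t a).
Proof.
by move=> t0; exact: is_derive_flow_space.
Qed.
Let cB : continuous B.
Proof. exact: flow_modulus_continuous. Qed.
Let time0 t : time_interval T t -> 0 <= t.
Proof. by case. Qed.

Lemma time_interval_down s t : time_interval T t -> 0 <= s <= t -> time_interval T s.
Proof.
by move=> [t0 tT] /andP[s0 st]; split => //; apply: le_lt_trans tT; rewrite lee_fin.
Qed.

Lemma flow_expand t c : 0 <= t -> (forall a, c <= J t a) ->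
  forall a b, c * `|a - b| <= `|X t a - X t b|.
Proof.
move=> t0 cJ a b; have [x _ ->] := mean_value b a (fun a => dXa a t0).
rewrite normrM ler_wpM2r//; exact: le_trans (cJ x) (ler_norm _).
Qed.

Lemma jacobian_pos t a : time_interval T t -> 0 < J t a.
Proof.
move=> It; have [c c0 H] := good It; apply: lt_le_trans c0 (H _ _ _).
by rewrite lexx (time0 It).
Qed.

Lemma flow_incr t a b : time_interval T t -> a < b -> X t a < X t b.
Proof.
move=> It ab; have t0 := time0 It.
have [x _ E] := mean_value a b (fun a => dXa a t0).
by rewrite -subr_gt0 E mulr_gt0 ?subr_gt0// jacobian_pos.
Qed.

(** No label is displaced by more than [D], so the labels [x - D] and [x + D] enclose a preimage of
    [x]. *)
Lemma flow_surj t x : time_interval T t -> exists a, X t a = x.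
Proof.
move=> It; have t0 := time0 It.
pose D := B t - B 0.
have XD a : `|X t a - a| <= D.
  by have := flow_time a (lexx 0) t0; rewrite flow_init.
have D0 : 0 <= D by exact: le_trans (XD 0).
have [|||a _ <-] := @IVT _ (X t) (x - D) (x + D) x.
- by lra.
- exact/continuous_within/cX.
- have := XD (x - D); have := XD (x + D); rewrite !ler_norml => /andP[h1 h2] /andP[h3 h4].
  by rewrite ge_min le_max; apply/andP; split; apply/orP; [left|right]; lra.
by exists a.
Qed.

(** The default [0] never occurs at times of the interval, where the flow is onto. *)
Definition label t x : R := xget 0 [set a | X t a = x].
Notation A := label.

Lemma flow_label t x : time_interval T t -> X t (A t x) = x.
Proof.
by move=> It; have [a Xa] := flow_surj x It;
  exact: (xgetPex 0 (ex_intro _ a Xa : exists a, [set a | X t a = x] a)).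
Qed.

Lemma label_flow t a : time_interval T t -> A t (X t a) = a.
Proof.
move=> It; have H := flow_label (X t a) It.
have [h|h|//] := ltgtP (A t (X t a)) a.
  by have := flow_incr It h; rewrite H ltxx.
by have := flow_incr It h; rewrite H ltxx.
Qed.

Lemma label_space_lip t c : time_interval T t -> 0 < c -> (forall a, c <= J t a) ->
  forall x y, `|A t x - A t y| <= c^-1 * `|x - y|.
Proof.
move=> It c0 cJ x y; rewrite ler_pdivlMl//.
by apply: le_trans (flow_expand (time0 It) cJ _ _) _; rewrite !flow_label.
Qed.

Lemma label_continuous t : time_interval T t -> continuous (A t).
Proof.
move=> It; have [c c0 H] := good It.
by apply: (lipschitz_continuous (l := c^-1)); apply: label_space_lip => // a; apply: H; rewrite lexx (time0 It).
Qed.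

Lemma label_time_lip r c : time_interval T r -> 0 < c ->
  (forall s a, 0 <= s <= r -> c <= J s a) ->
  forall s t x, 0 <= s <= r -> 0 <= t <= r -> `|A t x - A s x| <= c^-1 * `|B t - B s|.
Proof.
move=> Ir c0 cJ.
have H s t x : 0 <= s -> s <= t -> t <= r -> `|A t x - A s x| <= c^-1 * `|B t - B s|.
  move=> s0 st tr; have t0 := le_trans s0 st.
  have It : time_interval T t by apply: time_interval_down Ir _; rewrite t0.
  have Is : time_interval T s by apply: time_interval_down It _; rewrite s0.
  rewrite ler_pdivlMl//; apply: le_trans (flow_expand t0 _ _ _) _.
    by move=> a; apply: cJ; rewrite t0.
  rewrite flow_label// -{1}(flow_label x Is) distrC.
  apply: le_trans (flow_time (A s x) s0 st) (ler_norm _).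
move=> s t x /andP[s0 sr] /andP[t0 tr]; have [st|/ltW ts] := leP s t; first exact: H.
by rewrite distrC (distrC (B t)); exact: H.
Qed.

Lemma jacobian_continuous t : 0 <= t -> continuous (J t).
Proof.
move=> t0 a; apply/continuousP_eps => e e0.
have [C C0 H] := jacobian_space_lip t0.
have e1 : 0 < e / (2 * (C + 1)) by rewrite divr_gt0// mulr_gt0// ltr_wpDl.
have [d d0 Hd] := w1_unif e1.
exists (Num.min d (e / (2 * (C + 1)))) => [|b]; first by rewrite lt_min d0.
rewrite lt_min => /andP[h1 h2]; apply: le_trans (H t b a _) _; first by rewrite t0 lexx.
have h3 := Hd _ _ h1.
apply: (@le_trans _ _ ((C + 1) * (e / (2 * (C + 1)) + e / (2 * (C + 1))))).
  by apply: ler_pM; [exact: C0|exact: addr_ge0|rewrite lerDl|exact: lerD h3 (ltW h2)].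
by apply: eq_ler; field; rewrite gt_eqF// ltr_wpDl.
Qed.

Lemma is_derive_label_space t x : time_interval T t -> is_derive x 1 (A t) (J t (A t x))^-1.
Proof.
move=> It; have t0 := time0 It.
rewrite -{1}(flow_label x It).
apply: (is_derive_inverse (f := X t)).
- by near=> a; exact: label_flow.
- by near=> a; exact: cX.
- exact: dXa.
- by rewrite gt_eqF// jacobian_pos.
Unshelve. all: by end_near. Qed.

Lemma time_interval_right t : time_interval T t -> exists2 r, t < r & time_interval T r.
Proof.
case=> t0; case: T => [T'|_|]/=; last by rewrite ltNge leNye.
  rewrite lte_fin => tT'; exists ((t + T') / 2); first by lra.
  by split; [lra|rewrite lte_fin; lra].
by exists (t + 1); [lra|split; [lra|exact: ltry]].
Qed.

(** The implicit function theorem for [X s (A s x) = x], by hand. The mean value theorem in the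
    label gives [J s z * (b - a) = - (X s a - X t a)] with [z] near [a]. Then [J s z] is compared
    with [J t a] by uniform Lipschitz continuity in time and continuity in the label. *)
Lemma is_derive_label_time t x : 0 < t -> time_interval T t ->
  is_derive t 1 (A^~ x) (- V t (A t x) / J t (A t x)).
Proof.
move=> tp It; have t0 := ltW tp.
have [r tr Ir] := time_interval_right It; have r0 := time0 Ir.
have [c c0 cJ] := good Ir.
set a := A t x; set j := J t a.
have j0 : 0 < j by exact: jacobian_pos.
have jc : c <= j by apply: cJ; rewrite t0 ltW.
have [C C0 HC] := jacobian_time_lip r0.
apply/is_deriveP_eps => e e0.
(* The bound [e1 <= 1] yields [|X s a - X t a| <= (|v| + 1) * |s - t|], hence
   [|b - a| <= (|v| + 1) / c * |s - t|], and [h] is chosen so that its product with this is half of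
   [e * c * |s - t|]. The factor [c] pays for the final division by [j >= c]. *)
set v := V t a; pose e1 := Num.min 1 (e * c / 2).
have e10 : 0 < e1 by rewrite lt_min ltr01/= divr_gt0// mulr_gt0.
pose h := e * c / 2 * c / (`|v| + 1).
have h0 : 0 < h by rewrite divr_gt0// mulr_gt0// divr_gt0// mulr_gt0.
have h20 : 0 < h / 2 by rewrite divr_gt0.
have /is_deriveP_eps/(_ _ e10)[d1 d10 Hd1] := dX a t0.
have /continuousP_eps/(_ _ h20)[d2 d20 Hd2] := (@jacobian_continuous t t0 a).
exists (Num.min (Num.min d1 (Num.min t (r - t)))
  (Num.min (d2 * c / (`|v| + 1)) (h / 2 / (C + 1)))) => [|s].
  have C10 : 0 < C + 1 by rewrite ltr_wpDl.
  have p1 : 0 < d2 * c / (`|v| + 1) by rewrite divr_gt0// mulr_gt0.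
  have p2 : 0 < h / 2 / (C + 1) by rewrite divr_gt0.
  by rewrite !lt_min d10 tp subr_gt0 tr p1 p2.
rewrite !lt_min => /andP[/andP[sd1 /andP[st sr]] /andP[sd2 sC]].
have s0 : 0 <= s by move: st; rewrite ltr_norml; lra.
have sr' : s <= r by move: sr; rewrite ltr_norml; lra.
have Is : time_interval T s by apply: time_interval_down Ir _; rewrite s0.
set b := A s x.
have [z zb Hz] := mean_value a b (fun y => dXa y s0).
have Xb : X s b = x by exact: flow_label.
have Xa : X t a = x by exact: flow_label.
have H1 := Hd1 s sd1.
have Js : c <= J s z by apply: cJ; rewrite s0.
have Hdt : `|X s a - X t a| <= (`|v| + 1) * `|s - t|.
  have -> : (`|v| + 1) * `|s - t| = `|v| * `|s - t| + `|s - t| by rewrite mulrDl mul1r.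
  rewrite -[X s a - X t a](subrK (v * (s - t))) addrC.
  apply: le_trans (ler_normD _ _) _; rewrite normrM lerD2l.
  by apply: (le_trans H1); rewrite ler_piMl// ge_min lexx.
have Hba : `|b - a| <= (`|v| + 1) / c * `|s - t|.
  rewrite -mulrA mulrCA ler_pdivlMl//.
  have E1 : X s b - X s a = - (X s a - X t a) by rewrite Xb Xa opprB.
  apply: le_trans Hdt; rewrite -[leRHS]normrN -E1 Hz normrM ler_wpM2r//.
  exact: le_trans Js (ler_norm _).
have HJ : `|j - J s z| <= h.
  have rearr (j1 j2 j3 : R) : j1 - j2 = - ((j2 - j3) + (j3 - j1)) by ring.
  rewrite (rearr _ _ (J t z)).
  rewrite normrN; apply: le_trans (ler_normD _ _) _.
  have q1 : `|J t z - J t a| <= h / 2.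
    apply: Hd2; apply: le_lt_trans zb _; apply: le_lt_trans Hba _.
    by rewrite mulrAC ltr_pdivrMr// mulrC -ltr_pdivlMr.
  have q2 : `|J s z - J t z| <= C * `|s - t|.
    have [ts|/ltW ts] := leP t s; first by rewrite (ger0_norm (x := s - t)) ?subr_ge0//; exact: HC.
    by rewrite distrC (distrC s) (ger0_norm (x := t - s)) ?subr_ge0//; apply: HC => //; exact: ltW.
  have q3 : C * `|s - t| <= h / 2.
    apply: (@le_trans _ _ ((C + 1) * `|s - t|)); first by rewrite ler_wpM2r// lerDl.
    by rewrite mulrC -ler_pdivlMr ?ltr_wpDl// ltW.
  by apply: le_trans (lerD (le_trans q2 q3) q1) _; rewrite -splitr.
have key : j * (b - a) + v * (s - t) =
    (j - J s z) * (b - a) - (X s a - X t a - v * (s - t)).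
  have rearr (j1 j2 h1 x1 x2 y : R) : j2 * h1 = - (x1 - x2) ->
    j1 * h1 + y = (j1 - j2) * h1 - (x1 - x2 - y) by move=> jE; rewrite mulrBl jE; ring.
  by apply: rearr; rewrite -Hz Xb Xa opprB.
have rearr (j1 b1 a1 x1 h1 : R) : 0 < j1 ->
  b1 - a1 - - x1 / j1 * h1 = (j1 * (b1 - a1) + x1 * h1) / j1.
  by move=> j10; field; rewrite gt_eqF.
rewrite rearr//.
have concl (j1 x1 x2 : R) : 0 < j1 -> c <= j1 -> x1 = x2 ->
    `|x2| <= e * c * `|s - t| -> `|x1 / j1| <= e * `|s - t|.
  move=> j10 cj1 -> /le_trans H; rewrite normrM normfV (gtr0_norm j10) ler_pdivrMr//.
  by apply: H; rewrite mulrAC ler_wpM2l// mulr_ge0// ltW.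
apply: (concl _ _ _ j0 jc key).
apply: le_trans (ler_normB _ _) _; rewrite normrM.
have k1 : `|j - J s z| * `|b - a| <= e * c / 2 * `|s - t|.
  apply: le_trans (ler_pM _ _ HJ Hba) _ => //; apply: eq_ler.
  have rearr2 (c1 n1 k1 : R) : 0 < c1 -> 0 < n1 ->
    e * c1 / 2 * c1 / n1 * (n1 / c1 * k1) = e * c1 / 2 * k1.
    by move=> c10 n10; field; rewrite !gt_eqF.
  exact: rearr2.
have k2 : `|X s a - X t a - v * (s - t)| <= e * c / 2 * `|s - t|.
  by apply: (le_trans H1); rewrite ler_wpM2r// ge_min lexx orbT.
apply: le_trans (lerD k1 k2) _; by rewrite -mulrDl -splitr.
Qed.

(** * The Eulerian velocity and density, and the equations they satisfy *)

Definition velocity t x : R := w0 (A t x) - P t x.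
Definition density t x : R := w (A t x) / J t (A t x).
Notation u := velocity.
Notation rho := density.

Lemma velocity_flow t a : time_interval T t -> u t (X t a) = V t a.
Proof. by move=> It; rewrite /u label_flow. Qed.

Lemma is_derive_velocity_space t x : time_interval T t ->
  is_derive x 1 (u t) (w1 (A t x) / J t (A t x) - q t x).
Proof.
move=> It; apply: is_deriveBf.
  exact: is_derive_compf (dw0 _) (is_derive_label_space x It).
exact: is_derive_potential (time0 It).
Qed.

Lemma velocity_continuous t : time_interval T t -> continuous (u t).
Proof.
move=> It; exact: is_derive_all_continuous (fun x => is_derive_velocity_space x It).
Qed.

Lemma flow_speed_continuous t : 0 <= t -> continuous (V t).
Proof.
move=> t0; apply: continuousBf; first exact: is_derive_all_continuous dw0.
apply: continuous_compf (@cX t t0).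
exact: is_derive_all_continuous
  (fun x => is_derive_potential x t0).
Qed.

Lemma flow_speed_bounded r : 0 <= r -> exists2 C, 0 <= C &
  forall t a, 0 <= t <= r -> `|V t a| <= C.
Proof.
move=> r0; set Br := B r - B 0.
have Br0 : 0 <= Br by rewrite subr_ge0; apply: flow_modulus_homo.
have rate0 : 0 <= flow_rate K w ga p0.
  by rewrite /flow_rate addr_ge0 ?ler01// addr_ge0 ?(ltW ga0)// mulr_ge0// mulr_ge0.
have U0 : 0 <= U := le_trans (normr_ge0 _) (u0_le 0).
exists (U + `|ubar * ga| * r + flow_rate K w ga p0 * Br).
  by rewrite !addr_ge0// mulr_ge0.
move=> t a /andP[t0 tr].
have E1 : V t a = flow_rhs K w ga ubar Psi w0 t (X t) a.
  by rewrite /flow_speed /flow_potential /flow_rhs; ring.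
rewrite E1 -[flow_rhs _ _ _ _ _ _ _ _ _](subrK (flow_rhs K w ga ubar Psi w0 t id a)) addrC.
apply: le_trans (ler_normD _ _) _; apply: lerD.
  have -> : flow_rhs K w ga ubar Psi w0 t id a =
     (w0 a - ga * a - E (fun b => Psi (a - b))) + ubar * ga * t by rewrite /flow_rhs; ring.
  apply: le_trans (ler_normD _ _) _; apply: lerD => //.
  by rewrite normrM ler_wpM2l// ger0_norm.
have H b : `|X t b - id b| <= Br.
  have := flow_time b (lexx 0) t0; rewrite flow_init => /le_trans; apply.
  by rewrite lerD2r; apply: flow_modulus_homo.
have cid : continuous (@id R) by move=> x; exact: cvg_id.
exact: (flow_rhs_lip iw ubar w0 ga0 dPsi psi_le t (@cX t t0) cid (fun b _ => H b) (H a)).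
Qed.

Lemma is_derive_potential_time t x : 0 < t ->
  is_derive t 1 (P^~ x) (- E (fun b => psi (x - X t b) * V t b) - ubar * ga).
Proof.
move=> t0; have t1 : 0 <= t + 1 by lra.
have [C C0 HC] := flow_speed_bounded t1.
have dE : is_derive t 1 (fun t => E (fun b => Psi (x - X t b)))
    (E (fun b => - (psi (x - X t b) * V t b))).
  apply: (is_derive_wint (F := fun t b => Psi (x - X t b))
     (F' := fun t b => - (psi (x - X t b) * V t b)) iw (u := 0) (v := t + 1) (C := p0 * C)).
  - by rewrite t0/= ltrDl.
  - by move=> s /andP[/ltW s0 _]; apply: continuous_kernel_comp => //; exact: cX.
  - move=> s b /andP[/ltW s0 _] _.
    have := is_derive_compf (dPsi _) (is_deriveBf (is_derive_cstf x s) (dX b s0)).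
    by rewrite sub0r mulrN.
  move=> s b /andP[s0 st] _; rewrite normrN normrM; apply: ler_pM => //.
  by apply: HC; rewrite !ltW.
have EN : E (fun b => - (psi (x - X t b) * V t b)) = - E (fun b => psi (x - X t b) * V t b).
  have cc : continuous (fun b => psi (x - X t b) * V t b).
    apply: continuousMf; last exact: flow_speed_continuous (ltW t0).
    by apply: continuous_kernel_comp => //; exact: (@cX t (ltW t0)).
  rewrite -[RHS]mulN1r -(wintZ iw)//.
  by apply: eq_wint => b _; rewrite mulN1r.
have := is_deriveBf (is_deriveDf (is_derive_cstf (ga * x) t) dE)
  (is_deriveZf (ubar * ga) (is_derive_idf t)).
by rewrite add0r mulr1 EN.
Qed.

Lemma is_derive_velocity_time t x : 0 < t -> time_interval T t ->
  is_derive t 1 (u^~ x) (w1 (A t x) * (- V t (A t x) / J t (A t x)) -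
    (- E (fun b => psi (x - X t b) * V t b) - ubar * ga)).
Proof.
move=> t0 It; apply: is_deriveBf; last exact: is_derive_potential_time.
exact: is_derive_compf (dw0 _) (is_derive_label_time x t0 It).
Qed.

Lemma density_continuous t : time_interval T t -> continuous (rho t).
Proof.
move=> It x; apply: cvgM.
  exact: (continuous_compf cw (label_continuous It)).
apply: cvgV; first by rewrite gt_eqF// jacobian_pos.
exact: (continuous_compf (jacobian_continuous (time0 It)) (label_continuous It)).
Qed.

Lemma density_supp t y : time_interval T t ->
  y \notin `[X t (- K), X t K] -> rho t y = 0.
Proof.
move=> It; rewrite /rho => yn; rewrite w_supp ?mul0r//.
apply: contra yn; rewrite !in_itv/= -{3 4}(flow_label y It) => /andP[h1 h2].
have homo a b : a <= b -> X t a <= X t b.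
  by rewrite le_eqVlt => /predU1P[->//|ab]; exact/ltW/flow_incr.
by rewrite !homo.
Qed.

(** The substitution [y = X t b] on the image of the support, where the Jacobian cancels the
    denominator of the density. *)
Lemma density_integral t (g : R -> R) : time_interval T t -> continuous g ->
  \int[mu]_y (g y * rho t y) = E (fun b => g (X t b)).
Proof.
move=> It cg; have t0 := time0 It.
rewrite (wint_setT _ (fun y => density_supp It)).
have J'E a : derive1 (X t) a = J t a by exact/is_derive_derive1/dXa.
have J'F : derive1 (X t) = J t by apply/funext.
have cJ := jacobian_continuous t0.
rewrite /wint /Rintegral (@integration_by_substitution_increasing _ (X t) (fun y => g y * rho t y) (- K) K).
- congr fine; apply: eq_integral => b _; congr EFin.
  rewrite /= !fctE J'E /rho label_flow// -mulrA divfK// gt_eqF//; exact: jacobian_pos.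
- by rewrite (le_trans _ K0)// oppr_le0.
- by move=> a b _ _; exact: flow_incr.
- by move=> a _; rewrite J'F; exact: cJ.
- by rewrite J'F; apply/cvg_ex; exists (J t (- K)); apply: cvg_at_right_filter; exact: cJ.
- by rewrite J'F; apply/cvg_ex; exists (J t K); apply: cvg_at_left_filter; exact: cJ.
- split.
  + by move=> a _; exact: (ex_derive (is_derive := dXa a t0)).
  + by apply: cvg_at_right_filter; exact: cX.
  + by apply: cvg_at_left_filter; exact: cX.
- by apply: continuous_within; apply: continuousMf => //; exact: density_continuous.
Qed.

Lemma density_integrable t (g : R -> R) : time_interval T t -> continuous g ->
  mu.-integrable [set: R] (EFin \o (fun y => g y * rho t y)).
Proof.
move=> It cg.
have cgr : continuous (fun y => g y * rho t y).
  by apply: continuousMf => //; exact: density_continuous.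
have mI : measurable (`[X t (- K), X t K]%classic : set (measurableTypeR R)) by [].
have H := (integrable_mkcond _ mI).1 (continuous_integrable_itv (X t (- K)) (X t K) cgr).
apply: eq_integrable H => // y _; rewrite patchE /=; case: ifPn => //.
move=> yn; rewrite (density_supp It) ?mulr0//.
by apply: contraNN yn => yn; exact/mem_set.
Qed.

Lemma label_close t e : time_interval T t -> 0 < e -> exists2 d, 0 < d &
  forall s, time_interval T s -> `|s - t| < d -> forall x, `|A s x - A t x| <= e.
Proof.
move=> It e0; have [r tr Ir] := time_interval_right It.
have [c c0 cJ] := good Ir.
have ce0 : 0 < c * e by rewrite mulr_gt0.
have /continuousP_eps/(_ _ ce0)[d d0 Hd] := @cB t.
exists (Num.min d (r - t)) => [|s Is]; first by rewrite lt_min d0 subr_gt0.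
rewrite lt_min => /andP[sd sr] x.
have s_r : 0 <= s <= r.
  by rewrite (time0 Is)/=; exact: dist_lt_le sr.
have t_r : 0 <= t <= r by rewrite (time0 It) ltW.
apply: le_trans (label_time_lip Ir c0 cJ x t_r s_r) _.
by rewrite ler_pdivrMl// Hd.
Qed.

(** Serves both the density, with [k = w], and the slope of the velocity, with [k = w1]: each is a
    function of the label divided by the Jacobian. *)
Lemma transported_close (k : R -> R) N t e : (forall a, `|k a| <= N) ->
  (forall e, 0 < e -> exists2 d, 0 < d & forall a b, `|a - b| < d -> `|k a - k b| <= e) ->
  time_interval T t -> 0 < e -> exists2 d, 0 < d &
  forall s, time_interval T s -> `|s - t| < d -> forall x,
    `|k (A s x) / J s (A s x) - k (A t x) / J t (A t x)| <= e.
Proof.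
move=> kN ku It e0; have N0 : 0 <= N := le_trans (normr_ge0 _) (kN 0).
have t0 := time0 It.
have [r tr Ir] := time_interval_right It; have r0 := time0 Ir.
have [c c0 cJ] := good Ir.
have [C C0 HC] := jacobian_space_lip r0.
have [C' C'0 HC'] := jacobian_time_lip r0.
(* The constant of [quotient_close]. The denominators differ by at most [(2 * C + C') * h]: twice
   [C * h] from the moving label, through [w1] and through the label itself, and [C' * h] from
   time. *)
pose M := c^-1 + N * (2 * C + C') * (c^-1 * c^-1).
have ci0 : 0 < c^-1 by rewrite invr_gt0.
have M0 : 0 < M.
  apply: ltr_wpDr => //; apply: mulr_ge0; apply: mulr_ge0 => //; try exact: ltW.
  by rewrite addr_ge0// mulr_ge0.
pose h := e / M; have h0 : 0 < h by rewrite divr_gt0.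
have [d1 d10 Hk] := ku _ h0; have [d2 d20 Hw] := w1_unif h0.
pose e1 := Num.min h (Num.min d1 d2 / 2).
have d12 : 0 < Num.min d1 d2 by rewrite lt_min d10.
have e10 : 0 < e1 by rewrite lt_min h0 divr_gt0.
have [d3 d30 HA] := label_close It e10.
exists (Num.min d3 (Num.min h (r - t))) => [|s Is]; first by rewrite !lt_min d30 h0 subr_gt0.
rewrite !lt_min => /andP[sd3 /andP[sh sr]] x; have s0 := time0 Is.
have sr' : s <= r := dist_lt_le sr.
have Ax := HA s Is sd3 x.
have Axh : `|A s x - A t x| <= h by apply: (le_trans Ax); rewrite ge_min lexx.
have Axd : `|A s x - A t x| < Num.min d1 d2.
  apply: (@le_lt_trans _ _ (Num.min d1 d2 / 2)).
    by apply: (le_trans Ax); rewrite ge_min lexx orbT.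
  by rewrite ltr_pdivrMr// ltr_pMr// ltr1n.
move: (Axd); rewrite lt_min => /andP[Axd1 Axd2].
have -> : e = M * h by rewrite /h mulrC divfK// gt_eqF.
apply: quotient_close => //.
- by apply: cJ; rewrite s0.
- by apply: cJ; rewrite t0 ltW.
- exact: Hk.
have rearr (j1 j2 j3 : R) : j1 - j2 = (j1 - j3) + (j3 - j2) by ring.
rewrite (rearr _ _ (J s (A t x))) mulrDl; apply: le_trans (ler_normD _ _) _; apply: lerD.
  apply: le_trans (HC s _ _ _) _; first by rewrite s0.
  rewrite (mulrC 2) -mulrA ler_wpM2l// mulr2n mulrDl mul1r; apply: lerD => //.
  exact: Hw.
have [ts|/ltW st] := leP t s.
  apply: le_trans (HC' t s _ t0 ts sr') _; rewrite ler_wpM2l//.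
  exact: le_trans (ler_norm _) (ltW sh).
rewrite distrC; apply: le_trans (HC' s t _ s0 st (ltW tr)) _; rewrite ler_wpM2l//.
by apply: le_trans (ler_norm _) _; rewrite distrC ltW.
Qed.

Lemma transported_bounded (k : R -> R) N t : (forall a, `|k a| <= N) ->
  time_interval T t -> exists C, forall x, `|k (A t x) / J t (A t x)| <= C.
Proof.
move=> kN It; have [c c0 cJ] := good It; exists (N * c^-1) => x.
rewrite normrM; apply: ler_pM => //.
have cj : c <= J t (A t x) by apply: cJ; rewrite (time0 It) lexx.
by rewrite gtr0_norm ?invr_gt0 ?(lt_le_trans c0)// lef_pV2// posrE// (lt_le_trans c0).
Qed.

Lemma weight_bounded : exists N, forall y, `|w y| <= N.
Proof.
have [C C0 HC] := continuous_bounded_itv (- K) K cw; exists C => y.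
by have [/HC//|/w_supp ->] := boolP (y \in `[(- K), K]); rewrite normr0.
Qed.

Lemma density_C_Loo : C_Loo T rho.
Proof.
have [N HN] := weight_bounded; apply: C_Loo_of_uniform => [t It|t It|t e It e0].
- exact: density_continuous.
- exact: (transported_bounded HN It).
- exact: (transported_close HN w_unif It e0).
Qed.

Lemma derive1_velocity t x : time_interval T t ->
  derive1 (u t) x = w1 (A t x) / J t (A t x) - q t x.
Proof. by move=> It; exact: is_derive_derive1 (is_derive_velocity_space x It). Qed.

Lemma derive1_velocity_continuous t : time_interval T t -> continuous (derive1 (u t)).
Proof.
move=> It; have t0 := time0 It.
have -> : derive1 (u t) = fun x => w1 (A t x) / J t (A t x) - q t x.
  by apply/funext => x; exact: derive1_velocity.
apply: continuousBf; last first.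
  by apply: lipschitz_continuous => x y; exact: flow_damping_lip t0.
have cw1 : continuous w1.
  move=> a; apply/continuousP_eps => e /w1_unif[d d0 Hd]; exists d => // b; exact: Hd.
move=> x; apply: cvgM; first exact: (continuous_compf cw1 (label_continuous It)).
apply: cvgV; first by rewrite gt_eqF// jacobian_pos.
exact: (continuous_compf (jacobian_continuous t0) (label_continuous It)).
Qed.

Lemma derive1_velocity_bounded t : time_interval T t ->
  exists C, forall x, `|derive1 (u t) x| <= C.
Proof.
move=> It; have [C HC] := transported_bounded w1_le It.
exists (C + cst) => x; rewrite derive1_velocity//.
apply: le_trans (ler_normB _ _) _; apply: lerD => //.
exact: flow_damping_le (time0 It).
Qed.

Lemma velocity_C_dotW1oo : C_dotW1oo T u.
Proof.
split.
- move=> t It; have [C HC] := derive1_velocity_bounded It.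
  apply: (dotW1oo_of_continuous (f' := derive1 (u t)) _ _ HC).
    move=> x; apply: derivable_is_derive.
    exact: (ex_derive (is_derive := is_derive_velocity_space x It)).
  exact: derive1_velocity_continuous.
- apply: C_Loo_of_uniform => [t It|t It|t e It e0].
  + exact: derive1_velocity_continuous.
  + exact: derive1_velocity_bounded.
  have e20 : 0 < e / 2 by rewrite divr_gt0.
  have [d1 d10 H1] := transported_close w1_le w1_unif It e20.
  have M0 : 0 < m * Lp + 1 by rewrite ltr_wpDl// mulr_ge0.
  have e3 : 0 < e / 2 / (m * Lp + 1) by rewrite divr_gt0.
  have /continuousP_eps/(_ _ e3)[d2 d20 H2] := @cB t.
  exists (Num.min d1 d2) => [|s Is]; first by rewrite lt_min d10.
  rewrite lt_min => /andP[sd1 sd2] x; rewrite !derive1_velocity//.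
  have rearr (k1 k2 q1 q2 : R) : k1 - q1 - (k2 - q2) = (k1 - k2) - (q1 - q2) by ring.
  rewrite rearr (splitr e); apply: le_trans (ler_normB _ _) _; apply: lerD; first exact: H1.
  have Hq : `|q s x - q t x| <= m * Lp * `|B s - B t|.
    have [ts|/ltW st] := leP t s.
      apply: le_trans (flow_damping_time x (time0 It) ts) _.
      by rewrite ler_wpM2l ?mulr_ge0 ?ler_norm.
    rewrite distrC (distrC (B s)); apply: le_trans (flow_damping_time x (time0 Is) st) _.
    by rewrite ler_wpM2l ?mulr_ge0 ?ler_norm.
  apply: (le_trans Hq); apply: (@le_trans _ _ ((m * Lp + 1) * (e / 2 / (m * Lp + 1)))).
    apply: ler_pM; [exact: mulr_ge0|exact: normr_ge0|by rewrite lerDl|exact: H2].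
  by rewrite mulrC divfK// gt_eqF.
move=> x; apply/within_continuousP_eps => t It e e0.
have t0 := time0 It.
have W10 : 0 < W + 1 by rewrite ltr_wpDl.
have e2 : 0 < e / 2 by rewrite divr_gt0.
have e2W : 0 < e / 2 / (W + 1) by rewrite divr_gt0.
have [d1 d10 H1] := label_close It e2W.
pose k := m * p0 + 1; have k0 : 0 < k by rewrite ltr_wpDl// mulr_ge0.
have ch : continuous (fun s => k * `|B s - B t| + `|ubar * ga| * `|s - t|).
  apply: continuousDf; apply: continuousZf.
    apply: (continuous_compf (f := Num.norm)); first exact: norm_continuous.
    by apply: continuousBf => // y; exact: cst_continuous.
  apply: (continuous_compf (f := Num.norm)); first exact: norm_continuous.
  by apply: continuousBf => y; [exact: cvg_id|exact: cst_continuous].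
have /continuousP_eps/(_ _ e2)[d2 d20 H2] := @ch t.
exists (Num.min d1 d2) => [|s Is]; first by rewrite lt_min d10.
rewrite lt_min => /andP[sd1 sd2]; have s0 := time0 Is.
have {}H2 : k * `|B s - B t| + `|ubar * ga| * `|s - t| <= e / 2.
  have := H2 s sd2; rewrite !subrr !normr0 !mulr0 addr0 subr0.
  exact: le_trans (ler_norm _).
have HP : `|P s x - P t x| <= k * `|B s - B t| + `|ubar * ga| * `|s - t|.
  have rearr (x1 z1 z2 y1 s1 t1 : R) : x1 + z1 - y1 * s1 - (x1 + z2 - y1 * t1) =
    (z1 - z2) - y1 * (s1 - t1) by ring.
  rewrite /P rearr; apply: le_trans (ler_normB _ _) _; rewrite normrM lerD2r.
  apply: (@le_trans _ _ (m * (p0 * `|B s - B t|))); last first.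
    by rewrite mulrA ler_wpM2r// lerDl.
  apply: normr_wintB => //; try by apply: continuous_kernel_comp => //; exact: cX.
  move=> b _; apply: le_trans (kernel_primitive_lip dPsi psi_le _ _) _; rewrite ler_wpM2l//.
  have -> : x - X s b - (x - X t b) = X t b - X s b by ring.
  have [ts|/ltW st] := leP t s.
    by rewrite distrC; apply: le_trans (flow_time b t0 ts) (ler_norm _).
  by rewrite (distrC (B s)); apply: le_trans (flow_time b s0 st) (ler_norm _).
have rearr (k1 k2 q1 q2 : R) : k1 - q1 - (k2 - q2) = (k1 - k2) - (q1 - q2) by ring.
rewrite /u rearr (splitr e); apply: le_trans (ler_normB _ _) _; apply: lerD; last exact: le_trans HP H2.
apply: le_trans (lipschitz_of_derive dw0 w1_le _ _) _.
apply: (@le_trans _ _ ((W + 1) * (e / 2 / (W + 1)))).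
  by apply: ler_pM; [exact: W0|exact: normr_ge0|by rewrite lerDl|exact: H1].
by rewrite mulrC divfK// gt_eqF.
Qed.

(** Since [V] at the label of [x] equals [u t x], the terms in [w1] of the time derivative and of
    the convective term cancel. What is left is the integral of [psi * V] plus [ubar * ga - u * q],
    which is the alignment integral plus the control. *)
Lemma lagrangian_momentum gamma : gamma^-1 = ga ->
  momentum_equation gamma ubar psi T rho u.
Proof.
move=> gE t x tp tT; have It : time_interval T t by split => //; exact: ltW.
have t0 := time0 It.
have cV := flow_speed_continuous t0.
have cpX : continuous (fun b => psi (x - X t b)) by apply: continuous_kernel_comp => //; exact: cX.
have cg : continuous (fun y => psi (x - y) * (u t y - u t x)).
  apply: continuousMf.
    have cid : continuous (@id R) by move=> y; exact: cvg_id.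
    exact: (continuous_kernel_comp (x := x) cpsi cid).
  by apply: continuousBf; [exact: velocity_continuous|move=> y; exact: cst_continuous].
split.
- exact: (ex_derive (is_derive := is_derive_velocity_time x tp It)).
- exact: (ex_derive (is_derive := is_derive_velocity_space x It)).
- exact: density_integrable.
rewrite (density_integral It cg) derive1_velocity//.
rewrite (is_derive_derive1 (is_derive_velocity_time x tp It)) gE.
have -> : E (fun b => psi (x - X t b) * (u t (X t b) - u t x)) =
    E (fun b => psi (x - X t b) * V t b) - u t x * E (fun b => psi (x - X t b)).
  rewrite -(wintZ iw)// -(wintB iw).
  - by apply: eq_wint => b _; rewrite velocity_flow//; ring.
  - exact: continuousMf.
  - exact: continuousZf.
have -> : V t (A t x) = u t x by rewrite -velocity_flow// flow_label.
rewrite /q; move: (E _) (E _) (u t x) (w1 _) (J t _) => e1 e2 v w' j.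
by ring.
Qed.

(** Written over labels, the tested mass is the integral of [phi (X s b)] against a fixed weight, so
    time enters only through the trajectories. The derivative of [phi] is bounded on
    [[- K - D, K + D]], which they do not leave before time [r]. *)
Lemma lagrangian_continuity_equation : continuity_equation T rho u.
Proof.
move=> phi [dphi cphi'] _ t tp tT; have It : time_interval T t by split => //; exact: ltW.
have dphi1 y : is_derive y 1 phi (derive1 phi y) by exact: derivable_is_derive.
have cphi : continuous phi by exact: is_derive_all_continuous dphi1.
have [r tr Ir] := time_interval_right It; have r0 := time0 Ir.
have [C C0 HC] := flow_speed_bounded r0.
pose D := B r - B 0.
have XD s b : 0 <= s -> s <= r -> `|X s b - b| <= D.
  move=> s0 sr; have := flow_time b (lexx 0) s0; rewrite flow_init => /le_trans; apply.
  by rewrite lerD2r; exact: flow_modulus_homo.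
have [C1 C10 HC1] := continuous_bounded_itv (- K - D) (K + D) cphi'.
pose mass s := \int[mu]_x (rho s x * phi x).
have massE s : time_interval T s -> mass s = E (fun b => phi (X s b)).
  move=> Is; rewrite -density_integral//; apply: eq_Rintegral => y _; exact: mulrC.
have dm : is_derive t 1 (fun s => E (fun b => phi (X s b))) (E (fun b => derive1 phi (X t b) * V t b)).
  apply: (is_derive_wint (F := fun s b => phi (X s b)) (F' := fun s b => derive1 phi (X s b) * V s b)
    iw (u := 0) (v := r) (C := C1 * C)).
  - by rewrite tp.
  - by move=> s /andP[/ltW s0 _]; apply: continuous_compf => //; exact: cX.
  - by move=> s b /andP[/ltW s0 _] _; exact: is_derive_compf (dphi1 _) (dX b s0).
  move=> s b /andP[/ltW s0 /ltW sr] bK; rewrite normrM; apply: ler_pM => //; last by apply: HC; rewrite s0.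
  exact: HC1 (itv_near_itv bK (XD s b s0 sr)).
have {}dm : is_derive t 1 mass (E (fun b => derive1 phi (X t b) * V t b)).
  apply: near_eq_is_derive dm; near=> s; rewrite massE//.
  apply: time_interval_down Ir _; apply/andP; split; apply: ltW; near: s.
    exact: lt_nbhsr.
  exact: lt_nbhsl.
split; first exact: (ex_derive (is_derive := dm)).
rewrite (is_derive_derive1 dm).
have -> : E (fun b => derive1 phi (X t b) * V t b) =
   E (fun b => (fun y => u t y * derive1 phi y) (X t b)).
  by apply: eq_wint => b _; rewrite velocity_flow// mulrC.
have cg : continuous (fun y => u t y * derive1 phi y).
  by apply: continuousMf => //; exact: velocity_continuous.
rewrite -(density_integral It cg).
by apply: eq_Rintegral => y _ /=; rewrite [LHS]mulrC mulrA.
Unshelve. all: by end_near. Qed.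

Lemma lagrangian_strong_solution gamma (u0 : R -> R) : gamma^-1 = ga -> (0%:E < T)%E ->
  (forall x, u0 x = w0 x - ga * x - E (fun b => Psi (x - b))) ->
  strong_solution gamma ubar psi w u0 T rho u.
Proof.
move=> gE T0 u0E; have A0 x : A 0 x = x by rewrite -{1}(flow_init x) label_flow.
split; [split; [exact: density_C_Loo|exact: velocity_C_dotW1oo|]|
  exact: lagrangian_continuity_equation|exact: lagrangian_momentum| |].
- move=> t It; apply: ae_all => x; rewrite /rho divr_ge0// ltW// jacobian_pos//.
- by apply: ae_all => x; rewrite /rho A0 jacobian_init divr1.
move=> x; rewrite u0E /u A0 /P mulr0 subr0 opprD addrA; congr (_ - _).
by apply: eq_wint => b _; rewrite flow_init.
Qed.
End LagrangianSolution.

(** * Transport of mass *)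

Section Compactness.
Context {R : realType}.

(** Compactness for an arbitrary property that is monotone in its bound, so that it covers almost
    everywhere bounds, Lipschitz constants and moduli of continuity alike. *)
Lemma locally_bounded_itv (P : R -> R -> Prop) (a b : R) :
  (forall t B B', P t B -> B <= B' -> P t B') ->
  (forall t, a <= t <= b -> exists B d, 0 < d /\
     forall s, a <= s <= b -> `|s - t| < d -> P s B) ->
  exists2 B, 0 <= B & forall t, a <= t <= b -> P t B.
Proof.
move=> Pmono Ploc.
have /compact_near_coveringP/(_ R +oo%R
  (fun B t => t \in `[a, b] -> P t B) _) := @segment_compact R a b.
have H0 x : `[a, b]%classic x -> \forall x' \near x & i \near +oo%R, x' \in `[a, b] -> P x' i.
  rewrite /= in_itv/= => /Ploc[B [d [d0 H]]].
  exists (ball x d, [set i | B < i]).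
    split; first exact: nbhsx_ballx.
    exact: nbhs_pinfty_gt (num_real _).
  move=> [y i] [/= yx Bi]; rewrite in_itv/= => yab; apply: Pmono (ltW Bi).
  by apply: H => //; rewrite distrC.
move=> /(_ H0)[B [_ HB]]; exists (`|B| + 1) => [|t tab]; first by rewrite addr_ge0.
apply: (HB (`|B| + 1)) => //; first by rewrite (le_lt_trans (ler_norm _))// ltrDl.
Qed.

Lemma compactly_supported_itv (f : R -> R) (a b : R) :
  (forall y, y \notin `[a, b] -> f y = 0) -> compactly_supported f.
Proof.
move=> f0; apply: (@subclosed_compact _ _ `[a, b]%classic).
- exact: closed_closure.
- exact: segment_compact.
have /closure_id E : closed `[a, b]%classic by exact: interval_closed.
rewrite [X in _ `<=` X]E; apply: closureS => y /=; apply: contraR => h.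
exact/eqP/f0.
Qed.
End Compactness.

Section MassTransport.
Context {R : realType}.
Notation mu := (@lebesgue_measure R).
Implicit Types (x y z t s e p q C : R) (f g h w : R -> R).

Lemma wmass_le w p q C : 0 <= C -> p <= q -> measurable_fun [set: R] w ->
  {ae mu, forall x, `|w x| <= C} -> wmass p q w <= C * (q - p).
Proof.
move=> C0 pq mw wC; rewrite /wmass.
have iw := ae_bounded_integrable p q C0 mw wC.
apply: le_trans (ler_norm _) _; apply: ae_normr_Rintegral_le => //.
- exact: measurableT_comp.
- by apply: ae_imply wC => x; rewrite normr_id.
- exact: integrable_norm.
Qed.

Lemma wintBw (w1 w2 g : R -> R) p q : mu.-integrable `[p, q] (EFin \o w1) ->
  mu.-integrable `[p, q] (EFin \o w2) -> continuous g ->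
  wint p q (fun y => w1 y - w2 y) g = wint p q w1 g - wint p q w2 g.
Proof.
move=> i1 i2 cg; rewrite /wint -RintegralB//; try exact: wint_integrable.
by apply: eq_Rintegral => y _; rewrite mulrBr.
Qed.

Definition tent e z : R := Num.max 0 (e - `|z|).

Lemma tent_ge0 e z : 0 <= tent e z.
Proof. exact: max0_ge0. Qed.

Lemma tent_le e z : 0 <= e -> tent e z <= e.
Proof. by move=> e0; rewrite /tent ge_max e0 gerBl normr_ge0. Qed.

Lemma tent_out e z : e <= `|z| -> tent e z = 0.
Proof. by move=> ez; apply/max_idPl; rewrite subr_le0. Qed.

Lemma tent_continuous e : continuous (tent e).
Proof.
apply: (continuous_compf continuous_max0).
by apply: continuousBf; [move=> x; exact: cst_continuous|exact: norm_continuous].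
Qed.

(** A continuously differentiable step, constant outside [[- e, e]]. Differences of two shifted
    ramps are admissible test functions that approximate a multiple of the indicator of an
    interval. *)
Definition ramp e : R -> R := primitive (tent e).

Lemma is_derive_ramp e z : is_derive z 1 (ramp e) (tent e z).
Proof. exact: (is_derive_primitive z (@tent_continuous e)). Qed.

Lemma ramp_continuous e : continuous (ramp e).
Proof. exact: is_derive_all_continuous (is_derive_ramp e). Qed.

Lemma ramp_lip e x y : 0 <= e -> `|ramp e x - ramp e y| <= e * `|x - y|.
Proof.
move=> e0; apply: (lipschitz_of_derive (is_derive_ramp e)) => z.
by rewrite ger0_norm ?tent_ge0 ?tent_le.
Qed.

Lemma ramp_right e z : 0 < e -> e <= z -> ramp e z = ramp e e.
Proof.
move=> e0 ez; apply: eq_of_derive0 => //; first exact: continuous_within (@ramp_continuous e).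
move=> x /andP[ex _]; rewrite -(tent_out (e := e) (z := x)); first exact: is_derive_ramp.
by rewrite gtr0_norm ?(lt_trans e0)// ltW.
Qed.

Lemma ramp_left e z : 0 < e -> z <= - e -> ramp e z = ramp e (- e).
Proof.
move=> e0 ez; apply/esym; apply: eq_of_derive0 => //.
  exact: continuous_within (@ramp_continuous e).
move=> x /andP[_ xe]; rewrite -(tent_out (e := e) (z := x)); first exact: is_derive_ramp.
by rewrite ltr0_norm; lra.
Qed.

(** Only the right half of the tent is integrated; half of the true height suffices, since the
    errors are of order [e ^+ 3]. *)
Lemma ramp_height e : 0 < e -> e ^+ 2 / 2 <= ramp e e - ramp e (- e).
Proof.
move=> e0.
have h1 : 0 - 0 <= ramp e 0 - ramp e (- e).
  apply: (ler_of_derive (f := fun _ => 0)).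
  - lra.
  - by apply: continuous_within => x; exact: cst_continuous.
  - exact: continuous_within (@ramp_continuous e).
  move=> x _; exists 0, (tent e x); split; [exact: is_derive_cstf|exact: is_derive_ramp|exact: tent_ge0].
have d2 x : is_derive x 1 (fun z => e * z - z * z / 2) (e - x).
  have := is_deriveBf (is_deriveZf e (is_derive_idf x))
    (is_deriveMf (is_deriveMf (is_derive_idf x) (is_derive_idf x)) (is_derive_cstf (2^-1) x)).
  by rewrite (_ : e * 1 - _ = e - x) //; field.
have h2 : (e * e - e * e / 2) - (e * 0 - 0 * 0 / 2) <= ramp e e - ramp e 0.
  apply: (ler_of_derive (f := fun z => e * z - z * z / 2)).
  - lra.
  - by apply: is_derive_within => x _; exact: d2.
  - exact: continuous_within (@ramp_continuous e).
  move=> x /andP[x0 xe]; exists (e - x), (tent e x); split; [exact: d2|exact: is_derive_ramp|].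
  by rewrite /tent gtr0_norm// le_max lexx orbT.
rewrite expr2; lra.
Qed.

(** * Conservation of the mass between two characteristics *)

Variables (T1 L N Vm : R) (rho u : R -> R -> R) (X Y : R -> R).
Hypothesis N0 : 0 <= N.
Hypothesis L0 : 0 <= L.
Hypothesis Vm0 : 0 <= Vm.
Hypothesis T10 : 0 <= T1.
Hypothesis rho_meas : forall t, 0 <= t <= T1 -> measurable_fun [set: R] (rho t).
Hypothesis rho_le : forall t, 0 <= t <= T1 -> {ae mu, forall x, `|rho t x| <= N}.
Hypothesis rho_cont : forall t e, 0 <= t <= T1 -> 0 < e -> exists2 d, 0 < d &
  forall s, 0 <= s <= T1 -> `|s - t| < d -> {ae mu, forall x, `|rho s x - rho t x| <= e}.
Hypothesis u_lip : forall t, 0 <= t <= T1 -> forall x y, `|u t x - u t y| <= L * `|x - y|.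
Hypothesis rho_eq : forall phi phi' : R -> R, (forall x, is_derive x 1 phi (phi' x)) ->
  continuous phi' -> compactly_supported phi -> forall t, 0 < t < T1 ->
  is_derive t 1 (fun s => \int[mu]_x (rho s x * phi x)) (\int[mu]_x (rho t x * u t x * phi' x)).
Hypothesis dX : forall t, 0 <= t <= T1 -> is_derive t 1 X (u t (X t)).
Hypothesis dY : forall t, 0 <= t <= T1 -> is_derive t 1 Y (u t (Y t)).
Hypothesis XY : forall t, 0 <= t <= T1 -> X t <= Y t.
Hypothesis speedX : forall t, 0 <= t <= T1 -> `|u t (X t)| <= Vm.
Hypothesis speedY : forall t, 0 <= t <= T1 -> `|u t (Y t)| <= Vm.

Let path_lip (Z : R -> R) : (forall t, 0 <= t <= T1 -> is_derive t 1 Z (u t (Z t))) ->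
  (forall t, 0 <= t <= T1 -> `|u t (Z t)| <= Vm) ->
  forall s t, 0 <= s <= T1 -> 0 <= t <= T1 -> `|Z s - Z t| <= Vm * `|s - t|.
Proof.
move=> dZ vZ.
have H s t : 0 <= s -> s <= t -> t <= T1 -> `|Z t - Z s| <= Vm * (t - s).
  move=> s0 st tT; rewrite mulrBr.
  apply: (normr_ler_of_derive (g := fun r => Vm * r)) => //.
  - apply: (is_derive_within (f' := fun r => u r (Z r))) => r /=; rewrite in_itv/= => /andP[sr rt].
    by apply: dZ; rewrite (le_trans s0 sr) (le_trans rt).
  - by apply: continuous_within; apply: continuousZf => x; exact: cvg_id.
  move=> r /andP[/ltW sr /ltW rt]; have rT : 0 <= r <= T1 by rewrite (le_trans s0 sr) (le_trans rt).
  exists (u r (Z r)), (Vm * 1); split; [exact: dZ|exact: is_deriveZf (is_derive_idf _)|].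
  by rewrite mulr1; exact: vZ.
move=> s t /andP[s0 sT] /andP[t0 tT]; have [st|/ltW ts] := leP s t.
  by rewrite distrC (distrC s) (ger0_norm (x := t - s)) ?subr_ge0// H.
by rewrite (ger0_norm (x := s - t)) ?subr_ge0// H.
Qed.

Section Ramp.
Variable e : R.
Hypothesis e0 : 0 < e.
Let e_ge0 := ltW e0.
(** A time-independent interval that contains the support of every [phi s]: the characteristics
    travel at most [Vm * T1], and each ramp extends by [2 * e]. *)
Let lo := X 0 - Vm * T1 - 2 * e.
Let hi := Y 0 + Vm * T1 + 2 * e.

(* The plateau [X s, Y s] of the test function moves with the fluid, so that
   only the velocity differences [u s y - u s (X s)] near its ends contribute
   to the rate of change of the mass it measures. *)
Let phi s y := ramp e (y - X s + e) - ramp e (y - Y s - e).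
Let phi_x s y := tent e (y - X s + e) - tent e (y - Y s - e).
Let phi_t s y := tent e (y - Y s - e) * u s (Y s) - tent e (y - X s + e) * u s (X s).
Let height := ramp e e - ramp e (- e).

Let is_derive_phi s y : is_derive y 1 (phi s) (phi_x s y).
Proof.
have d1 := is_derive_compf (is_derive_ramp e _)
  (is_deriveDf (is_deriveBf (is_derive_idf y) (is_derive_cstf (X s) y)) (is_derive_cstf e y)).
have d2 := is_derive_compf (is_derive_ramp e _)
  (is_deriveBf (is_deriveBf (is_derive_idf y) (is_derive_cstf (Y s) y)) (is_derive_cstf e y)).
by have := is_deriveBf d1 d2; rewrite !subr0 addr0 !mulr1.
Qed.

Let is_derive_phi_t s y : 0 <= s <= T1 -> is_derive s 1 (phi^~ y) (phi_t s y).
Proof.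
move=> sT.
have d1 := is_derive_compf (is_derive_ramp e _)
  (is_deriveDf (is_deriveBf (is_derive_cstf y s) (dX sT)) (is_derive_cstf e s)).
have d2 := is_derive_compf (is_derive_ramp e _)
  (is_deriveBf (is_deriveBf (is_derive_cstf y s) (dY sT)) (is_derive_cstf e s)).
have := is_deriveBf d1 d2; congr is_derive; rewrite /phi_t; ring.
Qed.

Let cphi s : continuous (phi s).
Proof. exact: is_derive_all_continuous (is_derive_phi s). Qed.

Let ctent s (c : R) : continuous (fun y => tent e (y - s + c)).
Proof.
apply: (continuous_compf (@tent_continuous e)).
apply: continuousDf; last by move=> x; exact: cst_continuous.
by apply: continuousBf; [move=> x; exact: cvg_id|move=> x; exact: cst_continuous].
Qed.

Let cphi_x s : continuous (phi_x s).
Proof. by apply: continuousBf; exact: ctent. Qed.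

Let cphi_t s : continuous (phi_t s).
Proof.
by apply: continuousBf; (apply: continuousMf; [exact: ctent|move=> x; exact: cst_continuous]).
Qed.

Let phi_plateau s y : X s <= y <= Y s -> phi s y = height.
Proof.
move=> /andP[xy yY]; rewrite /phi.
have -> : ramp e (y - X s + e) = ramp e e by apply: ramp_right => //; lra.
by have -> : ramp e (y - Y s - e) = ramp e (- e) by apply: ramp_left => //; lra.
Qed.

Let phi_out s y : 0 <= s <= T1 -> y \notin `[X s - 2 * e, Y s + 2 * e] -> phi s y = 0.
Proof.
have e1 := e0.
move=> sT; have := XY sT; rewrite in_itv/= negb_and -!ltNge => xy /orP[h|h]; rewrite /phi.
  have -> : ramp e (y - X s + e) = ramp e (- e) by apply: ramp_left => //; lra.
  have -> : ramp e (y - Y s - e) = ramp e (- e) by apply: ramp_left => //; lra.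
  exact: subrr.
have -> : ramp e (y - X s + e) = ramp e e by apply: ramp_right => //; lra.
have -> : ramp e (y - Y s - e) = ramp e e by apply: ramp_right => //; lra.
exact: subrr.
Qed.

(** The slope of [phi s] is at most [2 * e], and a zero of it, taken at distance [e] outside the
    support, lies within [3 * e]. *)
Let phi_le s y : 0 <= s <= T1 -> y \in `[X s - 2 * e, X s] \/ y \in `[Y s, Y s + 2 * e] ->
  `|phi s y| <= 6 * e ^+ 2.
Proof.
move=> sT h.
have lip y1 y2 : `|phi s y1 - phi s y2| <= (2 * e) * `|y1 - y2|.
  apply: (lipschitz_of_derive (is_derive_phi s)) => z; apply: le_trans (ler_normB _ _) _.
  by rewrite !ger0_norm ?tent_ge0// mulr2n mulrDl mul1r lerD// tent_le.
have [z [pz yz]] : exists z, phi s z = 0 /\ `|y - z| <= 3 * e.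
  have e1 := e0; have xy := XY sT; case: h; rewrite in_itv/= => /andP[h1 h2].
    exists (X s - 2 * e - e); split; last by rewrite ger0_norm; lra.
    by apply: phi_out => //; rewrite in_itv/= negb_and -!ltNge; apply/orP; left; lra.
  exists (Y s + 2 * e + e); split; last by rewrite ler0_norm; lra.
  by apply: phi_out => //; rewrite in_itv/= negb_and -!ltNge; apply/orP; right; lra.
have := lip y z; rewrite pz subr0 => /le_trans; apply.
apply: le_trans (ler_wpM2l _ yz) _; first by rewrite mulr_ge0.
by apply: eq_ler; ring.
Qed.

Let range_X s : 0 <= s <= T1 -> lo <= X s - 2 * e.
Proof.
move=> sT; have z0 : 0 <= (0 : R) <= T1 by apply/andP; split => //.
have := path_lip dX speedX sT z0.
move: (sT) => /andP[s0 sT1]; rewrite subr0 (ger0_norm s0) ler_norml => /andP[h _].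
have := ler_wpM2l Vm0 sT1; rewrite /lo; lra.
Qed.

Let range_Y s : 0 <= s <= T1 -> Y s + 2 * e <= hi.
Proof.
move=> sT; have z0 : 0 <= (0 : R) <= T1 by apply/andP; split => //.
have := path_lip dY speedY sT z0.
move: (sT) => /andP[s0 sT1]; rewrite subr0 (ger0_norm s0) ler_norml => /andP[_ h].
have := ler_wpM2l Vm0 sT1; rewrite /hi; lra.
Qed.

Let lohi : lo <= hi.
Proof.
have sT : 0 <= (0 : R) <= T1 by apply/andP; split => //.
by have := range_X sT; have := range_Y sT; have := XY sT; have := e0; move=> *; lra.
Qed.

Let phi_out_lohi s y : 0 <= s <= T1 -> y \notin `[lo, hi] -> phi s y = 0.
Proof.
move=> sT h; apply: phi_out => //; apply: contra h; rewrite !in_itv/= => /andP[h1 h2].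
by rewrite (le_trans (range_X sT) h1) (le_trans h2 (range_Y sT)).
Qed.

Let irho s p q : 0 <= s <= T1 -> mu.-integrable `[p, q] (EFin \o rho s).
Proof. by move=> sT; exact: ae_bounded_integrable N0 (rho_meas sT) (rho_le sT). Qed.

Let M s := wint lo hi (rho s) (phi s).

Let phi_time_lip s t y : 0 <= s <= T1 -> 0 <= t <= T1 ->
  `|phi s y - phi t y| <= 2 * e * Vm * `|s - t|.
Proof.
move=> sT tT.
have -> : phi s y - phi t y = (ramp e (y - X s + e) - ramp e (y - X t + e)) -
  (ramp e (y - Y s - e) - ramp e (y - Y t - e)) by rewrite /phi; ring.
apply: le_trans (ler_normB _ _) _.
have h1 := ramp_lip (y - X s + e) (y - X t + e) e_ge0.
have h2 := ramp_lip (y - Y s - e) (y - Y t - e) e_ge0.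
have r1 : y - X s + e - (y - X t + e) = - (X s - X t) by ring.
have r2 : y - Y s - e - (y - Y t - e) = - (Y s - Y t) by ring.
rewrite r1 normrN in h1; rewrite r2 normrN in h2.
have h3 := ler_wpM2l e_ge0 (path_lip dX speedX sT tT).
have h4 := ler_wpM2l e_ge0 (path_lip dY speedY sT tT).
apply: le_trans (lerD (le_trans h1 h3) (le_trans h2 h4)) _.
by apply: eq_ler; ring.
Qed.

Let phi_bound s y : 0 <= s <= T1 -> `|phi s y| <= e * (Y s - X s + 2 * e).
Proof.
move=> sT; apply: le_trans (ramp_lip _ _ e_ge0) _; rewrite ler_wpM2l//.
have -> : y - X s + e - (y - Y s - e) = Y s - X s + 2 * e by ring.
by rewrite ger0_norm//; have := XY sT; have := e_ge0; lra.
Qed.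

Let weight_diff s t d (g : R -> R) C : 0 <= s <= T1 -> 0 <= t <= T1 -> 0 <= d ->
  {ae mu, forall x, `|rho s x - rho t x| <= d} -> continuous g ->
  (forall y, `|g y| <= C) ->
  `|wint lo hi (rho s) g - wint lo hi (rho t) g| <= d * (hi - lo) * C.
Proof.
move=> sT tT d0 H cg gC.
have C0 : 0 <= C := le_trans (normr_ge0 _) (gC 0).
have mst : measurable_fun [set: R] (fun y => rho s y - rho t y).
  by apply: measurable_funB; exact: rho_meas.
have ist := ae_bounded_integrable lo hi d0 mst H.
rewrite -wintBw//; try exact: irho.
apply: le_trans (normr_wint ist cg (fun y _ => gC y)) _.
by rewrite ler_wpM2r//; exact: wmass_le.
Qed.

Let M_continuous : {within `[0, T1], continuous M}.
Proof.
apply/within_continuousP_eps => t; rewrite /= in_itv/= => tT h h0.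
set D := hi - lo; have D0 : 0 <= D by rewrite subr_ge0.
set C := e * (Y t - X t + 2 * e).
have C0 : 0 <= C by apply: le_trans (phi_bound 0 tT).
have DC1 : 0 < D * C + 1 by rewrite ltr_wpDl// mulr_ge0.
have [d1 d10 H1] := rho_cont tT (divr_gt0 (divr_gt0 h0 (ltr0Sn _ 1)) DC1).
have NDV : 0 < N * D * (2 * e * Vm) + 1.
  by rewrite ltr_wpDl// !mulr_ge0// ltW.
exists (Num.min d1 (h / 2 / (N * D * (2 * e * Vm) + 1))) => [|s].
  by rewrite lt_min d10 divr_gt0// divr_gt0.
rewrite /= in_itv/= => sT; rewrite lt_min => /andP[sd1 sd2].
have -> : M s - M t = (wint lo hi (rho s) (phi s) - wint lo hi (rho s) (phi t)) +
   (wint lo hi (rho s) (phi t) - wint lo hi (rho t) (phi t)).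
  by rewrite addrA subrK.
rewrite (splitr h); apply: le_trans (ler_normD _ _) _; apply: lerD.
  apply: le_trans (normr_wintB (irho _ _ sT) (@cphi s) (@cphi t) (fun y _ => phi_time_lip y sT tT)) _.
  apply: (@le_trans _ _ (N * D * (2 * e * Vm * `|s - t|))).
    by rewrite ler_wpM2r ?mulr_ge0//; apply: wmass_le => //; [exact: rho_meas|exact: rho_le].
  rewrite [X in X <= _]mulrA; apply: (@le_trans _ _ ((N * D * (2 * e * Vm) + 1) * `|s - t|)).
    by rewrite ler_wpM2r// lerDl.
  by rewrite mulrC -ler_pdivlMr// ltW.
apply: le_trans (weight_diff sT tT _ (H1 s sT sd1) (@cphi t) (fun y => phi_bound y tT)) _.
  by rewrite !divr_ge0// ltW.
rewrite -/D -/C -mulrA; apply: (@le_trans _ _ (h / 2 / (D * C + 1) * (D * C + 1))).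
  by rewrite ler_wpM2l ?lerDl// !divr_ge0// ltW.
by rewrite divfK// gt_eqF.
Qed.

(** On the edge around [Z] the velocity differs from that at [Z] by at most [2 * L * e], the tent is
    at most [e], and the mass at most [4 * e * N]. The product is one order smaller than the height
    of the plateau. *)
Let flux_le t (Z c : R) : 0 <= t <= T1 ->
  (forall y, tent e (y - Z + c) != 0 -> y \in `[Z - 2 * e, Z + 2 * e]) ->
  lo <= Z - 2 * e -> Z + 2 * e <= hi ->
  `|wint lo hi (rho t) (fun y => (u t y - u t Z) * tent e (y - Z + c))| <=
    8 * N * L * e ^+ 3.
Proof.
move=> tT supp loZ hiZ.
have cu : continuous (u t) by exact: lipschitz_continuous (u_lip tT).
have cg : continuous (fun y => (u t y - u t Z) * tent e (y - Z + c)).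
  apply: continuousMf; last exact: ctent.
  by apply: continuousBf => // x; exact: cst_continuous.
have out y : y \notin `[Z - 2 * e, Z + 2 * e] -> (u t y - u t Z) * tent e (y - Z + c) * rho t y = 0.
  by move=> h; have [->|/supp] := eqVneq (tent e (y - Z + c)) 0; [rewrite mulr0 mul0r|rewrite (negbTE h)].
have -> : wint lo hi (rho t) (fun y => (u t y - u t Z) * tent e (y - Z + c)) =
   wint (Z - 2 * e) (Z + 2 * e) (rho t) (fun y => (u t y - u t Z) * tent e (y - Z + c)).
  rewrite /wint -!Rintegral_itv_setT// => y h; apply: out; apply: contra h.
  by rewrite !in_itv/= => /andP[h1 h2]; rewrite (le_trans loZ) ?(le_trans h2).
have e1 := e_ge0.
apply: le_trans (normr_wint (irho _ _ tT) cg (C := 2 * L * e ^+ 2) _) _.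
  move=> y; rewrite in_itv/= => /andP[h1 h2]; rewrite normrM (ger0_norm (tent_ge0 _ _)).
  have h3 : `|u t y - u t Z| <= L * (2 * e).
    by apply: le_trans (u_lip tT _ _) _; rewrite ler_wpM2l// ler_norml; lra.
  apply: le_trans (ler_pM (normr_ge0 _) (tent_ge0 _ _) h3 (tent_le _ e_ge0)) _.
  by apply: eq_ler; ring.
have mle : wmass (Z - 2 * e) (Z + 2 * e) (rho t) <= N * (Z + 2 * e - (Z - 2 * e)).
  by apply: wmass_le => //; [lra|exact: rho_meas|exact: rho_le].
apply: le_trans (ler_wpM2r _ mle) _; first by rewrite mulr_ge0 ?mulr_ge0 ?sqr_ge0.
by apply: eq_ler; ring.
Qed.

(** A product rule for the pairing of [rho s] with [phi s], although [rho] has only a weak time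
    derivative. In [f2] only the test function moves; in [f3] it is frozen at time [t], where the
    weak equation applies. The cross term [f1] pairs both increments; it is of higher order since
    [rho] is continuous in the uniform norm and [phi] Lipschitz in time. The sum of the derivatives
    is one flux per edge. *)
Let is_derive_M t : 0 < t < T1 -> exists2 l, is_derive t 1 M l & `|l| <= 16 * N * L * e ^+ 3.
Proof.
move=> tT'; have tT : 0 <= t <= T1 by case/andP: tT' => /ltW -> /ltW ->.
pose f1 s := wint lo hi (rho s) (fun y => phi s y - phi t y) -
             wint lo hi (rho t) (fun y => phi s y - phi t y).
pose f2 s := wint lo hi (rho t) (phi s).
pose f3 s := wint lo hi (rho s) (phi t).
have cphist s : continuous (fun y => phi s y - phi t y) by apply: continuousBf; exact: cphi.
have near_T : \forall s \near t, 0 <= s <= T1.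
  case/andP: tT' => t0 tT1; near=> s; apply/andP; split; apply: ltW; near: s.
    exact: lt_nbhsr.
  exact: lt_nbhsl.
have ME : \forall s \near t, f1 s + f2 s + f3 s - M t = M s.
  near=> s; have sT : 0 <= s <= T1 by near: s.
  have E1 : wint lo hi (rho s) (fun y => phi s y - phi t y) = M s - f3 s.
    by have := wintB (irho lo hi sT) (@cphi s) (@cphi t).
  have E2 : wint lo hi (rho t) (fun y => phi s y - phi t y) = f2 s - M t.
    by have := wintB (irho lo hi tT) (@cphi s) (@cphi t).
  rewrite /f1 E1 E2; move: (M s) (M t) (f2 s) (f3 s) => z1 z2 z3 z4; ring.
have d1 : is_derive t 1 f1 0.
  apply/is_deriveP_eps => h h0; set C := 2 * e * Vm.
  have C0 : 0 <= C by rewrite mulr_ge0// mulr_ge0.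
  have D0 : 0 <= hi - lo by rewrite subr_ge0.
  have k0 : 0 < (hi - lo) * C + 1 by rewrite ltr_wpDl// mulr_ge0.
  have [d d0 Hd] := rho_cont tT (divr_gt0 h0 k0).
  move: near_T => [d' /= d'0 Hd'].
  exists (Num.min d d') => [|s]; first by rewrite lt_min d0.
  rewrite lt_min => /andP[sd sd']; have sT : 0 <= s <= T1 by apply: Hd'; rewrite /= distrC.
  have f1t : f1 t = 0 by rewrite /f1 subrr.
  rewrite f1t subr0 mul0r subr0.
  apply: le_trans (weight_diff sT tT _ (Hd s sT sd) (@cphist s) (fun y => phi_time_lip y sT tT)) _.
    by rewrite divr_ge0// ltW.
  have rearr (z D k : R) : 0 < D * k + 1 -> 0 <= z ->
    h / (D * k + 1) * D * (k * z) <= h * z.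
    move=> Dk z0; have -> : h / (D * k + 1) * D * (k * z) = h * z / (D * k + 1) * (D * k) by ring.
    rewrite -[leRHS](divfK (x := D * k + 1)) ?gt_eqF// ler_wpM2l ?lerDl//.
    by rewrite divr_ge0 ?mulr_ge0// ltW.
  by rewrite -/C; apply: rearr.
have d2 : is_derive t 1 f2 (wint lo hi (rho t) (phi_t t)).
  apply: (is_derive_wint (F := phi) (F' := phi_t) (irho _ _ tT) (u := 0) (v := T1) (C := e * Vm + e * Vm)) => //.
  - by move=> s y /andP[/ltW s0 /ltW sT] _; apply: is_derive_phi_t; rewrite s0.
  move=> s y /andP[/ltW s0 /ltW sT] _; have sT' : 0 <= s <= T1 by rewrite s0.
  apply: le_trans (ler_normB _ _) _; rewrite !normrM !(ger0_norm (tent_ge0 _ _)).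
  by apply: lerD; apply: ler_pM => //; rewrite ?tent_ge0 ?tent_le// ?speedX ?speedY.
have cu : continuous (u t) by exact: lipschitz_continuous (u_lip tT).
have phi_x_out y : y \notin `[lo, hi] -> phi_x t y = 0.
  have e1 := e0; have r1 := range_X tT; have r2 := range_Y tT; have xy := XY tT.
  rewrite in_itv/= negb_and -!ltNge => /orP[h|h]; rewrite /phi_x.
    rewrite !tent_out ?subrr//; first by rewrite ler0_norm; lra.
    by rewrite ler0_norm; lra.
  rewrite !tent_out ?subrr//; first by rewrite ger0_norm; lra.
  by rewrite ger0_norm; lra.
have d3 : is_derive t 1 f3 (wint lo hi (rho t) (fun y => u t y * phi_x t y)).
  have := rho_eq (is_derive_phi t) (@cphi_x t)
    (compactly_supported_itv (fun y => phi_out_lohi tT (y := y))) tT'.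
  have -> : (\int[mu]_x (rho t x * u t x * phi_x t x)) =
     wint lo hi (rho t) (fun y => u t y * phi_x t y).
    rewrite /wint -Rintegral_itv_setT => [|y /phi_x_out ->]; last by rewrite mulr0 mul0r.
    by apply: eq_Rintegral => y _; rewrite -mulrA mulrC.
  have -> : (fun s => \int[mu]_x (rho s x * phi t x)) = f3 => //.
  apply/funext => s; rewrite /f3 /wint -Rintegral_itv_setT => [|y h].
    by apply: eq_Rintegral => y _; rewrite mulrC.
  by rewrite (phi_out_lohi tT h) mul0r.
pose gX y := (u t y - u t (X t)) * tent e (y - X t + e).
pose gY y := (u t y - u t (Y t)) * tent e (y - Y t + (- e)).
have cgX : continuous gX.
  by apply: continuousMf; [apply: continuousBf => // x; exact: cst_continuous|exact: ctent].
have cgY : continuous gY.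
  by apply: continuousMf; [apply: continuousBf => // x; exact: cst_continuous|exact: ctent].
have e1 := e0; have xy := XY tT; have r1 := range_X tT; have r2 := range_Y tT.
exists (wint lo hi (rho t) gX - wint lo hi (rho t) gY); last first.
  have supp (Z c y : R) : `|c| = e -> tent e (y - Z + c) != 0 -> y \in `[Z - 2 * e, Z + 2 * e].
    move=> ce; apply: contraR; rewrite in_itv/= negb_and -!ltNge => h.
    apply/eqP; apply: tent_out.
    have /andP[h1 h2] : - e <= c <= e by rewrite -ler_norml ce.
    by case/orP: h => h; [rewrite ler0_norm|rewrite ger0_norm]; lra.
  apply: le_trans (ler_normB _ _) _.
  have -> : 16 * N * L * e ^+ 3 = 8 * N * L * e ^+ 3 + 8 * N * L * e ^+ 3 by ring.
  apply: lerD; apply: flux_le => //; try lra.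
    by move=> y; apply: supp; rewrite gtr0_norm.
  by move=> y; apply: supp; rewrite normrN gtr0_norm.
have := is_deriveBf (is_deriveDf (is_deriveDf d1 d2) d3) (is_derive_cstf (M t) t).
move=> /(near_eq_is_derive ME); congr is_derive.
rewrite add0r subr0 -(wintB (irho _ _ tT) cgX cgY) -(wintD (irho _ _ tT)).
- apply: eq_wint => y _; rewrite /gX /gY /phi_t /phi_x; ring.
- exact: cphi_t.
- exact: continuousMf.
Unshelve. all: by end_near. Qed.

(** Outside the plateau there remain two edges of width [2 * e], where the test function is at most
    [6 * e ^+ 2] and the density at most [N]. *)
Let M_mass t : 0 <= t <= T1 ->
  `|M t - height * \int[mu]_(y in `[X t, Y t]) rho t y| <= 24 * N * e ^+ 3.
Proof.
move=> tT; have e1 := e0; have xy := XY tT.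
have i1 p q : mu.-integrable `[p, q] (EFin \o (fun y => phi t y * rho t y)).
  by have := wint_integrable (irho p q tT) (@cphi t).
have -> : M t = \int[mu]_(y in `[X t - 2 * e, X t]) (phi t y * rho t y) +
   \int[mu]_(y in `[X t, Y t]) (phi t y * rho t y) +
   \int[mu]_(y in `[Y t, Y t + 2 * e]) (phi t y * rho t y).
  rewrite -Rintegral_itv_split//; last lra.
  rewrite -Rintegral_itv_split//; try lra.
  rewrite /M /wint -!Rintegral_itv_setT// => y h.
    by rewrite (phi_out tT h) mul0r.
  by rewrite (phi_out_lohi tT h) mul0r.
have -> : \int[mu]_(y in `[X t, Y t]) (phi t y * rho t y) =
    height * \int[mu]_(y in `[X t, Y t]) rho t y.
  have mI : measurable (`[X t, Y t]%classic : set (measurableTypeR R)) by [].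
  have <- := RintegralZl height mI (irho (X t) (Y t) tT).
  apply: eq_Rintegral => y /set_mem /=; rewrite in_itv/= => yXY.
  by rewrite phi_plateau.
have rearr (a1 a2 a3 : R) : a1 + a2 + a3 - a2 = a1 + a3 by ring.
rewrite rearr; apply: le_trans (ler_normD _ _) _.
have side p : (forall y, y \in `[p, p + 2 * e] -> `|phi t y| <= 6 * e ^+ 2) ->
    `|\int[mu]_(y in `[p, p + 2 * e]) (phi t y * rho t y)| <= 12 * N * e ^+ 3.
  move=> H; apply: le_trans (normr_wint (irho _ _ tT) (@cphi t) H) _.
  have mle : wmass p (p + 2 * e) (rho t) <= N * (p + 2 * e - p).
    by apply: wmass_le => //; [lra|exact: rho_meas|exact: rho_le].
  apply: le_trans (ler_wpM2r _ mle) _; first by rewrite mulr_ge0 ?sqr_ge0.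
  by apply: eq_ler; ring.
have -> : 24 * N * e ^+ 3 = 12 * N * e ^+ 3 + 12 * N * e ^+ 3 by ring.
apply: lerD.
  have := @side (X t - 2 * e); rewrite subrK; apply => y yX.
  by apply: phi_le => //; left.
by apply: side => y yY; apply: phi_le => //; right.
Qed.

(** Two edge errors and the accumulated flux are of order [e ^+ 3]; division by a height of at least
    [e ^+ 2 / 2] leaves an error of order [e]. *)
Lemma mass_almost_conserved t : 0 <= t <= T1 ->
  `|\int[mu]_(y in `[X t, Y t]) rho t y - \int[mu]_(y in `[X 0, Y 0]) rho 0 y| <=
    (96 * N + 32 * N * L * T1) * e.
Proof.
move=> tT; have z0 : 0 <= (0 : R) <= T1 by apply/andP; split.
have e1 := e0; have /andP[t0 tT1] := tT.
have h1 : `|M t - M 0| <= 16 * N * L * e ^+ 3 * t - 16 * N * L * e ^+ 3 * 0.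
  apply: (normr_ler_of_derive (g := fun s => 16 * N * L * e ^+ 3 * s)) => //.
  - apply: continuous_subspaceW M_continuous => s /=; rewrite !in_itv/= => /andP[-> st].
    exact: le_trans tT1.
  - by apply: continuous_within; apply: continuousZf => x; exact: cvg_id.
  move=> s /andP[s0 st]; have sT : 0 < s < T1 by rewrite s0 (lt_le_trans st).
  have [l dl ll] := is_derive_M sT.
  exists l, (16 * N * L * e ^+ 3 * 1); split => //; last by rewrite mulr1.
  exact: is_deriveZf (is_derive_idf _).
have h2 := M_mass tT; have h3 := M_mass z0.
set A := \int[mu]_(y in `[X t, Y t]) rho t y in h2 *.
set B := \int[mu]_(y in `[X 0, Y 0]) rho 0 y in h3 *.
have hh := ramp_height e0; rewrite -/height in hh.
have key : height * `|A - B| <= (48 * N + 16 * N * L * T1) * e ^+ 3.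
  have hpos : 0 <= height by apply: le_trans hh; rewrite divr_ge0 ?sqr_ge0.
  rewrite -{1}(ger0_norm hpos) -normrM.
  have -> : height * (A - B) = (M t - M 0) - (M t - height * A) + (M 0 - height * B) by ring.
  apply: le_trans (ler_normD _ _) _; apply: le_trans (lerD (ler_normB _ _) (lexx _)) _.
  apply: le_trans (lerD (lerD h1 h2) h3) _; rewrite mulr0 subr0.
  have h4 : 16 * N * L * e ^+ 3 * t <= 16 * N * L * e ^+ 3 * T1.
    by rewrite ler_wpM2l// !mulr_ge0// exprn_ge0.
  apply: le_trans (lerD (lerD h4 (lexx _)) (lexx _)) _.
  by apply: eq_ler; ring.
have h5 : e ^+ 2 / 2 * `|A - B| <= (48 * N + 16 * N * L * T1) * e ^+ 3.
  by apply: le_trans key; rewrite ler_wpM2r.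
have e2 : 0 < e ^+ 2 / 2 by rewrite divr_gt0// exprn_gt0.
rewrite -(ler_pM2l e2); apply: (le_trans h5); apply: eq_ler; field.
Unshelve. all: by []. Qed.
End Ramp.

Lemma mass_transport t : 0 <= t <= T1 ->
  \int[mu]_(y in `[X t, Y t]) rho t y = \int[mu]_(y in `[X 0, Y 0]) rho 0 y.
Proof.
move=> tT; apply/eqP; rewrite -subr_eq0 -normr_le0; apply/ler_addgt0Pr => h h0.
set C := 96 * N + 32 * N * L * T1.
have C0 : 0 <= C by rewrite addr_ge0 ?mulr_ge0.
have C1 : 0 < C + 1 by rewrite ltr_wpDl.
apply: le_trans (mass_almost_conserved (divr_gt0 h0 C1) tT) _; rewrite add0r -/C.
apply: (@le_trans _ _ ((C + 1) * (h / (C + 1)))).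
  by rewrite ler_wpM2r ?lerDl// divr_ge0// ltW.
by rewrite mulrC divfK// gt_eqF.
Qed.
End MassTransport.

(** * Characteristics of a strong solution *)

Section GeneralSolution.
Context {R : realType}.
Notation mu := (@lebesgue_measure R).
Implicit Types (a b c x y t s : R).

Lemma expRNK c t x : expR (- c * t) * (expR (c * t) * x) = x.
Proof. by rewrite mulrA -expRD mulNr addNr expR0 mul1r. Qed.

Lemma expRKN c t x : expR (c * t) * (expR (- c * t) * x) = x.
Proof. by rewrite mulrA -expRD mulNr addrN expR0 mul1r. Qed.

Lemma within_bounded (f : R -> R) a b : {within `[a, b], continuous f} ->
  exists2 C, 0 <= C & forall y, a <= y <= b -> `|f y| <= C.
Proof.
move=> cf; have [ab|ba] := leP a b; last first.
  by exists 0 => // y /andP[ay yb]; have := le_trans ay yb; rewrite leNgt ba.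
have cn : {within `[a, b], continuous (fun y => `|f y|)}.
  by move=> y; apply: continuous_comp; [exact: cf|exact: norm_continuous].
have [c _ H] := EVT_max ab cn; by exists `|f c|.
Qed.

(** Phrased with the difference of the derivatives, as this is what continuity in time provides; it
    need not agree with [derive1] of the difference where [f] or [g] fails to be differentiable.
    Both increments are written as integrals instead. *)
Lemma dotW1oo_diff_lipschitz (f g : R -> R) e : 0 <= e -> dotW1oo f -> dotW1oo g ->
  {ae mu, forall x, `|derive1 f x - derive1 g x| <= e} ->
  forall x y, `|(f x - g x) - (f y - g y)| <= e * `|x - y|.
Proof.
move=> e0 [/Lfun_oo_ae[mf [Cf Cf0 fC]] Hf] [/Lfun_oo_ae[mg [Cg Cg0 gC]] Hg] fg.
have H x y : x <= y -> `|(f y - g y) - (f x - g x)| <= e * (y - x).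
  move=> xy.
  have -> : (f y - g y) - (f x - g x) = (f y - f x) - (g y - g x) by ring.
  rewrite Hf// Hg// -RintegralB//; try exact: (ae_bounded_integrable _ _ _ _ fC);
    try exact: (ae_bounded_integrable _ _ _ _ gC).
  have mfg : measurable_fun [set: R] (fun z => derive1 f z - derive1 g z).
    exact: measurable_funB.
  apply: ae_normr_Rintegral_le => //; last exact: ae_bounded_integrable fg.
  by apply: ae_imply fg.
move=> x y; have [xy|/ltW yx] := leP x y.
  by rewrite distrC (distrC x) (ger0_norm (x := y - x)) ?subr_ge0// H.
by rewrite (ger0_norm (x := x - y)) ?subr_ge0// H.
Qed.

Variables (gamma ubar : R) (psi rho0 u0 : R -> R) (T : \bar R) (rho u : R -> R -> R).
Hypothesis sol : strong_solution gamma ubar psi rho0 u0 T rho u.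
Hypothesis C1u0 : C1 u0.
Variable T1 : R.
Hypothesis T10 : 0 <= T1.
Hypothesis T1T : (T1%:E < T)%E.

Let inT t : 0 <= t <= T1 -> time_interval T t.
Proof. by move=> /andP[t0 tT]; split => //; apply: le_lt_trans T1T; rewrite lee_fin. Qed.

Lemma solution_lipschitz : exists2 L, 0 <= L &
  forall t, 0 <= t <= T1 -> forall x y, `|u t x - u t y| <= L * `|x - y|.
Proof.
have [[_ [uW uL _] _] _ _ _ _] := sol.
apply: locally_bounded_itv => [t B B' H BB x y|t tT].
  by apply: le_trans (H x y) _; rewrite ler_wpM2r.
have [d d0 Hd] := C_Loo_ae uL (inT tT) ltr01.
have [/Lfun_oo_ae[_ [C C0 HC]] _] := uW t (inT tT).
exists (C + 1), d; split => // s sT std; apply: dotW1oo_lipschitz (uW s (inT sT)) _.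
  by rewrite addr_ge0.
apply: ae_imply2 (Hd s (inT sT) std) HC => x h1 h2.
by rewrite -(subrK (derive1 (u t) x) (derive1 (u s) x)) addrC (le_trans (ler_normD _ _))// lerD.
Qed.

Lemma solution_diff_lipschitz t e : 0 <= t <= T1 -> 0 < e -> exists2 d, 0 < d &
  forall s, 0 <= s <= T1 -> `|s - t| < d ->
  forall x y, `|(u s x - u t x) - (u s y - u t y)| <= e * `|x - y|.
Proof.
have [[_ [uW uL _] _] _ _ _ _] := sol.
move=> tT e0; have [d d0 Hd] := C_Loo_ae uL (inT tT) e0.
exists d => // s sT std; apply: dotW1oo_diff_lipschitz (ltW e0) _ _ _.
- exact: uW (inT sT).
- exact: uW (inT tT).
- exact: Hd (inT sT) std.
Qed.

Lemma density_bounded : exists2 N, 0 <= N &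
  forall t, 0 <= t <= T1 -> {ae mu, forall x, `|rho t x| <= N}.
Proof.
have [[rL _ _] _ _ _ _] := sol.
apply: locally_bounded_itv => [t B B' H BB|t tT].
  by apply: ae_imply H => x h; exact: le_trans BB.
have [d d0 Hd] := C_Loo_ae rL (inT tT) ltr01.
have [_ [C C0 HC]] := Lfun_oo_ae (rL.1 t (inT tT)).
exists (C + 1), d; split => // s sT std.
apply: ae_imply2 (Hd s (inT sT) std) HC => x h1 h2.
by rewrite -(subrK (rho t x) (rho s x)) addrC (le_trans (ler_normD _ _))// lerD.
Qed.

Lemma solution_time_continuous x : {within `[0, T1], continuous (u^~ x)}.
Proof.
have [[_ [_ _ uc] _] _ _ _ _] := sol.
by apply: continuous_subspaceW (uc x) => t /=; rewrite in_itv/= => /inT.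
Qed.

Lemma solution_derivable t x : 0 <= t <= T1 -> derivable (u t) x 1.
Proof.
have [_ _ mom _ ui] := sol; move=> tT; have /andP[t0 _] := tT.
move: t0; rewrite le_eqVlt => /predU1P[t0|t0].
  (* The momentum equation gives differentiability in space only at positive times; at time [0] it
     comes from the datum. *)
  by rewrite -t0 (_ : u 0 = u0); [exact: C1u0.1|apply/funext].
by have [_ tTT] := inT tT; have [_ + _ _] := mom t x t0 tTT.
Qed.

Definition clamp s : R := Num.min T1 (Num.max 0 s).

Let clamp_in s : 0 <= clamp s <= T1.
Proof. by rewrite /clamp le_min T10 max0_ge0 ge_min lexx. Qed.

Let clamp_continuous : continuous clamp.
Proof.
apply: (continuous_compf (f := fun s => Num.min T1 s)); last exact: continuous_max0.
have -> : (fun s => Num.min T1 s) = (fun s => T1 - Num.max 0 (T1 - s)).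
  apply/funext => s; have [h|/ltW h] := leP T1 s.
    by rewrite max_l ?subr0// subr_le0.
  by rewrite max_r ?subr_ge0// opprB addrC subrK.
apply: continuousBf; first by move=> x; exact: cst_continuous.
apply: (continuous_compf continuous_max0).
by apply: continuousBf; [move=> x; exact: cst_continuous|move=> x; exact: cvg_id].
Qed.

Lemma within_clamp (f : R -> R) : {within `[0, T1], continuous f} ->
  continuous (fun s => f (clamp s)).
Proof.
move=> /within_continuousP_eps cf s; apply/continuousP_eps => e e0.
have cs : `[0, T1]%classic (clamp s) by rewrite /= in_itv/= clamp_in.
have [d d0 Hd] := cf _ cs _ e0.
have /continuousP_eps/(_ (d / 2))[|d' d'0 Hd'] := @clamp_continuous s.
  by rewrite divr_gt0.
exists d' => // r rs; apply: Hd; first by rewrite /= in_itv/= clamp_in.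
by apply: le_lt_trans (Hd' _ rs) _; rewrite ltr_pdivrMr// ltr_pMr// ltr1n.
Qed.

(** The Picard scheme with a one-point label set. The velocity is frozen after [T1], so that the
    scheme runs for all times and the solution has two-sided derivatives at both ends of
    [[0, T1]]. *)
Lemma characteristic_exists a : exists Z : R -> R, Z 0 = a /\
  forall t, 0 <= t <= T1 -> is_derive t 1 Z (u t (Z t)).
Proof.
have [L L0 uL] := solution_lipschitz.
have [A A0 HA] := within_bounded (@solution_time_continuous a).
have L10 : 0 < L + 1 by rewrite ltr_wpDl.
pose G t (f : unit -> R) (i : unit) := u (Num.min T1 t) (f i).
have min_in t : 0 <= t -> 0 <= Num.min T1 t <= T1.
  by move=> t0; rewrite le_min T10 t0 ge_min lexx.
have e1 t : 0 <= t -> 1 <= expR (2 * (L + 1) * t).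
  by move=> t0; rewrite -{1}(@expR0 R) ler_expR mulr_ge0// mulr_ge0// ltW.
have [||||||X [[_ X0 _] dX]] := @picard R unit (L + 1) A (fun _ => a) G (fun _ _ => True) L10 A0.
- by move=> t i t0; apply: le_trans (HA _ (min_in _ t0)) _; rewrite ler_peMr ?e1.
- move=> t f g M t0 _ _ fg i; apply: le_trans (uL _ (min_in _ t0) _ _) _.
  by apply: ler_pM => //; rewrite lerDl.
- move=> f [_ f0 fB] i.
  set B := picard_modulus _ _ in fB.
  have cB : continuous B by apply: is_derive_all_continuous => t; exact: is_derive_picard_modulus.
  have cf : continuous (fun s => f (Num.max 0 s) i).
    apply: (continuous_dominated (continuous_compf cB continuous_max0)) => s t st.
    by apply: fB; [exact: max0_ge0|exact: max0_homo].
  move=> s; apply/continuousP_eps => e e0; rewrite /G.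
  have e20 : 0 < e / 2 by rewrite divr_gt0.
  have eL : 0 < e / 2 / (L + 1) by rewrite divr_gt0.
  have /continuousP_eps/(_ _ eL)[d d0 Hd] := @cf s.
  have /continuousP_eps/(_ _ e20)[d' d'0 Hd'] :=
    @within_clamp _ (@solution_time_continuous (f (Num.max 0 s) i)) s.
  exists (Num.min d d') => [|r]; first by rewrite lt_min d0.
  rewrite lt_min => /andP[/Hd h1 /Hd' h2].
  rewrite -/(clamp r) -/(clamp s).
  have rearr (z1 z2 z3 : R) : z1 - z3 = (z1 - z2) + (z2 - z3) by ring.
  rewrite (rearr _ (u (clamp r) (f (Num.max 0 s) i))) (splitr e).
  apply: le_trans (ler_normD _ _) _; apply: lerD => //.
  apply: le_trans (uL _ (clamp_in r) _ _) _.
  apply: (@le_trans _ _ ((L + 1) * (e / 2 / (L + 1)))).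
    by apply: ler_pM => //; rewrite lerDl.
  by rewrite mulrC divfK// gt_eqF.
- by [].
- by [].
- by [].
exists (fun t => X t tt); split => // t /andP[t0 tT].
by have := dX t tt t0; rewrite /G min_r.
Qed.

(** * Separation of two characteristics *)

Section Characteristics.
Variables (Z Z' : R -> R).
Hypothesis dZ : forall t, 0 <= t <= T1 -> is_derive t 1 Z (u t (Z t)).
Hypothesis dZ' : forall t, 0 <= t <= T1 -> is_derive t 1 Z' (u t (Z' t)).
Let y t := Z' t - Z t.
Let dy t : 0 <= t <= T1 -> is_derive t 1 y (u t (Z' t) - u t (Z t)).
Proof. by move=> tT; apply: is_deriveBf; [exact: dZ'|exact: dZ]. Qed.

Let cy t : 0 <= t <= T1 -> {within `[0, t], continuous y}.
Proof.
move=> /andP[t0 tT].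
apply: (is_derive_within (f' := fun s => u s (Z' s) - u s (Z s))) => s /=.
by rewrite in_itv/= => /andP[s0 st]; apply: dy; rewrite s0 (le_trans st).
Qed.

Let weighted c s : 0 <= s <= T1 -> is_derive s 1 (fun s => expR (c * s) * (y s * y s))
  (expR (c * s) * (c * y s ^+ 2 + 2 * (y s * (u s (Z' s) - u s (Z s))))).
Proof.
move=> sT; have := is_deriveMf (is_derive_exp_lin c s) (is_deriveMf (dy sT) (dy sT)).
move: (u s (Z' s) - u s (Z s)) (y s) => z1 z2.
by congr is_derive; ring.
Qed.

(** The weighted square [expR (2 * L * t) * y ^+ 2] is nondecreasing. Squares are needed because [y]
    is not yet known to keep its sign; that follows from this bound by the intermediate value
    theorem. *)
Lemma characteristics_lower L : 0 <= L ->
  (forall t, 0 <= t <= T1 -> forall x y, `|u t x - u t y| <= L * `|x - y|) ->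
  forall t, 0 <= t <= T1 -> expR (- (2 * L) * t) * y 0 ^+ 2 <= y t ^+ 2.
Proof.
move=> L0 uL t tT; have /andP[t0 tT1] := tT.
have : 0 - 0 <= expR (2 * L * t) * (y t * y t) - expR (2 * L * 0) * (y 0 * y 0).
  apply: (ler_of_derive (f := fun _ => 0) (g := fun s => expR (2 * L * s) * (y s * y s))) => //.
  - by apply: continuous_within => x; exact: cst_continuous.
  - apply: is_derive_within => s /=; rewrite in_itv/= => /andP[s0 st].
    by apply: weighted; rewrite s0 (le_trans st).
  move=> s /andP[/ltW s0 /ltW st]; have sT : 0 <= s <= T1 by rewrite s0 (le_trans st).
  eexists; eexists; split; [exact: is_derive_cstf|exact: weighted|].
  apply: mulr_ge0; first exact: expR_ge0.
  have := uL s sT (Z' s) (Z s); rewrite -/(y s); move: (u s _ - u s _) (y s) => d z h.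
  have h1 : - (z * d) <= L * z ^+ 2.
    apply: le_trans (ler_norm _) _; rewrite normrN normrM -[z ^+ 2]ger0_norm ?sqr_ge0//.
    by rewrite normrX expr2 mulrCA ler_wpM2l.
  lra.
rewrite mulr0 expR0 mul1r !subr0 -!expr2 subr_ge0 => h.
have := ler_wpM2l (expR_ge0 (- (2 * L) * t)) h.
by rewrite expRNK.
Qed.

Lemma characteristics_upper L : 0 <= L ->
  (forall t, 0 <= t <= T1 -> forall x y, `|u t x - u t y| <= L * `|x - y|) ->
  forall t, 0 <= t <= T1 -> `|y t| <= expR (L * t) * `|y 0|.
Proof.
move=> L0 uL t tT; have /andP[t0 tT1] := tT.
have : expR (- (2 * L) * t) * (y t * y t) - expR (- (2 * L) * 0) * (y 0 * y 0) <= 0 - 0.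
  apply: (ler_of_derive (g := fun _ => 0) (f := fun s => expR (- (2 * L) * s) * (y s * y s))) => //.
  - apply: is_derive_within => s /=; rewrite in_itv/= => /andP[s0 st].
    by apply: weighted; rewrite s0 (le_trans st).
  - by apply: continuous_within => x; exact: cst_continuous.
  move=> s /andP[/ltW s0 /ltW st]; have sT : 0 <= s <= T1 by rewrite s0 (le_trans st).
  eexists; eexists; split; [exact: weighted|exact: is_derive_cstf|].
  rewrite pmulr_rle0 ?expR_gt0//.
  have := uL s sT (Z' s) (Z s); rewrite -/(y s); move: (u s _ - u s _) (y s) => d z h.
  have h1 : z * d <= L * z ^+ 2.
    apply: le_trans (ler_norm _) _; rewrite normrM -[z ^+ 2]ger0_norm ?sqr_ge0//.
    by rewrite normrX expr2 mulrCA ler_wpM2l.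
  lra.
rewrite mulr0 expR0 mul1r !subr0 -!expr2 subr_le0 => h.
have e2 : expR (2 * L * t) = expR (L * t) ^+ 2.
  by rewrite expr2 -expRD; congr expR; ring.
have := ler_wpM2l (expR_ge0 (2 * L * t)) h.
rewrite expRKN e2 -exprMn => h2.
rewrite -(ler_sqr (x := `|y t|)) ?nnegrE ?mulr_ge0 ?expR_ge0//.
by rewrite -(ger0_norm (expR_ge0 (L * t))) -normrM -!normrX !ger0_norm ?sqr_ge0.
Qed.

Lemma characteristics_ordered t : 0 <= t <= T1 -> y 0 > 0 -> y t > 0.
Proof.
have [L L0 uL] := solution_lipschitz.
move=> tT y0; have /andP[t0 tT1] := tT.
have nz s : 0 <= s <= T1 -> y s != 0.
  move=> sT; have h : 0 < y s ^+ 2.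
    by apply: lt_le_trans (characteristics_lower L0 uL sT); rewrite mulr_gt0 ?expR_gt0 ?exprn_gt0.
  by apply: contraTN h => /eqP ->; rewrite expr0n ltxx.
rewrite ltNge; apply/negP => yt.
have [||s] := @IVT _ y 0 t 0 t0; first exact: cy.
  by rewrite ge_min le_max yt (ltW y0) orbT.
rewrite in_itv/= => /andP[s0 st] /eqP ys; have := nz s; rewrite ys s0 (le_trans st)//.
by move=> /(_ isT).
Qed.

(** Once the order is known, [expR (M * t) * y t] is nondecreasing by the mean value theorem. Only a
    one-sided slope bound enters, which is exactly what blow-up denies. *)
Lemma characteristics_spread M : (forall t x, 0 <= t <= T1 -> - M <= derive1 (u t) x) ->
  0 < y 0 -> forall t, 0 <= t <= T1 -> expR (- M * t) * y 0 <= y t.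
Proof.
move=> uM y0 t tT; have /andP[t0 tT1] := tT.
have dw s : 0 <= s <= T1 -> is_derive s 1 (fun s => expR (M * s) * y s)
    (M * expR (M * s) * y s + expR (M * s) * (u s (Z' s) - u s (Z s))).
  by move=> sT; exact: is_deriveMf (is_derive_exp_lin M s) (dy sT).
have : 0 - 0 <= expR (M * t) * y t - expR (M * 0) * y 0.
  apply: (ler_of_derive (f := fun _ => 0) (g := fun s => expR (M * s) * y s)) => //.
  - by apply: continuous_within => x; exact: cst_continuous.
  - apply: is_derive_within => s /=; rewrite in_itv/= => /andP[s0 st].
    by apply: dw; rewrite s0 (le_trans st).
  move=> s /andP[/ltW s0 /ltW st]; have sT : 0 <= s <= T1 by rewrite s0 (le_trans st).
  eexists; eexists; split; [exact: is_derive_cstf|exact: dw|].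
  have [c _ E] := mean_value (Z s) (Z' s)
    (fun x => derivable_is_derive (@solution_derivable s x sT)).
  have ys := characteristics_ordered sT y0; rewrite E -/(y s).
  have -> : M * expR (M * s) * y s + expR (M * s) * (derive1 (u s) c * y s) =
     expR (M * s) * ((derive1 (u s) c + M) * y s) by ring.
  apply: mulr_ge0; first exact: expR_ge0.
  by apply: mulr_ge0 (ltW ys); have := uM s c sT; lra.
rewrite mulr0 expR0 mul1r !subr0 subr_ge0 => h.
have := ler_wpM2l (expR_ge0 (- M * t)) h.
by rewrite expRNK.
Qed.
End Characteristics.

(** * Identification of the characteristics with the Lagrangian flow *)

Variables (K ga p0 Lp : R) (Psi w0 : R -> R).
Hypothesis K0 : 0 <= K.
Hypothesis crho0 : continuous rho0.
Hypothesis rho0_supp : forall y, K <= `|y| -> rho0 y = 0.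
Notation E := (wint (- K) K rho0).
Hypothesis gammaE : gamma^-1 = ga.
Hypothesis ga0 : 0 < ga.
Hypothesis dPsi : forall y, is_derive y 1 Psi (psi y).
Hypothesis psi_le : forall y, `|psi y| <= p0.
Hypothesis psi_lip : forall x y, `|psi x - psi y| <= Lp * `|x - y|.
Hypothesis w0E : forall a, w0 a = u0 a + ga * a + E (fun b => Psi (a - b)).
Variable X : R -> R -> R.
Hypothesis X0 : forall a, X 0 a = a.
Hypothesis dX : forall a t, 0 <= t <= T1 -> is_derive t 1 (X^~ a) (u t (X t a)).

Let iw p q : mu.-integrable `[p, q] (EFin \o rho0) := continuous_integrable_itv _ _ crho0.
Let zero_in : 0 <= (0 : R) <= T1.
Proof. by apply/andP; split. Qed.

Lemma solution_flow_lip : exists2 C, 0 <= C &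
  forall t a b, 0 <= t <= T1 -> `|X t a - X t b| <= C * `|a - b|.
Proof.
have [L L0 uL] := solution_lipschitz.
exists (expR (L * T1)); first exact: expR_ge0.
move=> t a b tT; have := characteristics_upper (dX b) (dX a) L0 uL tT.
rewrite !X0 => /le_trans; apply; rewrite ler_wpM2r// ler_expR ler_wpM2l//.
by case/andP: tT.
Qed.

Lemma solution_flow_continuous t : 0 <= t <= T1 -> continuous (X t).
Proof.
move=> tT; have [C C0 HC] := solution_flow_lip.
by apply: (lipschitz_continuous (l := C)) => a b; exact: HC.
Qed.

Lemma solution_flow_incr t a b : 0 <= t <= T1 -> a < b -> X t a < X t b.
Proof.
move=> tT ab; rewrite -subr_gt0.
by apply: (characteristics_ordered (dX a) (dX b) tT); rewrite !X0 subr_gt0.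
Qed.

Lemma solution_flow_homo t a b : 0 <= t <= T1 -> a <= b -> X t a <= X t b.
Proof.
by move=> tT; rewrite le_eqVlt => /predU1P[->//|/(solution_flow_incr tT)/ltW].
Qed.

(** Characteristics separate at least by the factor [expR (- L * t)], so their positions exhaust the
    line. Integer steps make the exhaustion countable, as almost everywhere statements require. *)
Lemma solution_flow_far t : 0 <= t <= T1 -> forall x y, exists n : nat,
  X t (y - n%:R) <= x <= X t (y + n%:R).
Proof.
move=> tT x y; have [L L0 uL] := solution_lipschitz.
pose c := expR (- L * t); have c0 : 0 < c by exact: expR_gt0.
have spread a b : a <= b -> c * (b - a) <= X t b - X t a.
  move=> ab; have := characteristics_lower (dX a) (dX b) L0 uL tT.
  rewrite !X0 (_ : expR (- (2 * L) * t) = c ^+ 2); last first.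
    by rewrite /c expr2 -expRD; congr expR; ring.
  rewrite -exprMn ler_sqr// nnegrE ?subr_ge0 ?solution_flow_homo//.
  by rewrite mulr_ge0 ?subr_ge0// ltW.
pose B := `|x - X t y| / c.
have [n Bn] : exists n : nat, B <= n%:R.
  exists (Num.truncn B).+1; apply: ltW.
  by have /andP[] := truncn_itv (divr_ge0 (normr_ge0 (x - X t y)) (ltW c0)).
have H : `|x - X t y| <= c * n%:R by rewrite mulrC -ler_pdivrMr.
exists n; have n0 : 0 <= n%:R :> R by [].
have h1 := @spread (y - n%:R) y; have h2 := @spread y (y + n%:R).
rewrite (_ : y - (y - n%:R) = n%:R) in h1; last by ring.
rewrite (_ : y + n%:R - y = n%:R) in h2; last by ring.
move: H; rewrite ler_norml => /andP[h3 h4].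
have {}h1 : c * n%:R <= X t y - X t (y - n%:R) by apply: h1; lra.
have {}h2 : c * n%:R <= X t (y + n%:R) - X t y by apply: h2; lra.
move: (c * _) h1 h2 h3 h4 => z; move: (X t y) (X t _) (X t _) => z1 z2 z3 *.
by apply/andP; split; lra.
Qed.

(** The class of solutions controls the slope of [u] and its values at fixed points, so a bound is
    available only for bounded labels. *)
Lemma solution_speed_bounded K' : exists2 C, 0 <= C &
  forall s a, 0 <= s <= T1 -> `|a| <= K' -> `|u s (X s a)| <= C.
Proof.
have [L L0 uL] := solution_lipschitz.
have [C C0 HC] := solution_flow_lip.
have [A A0 HA] := within_bounded (@solution_time_continuous 0).
have cX0 : {within `[0, T1], continuous (X^~ 0)}.
  by apply: (is_derive_within (f' := fun s => u s (X s 0))) => s /=; rewrite in_itv/=; exact: dX.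
have [B B0 HB] := within_bounded cX0.
exists (L * (C * `|K'| + B) + A) => [|s a sT aK].
  by rewrite addr_ge0// mulr_ge0// addr_ge0// mulr_ge0.
rewrite -(subrK (u s 0) (u s (X s a))); apply: le_trans (ler_normD _ _) _.
apply: lerD; last exact: HA.
apply: le_trans (uL _ sT _ _) _; rewrite subr0 ler_wpM2l//.
rewrite -(subrK (X s 0) (X s a)); apply: le_trans (ler_normD _ _) _.
apply: lerD; last exact: HB.
apply: le_trans (HC _ _ _ sT) _; rewrite subr0 ler_wpM2l//.
exact: le_trans (ler_norm _).
Qed.

Lemma solution_mass t a b : 0 <= t <= T1 -> a <= b ->
  \int[mu]_(y in `[X t a, X t b]) rho t y = \int[mu]_(y in `[a, b]) rho0 y.
Proof.
move=> tT ab.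
have [[rL _ _] ce _ r0 _] := sol.
have [L L0 uL] := solution_lipschitz; have [N N0 HN] := density_bounded.
have rm s : 0 <= s <= T1 -> measurable_fun [set: R] (rho s).
  by move=> sT; have [] := Lfun_oo_ae (rL.1 s (inT sT)).
have [C C0 HC] := solution_speed_bounded (`|a| + `|b|).
transitivity (\int[mu]_(y in `[X 0 a, X 0 b]) rho 0 y); last first.
  rewrite !X0 /Rintegral; congr fine; apply: ae_eq_integral => //.
  - by apply/measurable_EFinP; apply: measurable_funTS; exact: rm.
  - apply/measurable_EFinP; apply: measurable_funTS.
    exact: measurable_realfun.continuous_measurable_fun.
  - by apply: ae_imply r0 => x -> _.
apply: (@mass_transport R T1 L N C rho u (X^~ a) (X^~ b)) => //.
- move=> s e sT e0; have [d d0 Hd] := C_Loo_ae rL (inT sT) e0.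
  by exists d => // r rT; apply: Hd; exact: inT.
- move=> phi phi' dphi cphi' sphi s /andP[s0 sT].
  have E1 : derive1 phi = phi' by apply/funext => x; exact: is_derive_derive1.
  have sT' : 0 <= s <= T1 by rewrite !ltW.
  have C1phi : C1 phi.
    by split=> [x|]; [exact: (ex_derive (is_derive := dphi x))|rewrite E1].
  have [dm dmE] := ce phi C1phi sphi s s0 (inT sT').2.
  by rewrite -E1 -dmE; exact: derivable_is_derive.
- by move=> s sT; exact: solution_flow_homo.
- by move=> s sT; apply: HC => //; rewrite lerDl.
- by move=> s sT; apply: HC => //; rewrite lerDr.
Qed.

(** The mass over the image of a label interval disjoint from the support is zero, and a nonnegative
    density of zero mass vanishes almost everywhere. Countably many such intervals cover the
    complement. *)
Lemma density_vanishes t : 0 <= t <= T1 ->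
  {ae mu, forall y, y \notin `[X t (- K), X t K] -> rho t y = 0}.
Proof.
move=> tT; have [[rL _ rho_ge0] _ _ _ _] := sol.
have [rm _] := Lfun_oo_ae (rL.1 t (inT tT)).
have [N N0 HN] := density_bounded.
have H p q : p <= q -> (forall y, p <= y <= q -> rho0 y = 0) ->
    {ae mu, forall y, y \in `[X t p, X t q] -> rho t y = 0}.
  move=> pq r0.
  pose D : set (measurableTypeR R) := `[X t p, X t q]%classic.
  have mD : measurable D by exact: measurable_itv.
  have mf : measurable_fun D (EFin \o rho t).
    by apply/measurable_EFinP; exact: measurable_funTS.
  have i0 : (\int[mu]_(y in D) (rho t y)%:E = 0)%E.
    have fin := integrable_fin_num (mu := mu) mD
      (ae_bounded_integrable (X t p) (X t q) N0 rm (HN t tT)).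
    rewrite -[LHS](fineK fin); congr EFin.
    have := solution_mass tT pq; rewrite /Rintegral => ->.
    rewrite -/(Rintegral mu `[p, q] rho0) (@eq_Rintegral _ _ _ _ _ (fun _ => 0)).
      by rewrite Rintegral_cst// mul0r.
    by move=> y /set_mem /=; rewrite in_itv/=; exact: r0.
  have : (\int[mu]_(y in D) `|(EFin \o rho t) y| = 0)%E.
    rewrite -i0; apply: ae_eq_integral => //; first exact: measurableT_comp.
    by apply: ae_imply (rho_ge0 t (inT tT)) => y h _ /=; rewrite ger0_norm.
  move=> /(ae_eq_integral_abs mu mD mf).1.
  by apply: ae_imply => y h yD; have := h yD => /= -[].
have {}H : forall n : nat, {ae mu, forall y,
    y \in `[X t K, X t (K + n%:R)] \/ y \in `[X t (- K - n%:R), X t (- K)] -> rho t y = 0}.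
  move=> n; have h1 : {ae mu, forall y, y \in `[X t K, X t (K + n%:R)] -> rho t y = 0}.
    apply: H => [|y /andP[Ky _]]; first by rewrite lerDl.
    by apply: rho0_supp; exact: le_trans (ler_norm _).
  have h2 : {ae mu, forall y, y \in `[X t (- K - n%:R), X t (- K)] -> rho t y = 0}.
    apply: H => [|y /andP[_ Ky]]; first by rewrite gerBl.
    by apply: rho0_supp; rewrite -normrN; apply: le_trans (ler_norm _); rewrite lerNr.
  by apply: ae_imply2 h1 h2 => y h1 h2 [/h1|/h2].
have := ae_foralln H; apply: ae_imply => y h yn.
have [n1 /andP[h1 h2]] := solution_flow_far tT y K.
have [n2 /andP[h3 h4]] := solution_flow_far tT y (- K).
move: yn; rewrite in_itv/= negb_and -!ltNge => /orP[yK|yK].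
  by apply: (h n2); right; rewrite in_itv/= h3 ltW.
by apply: (h n1); left; rewrite in_itv/= h2 ltW.
Qed.

(** No change of variables is available for a merely bounded [rho t]. Instead [H a] compares both
    integrals up to the label [a]; equality of masses makes its increments small relative to those
    of [a], so its derivative vanishes and [H] stays equal to its value [0] at [- K]. *)
Lemma density_push_forward t (g : R -> R) : 0 <= t <= T1 -> continuous g ->
  \int[mu]_y (g y * rho t y) = E (fun b => g (X t b)).
Proof.
move=> tT cg; have [[rL _ _] _ _ _ _] := sol.
have [rm _] := Lfun_oo_ae (rL.1 t (inT tT)).
have [N N0 HN] := density_bounded; have {}HN := HN t tT.
have [C C0 HC] := solution_flow_lip.
have [N' N'0 HN'] := continuous_bounded_itv (- K) K crho0.
have cgX : continuous (fun b => g (X t b)) by exact: continuous_compf cg (@solution_flow_continuous t tT).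
have ir p q : mu.-integrable `[p, q] (EFin \o rho t) by exact: ae_bounded_integrable HN.
have igr p q : mu.-integrable `[p, q] (EFin \o (fun y => g y * rho t y)).
  by have := wint_integrable (ir p q) cg.
have igX p q : mu.-integrable `[p, q] (EFin \o (fun y => g (X t y) * rho0 y)).
  by have := wint_integrable (iw p q) cgX.
have homo := solution_flow_homo tT.
have -> : \int[mu]_y (g y * rho t y) = wint (X t (- K)) (X t K) (rho t) g.
  have mgr : measurable_fun [set: R] (fun y => g y * rho t y).
    by apply: measurable_funM => //; exact: measurable_realfun.continuous_measurable_fun.
  rewrite /wint [RHS]Rintegral_mkcond /Rintegral; congr fine; apply: ae_eq_integral => //.
  - exact/measurable_EFinP.
  - apply/measurable_EFinP.
    have mD : measurable (`[X t (- K), X t K]%classic : set (measurableTypeR R)).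
      exact: measurable_itv.
    by have := (measurable_restrictT _ mD).1 (measurable_funTS mgr).
  apply: ae_imply (density_vanishes tT) => y h _; rewrite patchE; case: ifPn => // yn.
  by rewrite h ?mulr0//; apply: contraNN yn => yD; exact/mem_set.
pose H a := wint (X t (- K)) (X t a) (rho t) g - wint (- K) a rho0 (fun b => g (X t b)).
(* Since both integrals see the same mass, a constant [v] may be subtracted from [g]; on a short
   interval what remains is at most [h]. *)
have inc a b v h : - K <= a -> a <= b -> b <= K -> 0 <= h ->
    (forall y, X t a <= y <= X t b -> `|g y - v| <= h) ->
    `|H b - H a| <= h * (N * C + N') * (b - a).
  move=> Ka ab bK h0 Hh.
  have sub (f : R -> R) p q r : mu.-integrable `[p, r] (EFin \o f) -> p <= q -> q <= r ->
      \int[mu]_(y in `[p, r]) f y - \int[mu]_(y in `[p, q]) f y = \int[mu]_(y in `[q, r]) f y.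
    by move=> fi pq qr; rewrite (Rintegral_itv_split fi pq qr) addrC addrA addNr add0r.
  have E1 : H b - H a = wint (X t a) (X t b) (rho t) g - wint a b rho0 (fun b => g (X t b)).
    rewrite /H /wint -(sub _ (X t (- K)) (X t a) (X t b))// ?homo//.
    rewrite -(sub _ (- K) a b)//.
    by move: (Rintegral _ _ _) (Rintegral _ _ _) (Rintegral _ _ _) (Rintegral _ _ _) => *; ring.
  have cv : continuous (fun _ : R => v) by move=> x; exact: cst_continuous.
  have cgv : continuous (fun y => g y - v) by exact: continuousBf.
  have cgXv : continuous (fun y => g (X t y) - v) by exact: continuousBf.
  have wcst p q (w : R -> R) : mu.-integrable `[p, q] (EFin \o w) ->
      wint p q w (fun _ => v) = v * \int[mu]_(y in `[p, q]) w y.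
    move=> wi; have mD : measurable (`[p, q]%classic : set (measurableTypeR R)).
      exact: measurable_itv.
    by have <- := RintegralZl v mD wi.
  have E2 : H b - H a = wint (X t a) (X t b) (rho t) (fun y => g y - v) -
     wint a b rho0 (fun b => g (X t b) - v).
    rewrite E1 (wintB (ir _ _) cg cv) (wintB (iw _ _) cgX cv) !wcst//.
    rewrite (solution_mass tT ab).
    by move: (wint _ _ _ _) (wint _ _ _ _) (v * _) => *; ring.
  rewrite E2; apply: le_trans (ler_normB _ _) _.
  have h1 : `|wint (X t a) (X t b) (rho t) (fun y => g y - v)| <= N * (X t b - X t a) * h.
    apply: le_trans (normr_wint (ir _ _) cgv (C := h) _) _.
      by move=> y; rewrite in_itv/=; exact: Hh.
    by rewrite ler_wpM2r//; apply: wmass_le => //; exact: homo.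
  have h2 : `|wint a b rho0 (fun b => g (X t b) - v)| <= N' * (b - a) * h.
    apply: le_trans (normr_wint (iw _ _) cgXv (C := h) _) _.
      by move=> y; rewrite in_itv/= => /andP[ay yb]; apply: Hh; rewrite !homo.
    rewrite ler_wpM2r//; apply: wmass_le => //.
      exact: measurable_realfun.continuous_measurable_fun.
    apply: ae_all => y; have [/HN'//|h3] := boolP (y \in `[(- K), K]).
    rewrite rho0_supp ?normr0//; move: h3; rewrite in_itv/= negb_and -!ltNge => /orP[h3|h3].
      by rewrite -normrN; apply: le_trans (ler_norm _); rewrite lerNr ltW.
    by apply: le_trans (ler_norm _); exact: ltW.
  have h3 : N * (X t b - X t a) * h <= N * (C * (b - a)) * h.
    rewrite ler_wpM2r// ler_wpM2l//; have := HC t b a tT.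
    by rewrite (ger0_norm (x := b - a)) ?subr_ge0//; exact: le_trans (ler_norm _).
  apply: le_trans (lerD (le_trans h1 h3) h2) _; apply: eq_ler; ring.
have NC0 : 0 <= N * C + N' by rewrite addr_ge0// mulr_ge0.
have local c e : - K <= c <= K -> 0 < e -> exists2 d, 0 < d &
    forall b, - K <= b <= K -> `|b - c| < d -> `|H b - H c| <= e * `|b - c|.
  move=> /andP[Kc cK] e0; pose h := e / (N * C + N' + 1).
  have k0 : 0 < N * C + N' + 1 by rewrite ltr_wpDl.
  have h0 : 0 < h by rewrite divr_gt0.
  have he : h * (N * C + N') <= e.
    rewrite -[leRHS](divfK (x := N * C + N' + 1)) ?gt_eqF// -/h ler_wpM2l ?lerDl//.
    exact: ltW.
  have /continuousP_eps/(_ _ h0)[d d0 Hd] := @cg (X t c).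
  have C10 : 0 < C + 1 by rewrite ltr_wpDl.
  exists (d / (C + 1)) => [|b /andP[Kb bK]]; first by rewrite divr_gt0.
  rewrite ltr_pdivlMr// => bc.
  have Xbc : `|X t b - X t c| < d.
    apply: le_lt_trans bc; apply: le_trans (HC _ _ _ tT) _.
    by rewrite mulrC ler_wpM2l// lerDl.
  have [cb|/ltW bc'] := leP c b.
    rewrite (ger0_norm (x := b - c)) ?subr_ge0//.
    apply: (@le_trans _ _ (h * (N * C + N') * (b - c))); last by rewrite ler_wpM2r ?subr_ge0.
    apply: (inc _ _ (g (X t c))) => //; first exact: ltW.
    move=> y /andP[h1 h2]; apply: Hd; apply: le_lt_trans Xbc.
    have := homo _ _ cb; move: (X t c) (X t b) h1 h2 => z1 z2 h1 h2 h3.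
    by rewrite !ger0_norm; lra.
  rewrite distrC (distrC b) (ger0_norm (x := c - b)) ?subr_ge0//.
  apply: (@le_trans _ _ (h * (N * C + N') * (c - b))); last by rewrite ler_wpM2r ?subr_ge0.
  apply: (inc _ _ (g (X t c))) => //; first exact: ltW.
  move=> y /andP[h1 h2]; apply: Hd; apply: le_lt_trans Xbc.
  have := homo _ _ bc'; move: (X t c) (X t b) h1 h2 => z1 z2 h1 h2 h3.
  by rewrite !ler0_norm; lra.
have KK : - K <= K by rewrite (le_trans _ K0)// oppr_le0.
have HKK : H K = H (- K).
  apply: eq_of_derive0 => //.
    apply/within_continuousP_eps => c; rewrite /= in_itv/= => cK e e0.
    have [d d0 Hd] := local c e cK e0.
    exists (Num.min d 1) => [|b]; first by rewrite lt_min d0 ltr01.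
    rewrite /= in_itv/= lt_min => bK /andP[bc bc1]; apply: le_trans (Hd b bK bc) _.
    by rewrite ler_piMr// ltW.
  move=> c /andP[Kc cK]; apply/is_deriveP_eps => e e0.
  have [d d0 Hd] := local c e (introT andP (conj (ltW Kc) (ltW cK))) e0.
  exists (Num.min d (Num.min (c + K) (K - c))) => [|b].
    by rewrite !lt_min d0 subr_gt0 cK -[K]opprK subr_gt0 Kc.
  rewrite !lt_min => /andP[bd /andP[h1 h2]]; rewrite mul0r subr0; apply: Hd => //.
  move: h1 h2; rewrite !ltr_norml => /andP[h1 _] /andP[_ h2].
  by apply/andP; split; lra.
have HK0 : H (- K) = 0 by rewrite /H /wint !set_itv1 !Rintegral_set1 subrr.
by apply/eqP; rewrite -subr_eq0; apply/eqP; move: HKK; rewrite HK0.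
Qed.

Let cpsi : continuous psi := lipschitz_continuous psi_lip.
Let cPsi : continuous Psi := is_derive_all_continuous dPsi.
Let p00 : 0 <= p0 := le_trans (normr_ge0 _) (psi_le 0).

Lemma solution_continuous t : 0 <= t <= T1 -> continuous (u t).
Proof.
move=> tT; have [L L0 uL] := solution_lipschitz.
exact: lipschitz_continuous (uL t tT).
Qed.

(* Partial derivatives alone would not give the chain rule; it holds because
   [u s - u t] has a small Lipschitz constant for [s] close to [t]. *)
Lemma is_derive_along_flow t a : 0 < t < T1 ->
  is_derive t 1 (fun s => u s (X s a))
    (derive1 (u^~ (X t a)) t + derive1 (u t) (X t a) * u t (X t a)).
Proof.
move=> tT'; have tT : 0 <= t <= T1 by case/andP: tT' => /ltW -> /ltW ->.
have /andP[t0 tT1] := tT'.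
have [_ _ mom _ _] := sol.
have [ut ux _ _] := mom t (X t a) t0 (inT tT).2.
have d1 := derivable_is_derive ut.
have d2 : is_derive t 1 (fun s => u t (X s a)) (derive1 (u t) (X t a) * u t (X t a)).
  exact: is_derive_compf (derivable_is_derive ux) (dX a tT).
pose r s := (u s (X s a) - u t (X s a)) - (u s (X t a) - u t (X t a)).
have rt : r t = 0 by rewrite /r !subrr.
have dr : is_derive t 1 r 0.
  apply/is_deriveP_eps => e e0.
  set v := `|u t (X t a)| + 1; have v0 : 0 < v by rewrite ltr_wpDl.
  have [d d0 Hd] := solution_diff_lipschitz tT (divr_gt0 e0 v0).
  have /is_deriveP_eps/(_ _ ltr01)[d' d'0 Hd'] := dX a tT.
  exists (Num.min (Num.min d d') (Num.min t (T1 - t))) => [|s].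
    by rewrite !lt_min d0 d'0 t0 subr_gt0.
  rewrite !lt_min => /andP[/andP[sd sd'] /andP[s1 s2]].
  have sT : 0 <= s <= T1.
    rewrite (dist_lt_le s2) andbT; move: s1; rewrite ltr_norml => /andP[h _]; lra.
  rewrite rt subr0 mul0r subr0; apply: le_trans (Hd s sT sd _ _) _.
  have h : `|X s a - X t a| <= v * `|s - t|.
    rewrite -(subrK (u t (X t a) * (s - t)) (X s a - X t a)) addrC.
    apply: le_trans (ler_normD _ _) _; rewrite normrM mulrDl lerD2l.
    exact: Hd' sd'.
  apply: (@le_trans _ _ (e / v * (v * `|s - t|))).
    by rewrite ler_wpM2l// divr_ge0// ltW.
  by rewrite mulrA divfK// gt_eqF.
have := is_deriveDf (is_deriveBf (is_deriveDf d1 d2) (is_derive_cstf (u t (X t a)) t)) dr.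
rewrite subr0 addr0.
have -> // : (fun s => u s (X t a) + u t (X s a) - u t (X t a) + r s) = (fun s => u s (X s a)).
by apply/funext => s; rewrite /r; ring.
Qed.

Lemma is_derive_solution_flow t a : 0 < t < T1 ->
  is_derive t 1 (fun s => u s (X s a))
    (E (fun b => psi (X t a - X t b) * (u t (X t b) - u t (X t a))) + ga * (ubar - u t (X t a))).
Proof.
move=> tT'; have tT : 0 <= t <= T1 by case/andP: tT' => /ltW -> /ltW ->.
have /andP[t0 tT1] := tT'.
have [_ _ mom _ _] := sol.
have [_ _ _] := mom t (X t a) t0 (inT tT).2.
have cg : continuous (fun y => psi (X t a - y) * (u t y - u t (X t a))).
  have cid : continuous (@id R) by move=> y; exact: cvg_id.
  apply: continuousMf; first exact: (continuous_kernel_comp (x := X t a) cpsi cid).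
  by apply: continuousBf; [exact: solution_continuous|move=> x; exact: cst_continuous].
rewrite (density_push_forward tT cg) gammaE => H.
have := is_derive_along_flow a tT'.
by rewrite (mulrC (derive1 (u t) _)) H.
Qed.

Lemma solution_flow_time_lip K' : exists2 C, 0 <= C &
  forall s t a, 0 <= s -> s <= t -> t <= T1 -> `|a| <= K' -> `|X t a - X s a| <= C * (t - s).
Proof.
have [C C0 HC] := solution_speed_bounded K'; exists C => // s t a s0 st tT aK.
rewrite mulrBr; apply: (normr_ler_of_derive (f := X^~ a) (g := fun r => C * r)) => //.
- apply: (is_derive_within (f' := fun r => u r (X r a))) => r /=; rewrite in_itv/= => /andP[sr rt].
  by apply: dX; rewrite (le_trans s0 sr) (le_trans rt).
- by apply: continuous_within; apply: continuousZf => x; exact: cvg_id.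
move=> r /andP[/ltW sr /ltW rt]; have rT : 0 <= r <= T1 by rewrite (le_trans s0 sr) (le_trans rt).
exists (u r (X r a)), (C * 1); split; [exact: dX|exact: is_deriveZf (is_derive_idf _)|].
by rewrite mulr1; exact: HC.
Qed.

(** In the derivative of [F] the alignment integral cancels that of [Es], and the control cancels
    the linear terms. The equation is silent at time [0], so reaching the initial value needs
    continuity of each term on the closed interval. *)
Lemma solution_flow_equation t a : 0 <= t <= T1 ->
  u t (X t a) = flow_rhs K rho0 ga ubar Psi w0 t (X t) a.
Proof.
move=> tT; have /andP[t0 tT1] := tT.
have [_ _ _ _ u0E] := sol.
pose K' := K + `|a|.
have aK' : `|a| <= K' by rewrite lerDr.
have bK' b : b \in `[(- K), K] -> `|b| <= K'.
  by rewrite in_itv/= -ler_norml => /le_trans; apply; rewrite lerDl.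
have [C C0 HC] := solution_flow_time_lip K'.
have [S S0 HS] := solution_speed_bounded K'.
pose F s := u s (X s a) + E (fun b => Psi (X s a - X s b)) + ga * X s a - ubar * ga * s.
pose Es s := E (fun b => Psi (X s a - X s b)).
have cEs : {within `[0, t], continuous Es}.
  have m0 := wmass_ge0 (- K) K rho0.
  have H s r : 0 <= s -> s <= r -> r <= T1 ->
      `|Es r - Es s| <= wmass (- K) K rho0 * (p0 * (2 * C)) * (r - s).
    move=> s0 sr rT; have cXr : continuous (X r) by apply: solution_flow_continuous; rewrite (le_trans s0).
    have cXs : continuous (X s) by apply: solution_flow_continuous; rewrite s0 (le_trans sr).
    rewrite -!mulrA; apply: normr_wintB => //; try exact: continuous_kernel_comp.
    move=> b /bK' bK; apply: le_trans (kernel_primitive_lip dPsi psi_le _ _) _.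
    rewrite ler_wpM2l//.
    have -> : X r a - X r b - (X s a - X s b) = (X r a - X s a) - (X r b - X s b) by ring.
    apply: le_trans (ler_normB _ _) _.
    have -> : 2 * (C * (r - s)) = C * (r - s) + C * (r - s) by ring.
    by apply: lerD; exact: HC.
  set k := wmass _ _ _ * _ in H.
  have k0 : 0 <= k by rewrite mulr_ge0// mulr_ge0// mulr_ge0.
  apply/within_continuousP_eps => s; rewrite /= in_itv/= => /andP[s0 st] e e0.
  have k1 : 0 < k + 1 by rewrite ltr_wpDl.
  exists (e / (k + 1)) => [|r]; first by rewrite divr_gt0.
  rewrite /= in_itv/= => /andP[r0 rt]; rewrite ltr_pdivlMr// => rs.
  have rT := le_trans rt tT1; have sT := le_trans st tT1.
  apply: (@le_trans _ _ (k * `|r - s|)); last first.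
    by apply: le_trans (ltW rs); rewrite mulrC ler_wpM2l// lerDl.
  have [sr|/ltW rs'] := leP s r; first by rewrite (ger0_norm (x := r - s)) ?subr_ge0//; exact: H.
  by rewrite distrC (distrC r) (ger0_norm (x := s - r)) ?subr_ge0//; exact: H.
have dEs s : 0 < s < T1 -> is_derive s 1 Es
    (E (fun b => psi (X s a - X s b) * (u s (X s a) - u s (X s b)))).
  move=> sT; apply: (is_derive_wint (F := fun s b => Psi (X s a - X s b))
    (F' := fun s b => psi (X s a - X s b) * (u s (X s a) - u s (X s b)))
    (iw _ _) (u := 0) (v := T1) (C := p0 * (S + S))) => //.
  - move=> r /andP[/ltW r0 /ltW rT]; apply: continuous_kernel_comp => //.
    by apply: solution_flow_continuous; rewrite r0.
  - move=> r b /andP[/ltW r0 /ltW rT] _; have rT' : 0 <= r <= T1 by rewrite r0.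
    exact: is_derive_compf (dPsi _) (is_deriveBf (dX a rT') (dX b rT')).
  move=> r b /andP[/ltW r0 /ltW rT] /bK' bK; have rT' : 0 <= r <= T1 by rewrite r0.
  rewrite normrM; apply: ler_pM => //; apply: le_trans (ler_normB _ _) _.
  by apply: lerD; exact: HS.
have cux : {within `[0, t], continuous (fun s => u s (X s a))}.
  have [L L0 uL] := solution_lipschitz.
  apply/within_continuousP_eps => s; rewrite /= in_itv/= => /andP[s0 st] e e0.
  have sT : 0 <= s <= T1 by rewrite s0 (le_trans st).
  have e2 : 0 < e / 2 by rewrite divr_gt0.
  have /within_continuousP_eps/(_ s _ _ e2)[|d d0 Hd] := @solution_time_continuous (X s a).
    by rewrite /= in_itv.
  have L1 : 0 < L + 1 by rewrite ltr_wpDl.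
  have e3 : 0 < e / 2 / (L + 1) by rewrite divr_gt0.
  have /is_derive_continuous/continuousP_eps/(_ _ e3)[d' d'0 Hd'] := dX a sT.
  exists (Num.min d d') => [|r]; first by rewrite lt_min d0.
  rewrite /= in_itv/= lt_min => /andP[r0 rt] /andP[h1 h2].
  have rT : 0 <= r <= T1 by rewrite r0 (le_trans rt).
  rewrite -(subrK (u r (X s a)) (u r (X r a))) -addrA (splitr e).
  apply: le_trans (ler_normD _ _) _; apply: lerD; last by apply: Hd => //; rewrite /= in_itv.
  apply: le_trans (uL _ rT _ _) _.
  apply: (@le_trans _ _ ((L + 1) * (e / 2 / (L + 1)))).
    by apply: ler_pM; [exact: L0|exact: normr_ge0|by rewrite lerDl|exact: Hd'].
  by rewrite mulrC divfK// gt_eqF.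
have cX : {within `[0, t], continuous (X^~ a)}.
  apply: (is_derive_within (f' := fun s => u s (X s a))) => s /=; rewrite in_itv/= => /andP[s0 st].
  by apply: dX; rewrite s0 (le_trans st).
have cF : {within `[0, t], continuous F}.
  have c1 : {within `[0, t], continuous (fun s => u s (X s a) + Es s)}.
    by move=> s; exact: continuousD (cux s) (cEs s).
  have cga : {within `[0, t], continuous (fun _ : R => ga)}.
    by apply: continuous_within => s; exact: cst_continuous.
  have c2 : {within `[0, t], continuous (fun s => ga * X s a)}.
    by move=> s; exact: continuousM (cga s) (cX s).
  have c3 : {within `[0, t], continuous (fun s => u s (X s a) + Es s + ga * X s a)}.
    by move=> s; exact: continuousD (c1 s) (c2 s).
  have c4 : {within `[0, t], continuous (fun s => ubar * ga * s)}.
    by apply: continuous_within; apply: continuousZf => x; exact: cvg_id.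
  by move=> s; exact: continuousB (c3 s) (c4 s).
have FE : F t = F 0.
  apply: eq_of_derive0 => // s /andP[s0 st]; have sT : 0 < s < T1 by rewrite s0 (lt_le_trans st).
  have sT' : 0 <= s <= T1 by rewrite ltW// ltW//; case/andP: sT.
  have := is_deriveBf (is_deriveDf (is_deriveDf (is_derive_solution_flow a sT) (dEs s sT))
    (is_deriveZf ga (dX a sT'))) (is_deriveZf (ubar * ga) (is_derive_idf s)).
  congr is_derive.
  have -> : E (fun b => psi (X s a - X s b) * (u s (X s a) - u s (X s b))) =
     - E (fun b => psi (X s a - X s b) * (u s (X s b) - u s (X s a))).
    rewrite -[RHS]mulN1r -(wintZ (iw _ _)).
      by apply: eq_wint => b _; ring.
    have cXs := @solution_flow_continuous s sT'.
    apply: continuousMf; first exact: continuous_kernel_comp.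
    apply: continuousBf; last by move=> x; exact: cst_continuous.
    exact: continuous_compf (solution_continuous sT') cXs.
  by move: (E _) => z1; move: (u s _) => z2; ring.
have F0 : F 0 = w0 a.
  rewrite /F X0 u0E w0E mulr0 subr0 addrAC; congr (_ + _).
  by apply: eq_wint => b _; rewrite X0.
have -> : flow_rhs K rho0 ga ubar Psi w0 t (X t) a =
  F t + ubar * ga * t - ga * X t a - E (fun b => Psi (X t a - X t b)).
  by rewrite FE F0 /flow_rhs.
by rewrite /F; move: (E _) => z1; move: (u t _) => z2; ring.
Qed.

(** Uniqueness by repeated contraction on the labels of size at most [K']. This set contains [a] and
    the support of [rho0], the only labels that the right-hand side consults. *)
Lemma solution_flow_unique (p1 W U : R) (Y : R -> R -> R) :
  is_flow K rho0 ga ubar Psi w0 p1 W U Y ->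
  forall t a, 0 <= t <= T1 -> X t a = Y t a.
Proof.
move=> flowY t a tT; have /andP[t0 tT1] := tT.
have m0 := wmass_ge0 (- K) K rho0.
pose r := flow_rate K rho0 ga p0.
have r0 : 0 < r by rewrite /r /flow_rate ltr_wpDl// addr_ge0 ?(ltW ga0)// mulr_ge0// mulr_ge0.
pose K' := K + `|a|.
have K'0 : 0 <= K' by rewrite addr_ge0.
have bK' b : b \in `[(- K), K] -> `|b| <= K'.
  by rewrite in_itv/= -ler_norml => /le_trans; apply; rewrite lerDl.
have [C C0 HC] := solution_flow_time_lip K'.
pose B := flow_modulus K rho0 ga ubar p1 U T1 - flow_modulus K rho0 ga ubar p1 U 0.
have dY s b : 0 <= s -> is_derive s 1 (Y^~ b) (flow_rhs K rho0 ga ubar Psi w0 s (Y s) b).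
  by case: flowY => _ _ _; exact.
have Y0 b : Y 0 b = b by exact: flow_init flowY b.
pose M := C * T1 + B.
have B0 : 0 <= B by rewrite subr_ge0; exact: (flow_modulus_homo flowY).
have M0 : 0 <= M by rewrite addr_ge0// mulr_ge0.
have cXs s : 0 <= s <= T1 -> continuous (X s) by move=> sT; exact: solution_flow_continuous.
have cYs s : 0 <= s <= T1 -> continuous (Y s).
  by move=> /andP[s0 _]; exact: (flow_continuous flowY s0).
(* Both flows start at [b], so the sum [M] of their maximal displacements starts the induction; each
   pass through the equation halves the weighted bound. *)
have bound n : forall s b, 0 <= s <= T1 -> `|b| <= K' ->
    `|X s b - Y s b| <= M / 2 ^+ n * expR (2 * r * s).
  elim: n => [|n IH] s b sT bK; have /andP[s0 sT1] := sT.
    rewrite expr0 divr1; apply: (@le_trans _ _ M); last first.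
      by rewrite ler_peMr// -{1}(@expR0 R) ler_expR !mulr_ge0// ltW.
    have -> : X s b - Y s b = (X s b - X 0 b) - (Y s b - Y 0 b) by rewrite X0 Y0; ring.
    apply: le_trans (ler_normB _ _) _; apply: lerD.
      apply: le_trans (HC _ _ _ (lexx _) s0 sT1 bK) _; rewrite subr0.
      by rewrite ler_wpM2l.
    apply: le_trans (flow_time flowY b (lexx _) s0) _.
    by rewrite lerD2r; exact: (flow_modulus_homo flowY).
  have -> : M / 2 ^+ n.+1 = M / 2 ^+ n / 2 by rewrite exprS invfM; ring.
  have dXY z : 0 <= z <= T1 -> is_derive z 1 (fun z => X z b - Y z b)
      (flow_rhs K rho0 ga ubar Psi w0 z (X z) b - flow_rhs K rho0 ga ubar Psi w0 z (Y z) b).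
    move=> zT; have /andP[z0 _] := zT.
    apply: is_deriveBf; last exact: dY.
    by rewrite -solution_flow_equation//; exact: dX.
  apply: (contraction_step (L := r) (T := T1) (y := fun z => X z b - Y z b)
    (y' := fun z => flow_rhs K rho0 ga ubar Psi w0 z (X z) b - flow_rhs K rho0 ga ubar Psi w0 z (Y z) b)) => //.
  - by rewrite X0 Y0 subrr.
  - apply: is_derive_within => z /=; rewrite in_itv/= => /andP[z0 zs].
    by apply: dXY; rewrite z0 (le_trans zs).
  - by move=> z /andP[/ltW z0 /ltW zT]; apply: dXY; rewrite z0.
  - move=> z /andP[/ltW z0 /ltW zT]; have zT' : 0 <= z <= T1 by rewrite z0.
    apply: (flow_rhs_lip (iw _ _) ubar w0 ga0 dPsi psi_le z (@cXs z zT') (@cYs z zT')).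
      by move=> c /bK' cK; exact: IH.
    exact: IH.
  by rewrite divr_ge0// ltW// expr2_gt0.
apply/eqP; rewrite -subr_eq0 -normr_le0; apply/ler_addgt0Pr => e e0; rewrite add0r.
have [n Hn] := half_pow_small (M * expR (2 * r * t)) e0.
apply: le_trans (bound n t a tT _) _; first by rewrite lerDr.
by rewrite mulrAC.
Qed.
End GeneralSolution.

(** * The threshold *)

Section Data.
Context {R : realType}.
Notation mu := (@lebesgue_measure R).
Implicit Types (f psi : R -> R) (e K x y : R).

Lemma compactly_supported_bound f : compactly_supported f ->
  exists2 K, 0 <= K & forall y, K <= `|y| -> f y = 0.
Proof.
move=> /compact_bounded/ex_strict_bound_gt0 [K K0 HK].
exists K; first exact: ltW.
move=> y Ky; apply/eqP; apply: contraT => fy.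
have : `|y| < K by apply: HK; exact: subset_closure.
by rewrite ltNge Ky.
Qed.

(** Heine's theorem on [[- K, K]]. The radius of continuity is encoded as a reciprocal, roughly
    [1 / (C + 1)], because [locally_bounded_itv] produces upper bounds. A pair with a point in
    [[- K, K]] is handled from that point; outside, both values vanish. *)
Lemma unif_continuous_of_support f K : continuous f ->
  (forall y, K <= `|y| -> f y = 0) ->
  forall e, 0 < e -> exists2 d, 0 < d & forall a b : R, `|a - b| < d -> `|f a - f b| <= e.
Proof.
move=> cf f0 e e0.
pose P (t C : R) := forall b : R, `|b - t| * (Num.max 0 C + 1) < 1 -> `|f b - f t| <= e.
have [|t tK|C C0 HC] := @locally_bounded_itv R P (- K) K.
- move=> t C C' PC CC' b bt; apply: PC; apply: le_lt_trans bt.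
  by rewrite ler_wpM2l// lerD2r max0_homo.
- have e2 : 0 < e / 2 by rewrite divr_gt0.
  have [d d0 Hd] := (continuousP_eps f t).1 (cf t) _ e2.
  exists (2 / d), (d / 2); split; first by rewrite divr_gt0.
  move=> s _ st b; rewrite max_r => [bs|]; last by rewrite divr_ge0// ltW.
  have bs' : `|b - s| < d / 2.
    have : `|b - s| * (2 / d) < 1 by apply: le_lt_trans bs; rewrite ler_wpM2l// lerDl.
    by rewrite mulrA ltr_pdivrMr// mul1r ltr_pdivlMr.
  have fb : `|f b - f t| <= e / 2.
    apply: Hd; have -> : b - t = (b - s) + (s - t) by ring.
    by apply: le_lt_trans (ler_normD _ _) _; rewrite [ltRHS](splitr d) ltrD.
  have fs : `|f s - f t| <= e / 2 by apply: Hd; apply: lt_le_trans st _; lra.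
  have -> : f b - f s = (f b - f t) - (f s - f t) by ring.
  by apply: le_trans (ler_normB _ _) _; rewrite (splitr e) lerD.
have dist a b : `|a| <= K -> `|b - a| < (C + 1)^-1 -> `|f b - f a| <= e.
  rewrite ler_norml => aK ba; apply: HC => //.
  by rewrite max_r// -(@ltr_pdivlMr _ _ _ 1) ?div1r// ltr_wpDl.
exists (C + 1)^-1 => [|a b ab]; first by rewrite invr_gt0 ltr_wpDl.
have [aK|Ka] := leP `|a| K; first by rewrite distrC; apply: dist; rewrite // distrC.
have [bK|Kb] := leP `|b| K; first exact: dist.
by rewrite !f0 ?subrr ?normr0 ltW.
Qed.

Lemma unif_continuous_eps f : unif_continuous f ->
  forall e, 0 < e -> exists2 d, 0 < d & forall a b : R, `|a - b| < d -> `|f a - f b| <= e.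
Proof.
move=> /unif_continuousP uf e e0; have [d d0 Hd] := uf e e0.
by exists d => // a b ab; have /ltW := Hd (a, b) ab.
Qed.

Lemma dotW1oo_lip f : dotW1oo f ->
  exists2 C, 0 <= C & forall x y, `|f x - f y| <= C * `|x - y|.
Proof.
move=> fW; have [_ [C C0 fC]] := Lfun_oo_ae fW.1.
by exists C => //; exact: dotW1oo_lipschitz.
Qed.

End Data.

(** * The lifespan in terms of the Jacobian *)

Section Threshold.
Context {R : realType}.
Notation mu := (@lebesgue_measure R).
Variables (gamma ubar : R) (psi rho0 u0 : R -> R) (K p0 Lp C U : R).
Hypothesis gamma_gt0 : 0 < gamma.
Hypothesis psi_ge0 : forall y, 0 <= psi y.
Hypothesis psi_le : forall y, `|psi y| <= p0.
Hypothesis psi_lip : forall x y, `|psi x - psi y| <= Lp * `|x - y|.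
Hypothesis K0 : 0 <= K.
Hypothesis crho0 : continuous rho0.
Hypothesis rho0_ge0 : forall y, 0 <= rho0 y.
Hypothesis rho0_supp : forall y, K <= `|y| -> rho0 y = 0.
Hypothesis C1u0 : C1 u0.
Hypothesis u0_le : forall x, `|u0 x| <= U.
Hypothesis du0_le : forall x, `|derive1 u0 x| <= C.
Hypothesis du0_unif : forall e, 0 < e -> exists2 d, 0 < d &
  forall a b, `|a - b| < d -> `|derive1 u0 a - derive1 u0 b| <= e.

Notation ga := (gamma^-1).
Notation E := (wint (- K) K rho0).
Notation m := (wmass (- K) K rho0).
Notation Psi := (primitive psi).

Definition damped_velocity a := u0 a + ga * a + E (fun b => Psi (a - b)).
Definition damped_slope a := derive1 u0 a + ga + E (fun b => psi (a - b)).
Notation w0 := damped_velocity.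
Notation w1 := damped_slope.
Notation W := (C + ga + m * p0).

Let ga0 : 0 < ga. Proof. by rewrite invr_gt0. Qed.
Let p00 : 0 <= p0 := le_trans (normr_ge0 _) (psi_le 0).
Let m0 : 0 <= m := wmass_ge0 _ _ _.
Let cpsi : continuous psi := lipschitz_continuous psi_lip.
Let dPsi (y : R) : is_derive y 1 Psi (psi y). Proof. exact: is_derive_primitive. Qed.
Let cPsi : continuous Psi := is_derive_all_continuous dPsi.
Let iw : mu.-integrable `[(- K), K] (EFin \o rho0) := continuous_integrable_itv _ _ crho0.
Let Lp0 : 0 <= Lp.
Proof. by have := psi_lip 1 0; rewrite subr0 normr1 mulr1; apply: le_trans. Qed.

Let csub k (a : R) : continuous (k : R -> R) -> continuous (fun b => k (a - b)).
Proof.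
move=> ck; apply: (@continuous_compf _ k (fun b => a - b)) => // x.
by apply: continuousB; [exact: cvg_cst|exact: cvg_id].
Qed.

Lemma support_out y : y \notin `[- K, K] -> rho0 y = 0.
Proof.
by move=> yK; apply: rho0_supp; rewrite leNgt; apply: contra yK => /ltW; rewrite ler_norml in_itv.
Qed.

Lemma damped_slopeE a : w1 a = derive1 u0 a + ga + convolution psi rho0 a.
Proof. by rewrite /convolution (wint_setT _ support_out). Qed.

Lemma is_derive_damped_velocity (a : R) : is_derive a 1 w0 (w1 a).
Proof.
apply: is_deriveDf; first apply: is_deriveDf.
- by apply: derivable_is_derive; exact: C1u0.1.
- by have := is_deriveZf ga (is_derive_idf a); rewrite mulr1.
- apply: (is_derive_wint iw (u := a - 1) (v := a + 1) (C := p0)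
    (F := fun s b => Psi (s - b)) (F' := fun s b => psi (s - b))).
  + by apply/andP; split; lra.
  + by move=> s _; exact: csub.
  + move=> s y _ _; rewrite -[psi _]mulr1; apply: is_derive_compf => //.
    by have := is_deriveBf (is_derive_idf s) (is_derive_cstf y s); rewrite subr0.
  + by move=> s y _ _.
Qed.

Lemma normr_damped_slope a : `|w1 a| <= W.
Proof.
apply: le_trans (ler_normD _ _) _; apply: lerD; last first.
  by apply: (normr_wint iw) => //; exact: csub.
apply: le_trans (ler_normD _ _) _; apply: lerD => //.
by rewrite gtr0_norm.
Qed.

Lemma damped_slope_unif e : 0 < e -> exists2 d, 0 < d &
  forall a b, `|a - b| < d -> `|w1 a - w1 b| <= e.
Proof.
move=> e0; have e2 : 0 < e / 2 by rewrite divr_gt0.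
have [d d0 Hd] := du0_unif e2.
pose c := m * Lp + 1.
have c0 : 0 < c by rewrite ltr_wpDl// mulr_ge0.
exists (Num.min d (e / 2 / c)) => [|a b]; first by rewrite lt_min d0 divr_gt0.
rewrite lt_min => /andP[/Hd abd]; rewrite ltr_pdivlMr// => abe.
have ib : `|E (fun y => psi (a - y)) - E (fun y => psi (b - y))| <= m * (Lp * `|a - b|).
  apply: (normr_wintB iw (@csub psi a cpsi) (@csub psi b cpsi)) => y _.
  by apply: le_trans (psi_lip _ _) _; have -> : a - y - (b - y) = a - b by ring.
rewrite /w1; move: abd ib abe; move: (derive1 u0 a) (derive1 u0 b) => f1 f2.
move: (E _) => z1; move: (E _) => z2; move=> abd ib abe.
have -> : f1 + ga + z1 - (f2 + ga + z2) = (f1 - f2) + (z1 - z2) by ring.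
apply: le_trans (ler_normD _ _) _; rewrite (splitr e) lerD//.
apply: le_trans ib _; apply: le_trans (ltW abe).
by rewrite mulrA mulrC ler_wpM2l// lerDl.
Qed.

Lemma damped_velocityE a : w0 a - ga * a - E (fun b => Psi (a - b)) = u0 a.
Proof. by rewrite /w0; move: (E _) => z; ring. Qed.

Lemma damped_flow_exists : exists X, is_flow K rho0 ga ubar Psi w0 p0 W U X.
Proof.
apply: (flow_exists iw ubar ga0 dPsi psi_le is_derive_damped_velocity normr_damped_slope).
by move=> a; rewrite damped_velocityE.
Qed.

Variable X : R -> R -> R.
Hypothesis flowX : is_flow K rho0 ga ubar Psi w0 p0 W U X.
Notation J := (jacobian K rho0 ga psi w1 X).

Lemma solution_of_jacobian T : (0%:E < T)%E ->
  (forall t, time_interval T t -> exists2 c, 0 < c & forall s a, 0 <= s <= t -> c <= J s a) ->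
  exists rho u, strong_solution gamma ubar psi rho0 u0 T rho u.
Proof.
move=> T0 good; eexists; eexists.
apply: (lagrangian_strong_solution iw ga0 rho0_ge0 dPsi psi_le psi_lip
  is_derive_damped_velocity normr_damped_slope flowX K0 crho0 support_out
  damped_slope_unif _ _ good (erefl _) T0).
- exact: unif_continuous_of_support crho0 rho0_supp.
- by move=> a; rewrite damped_velocityE.
- by move=> a; rewrite damped_velocityE.
Qed.

Lemma global_solution : (forall a, 0 <= w1 a) ->
  exists rho u, strong_solution gamma ubar psi rho0 u0 +oo%E rho u.
Proof.
move=> w1_ge0; apply: (solution_of_jacobian (ltry 0)) => t [t0 _].
exists (expR (- ((ga + m * p0) * t))) => [|s a /andP[s0 st]]; first exact: expR_gt0.
apply: le_trans (jacobian_subcritical iw ga0 psi_le psi_lip flowX s0 (w1_ge0 a)).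
by rewrite ler_expR lerN2 ler_wpM2l// addr_ge0 ?mulr_ge0// ltW.
Qed.

Section Spread.
Variables (T : \bar R) (rho u : R -> R -> R).
Hypothesis sol : strong_solution gamma ubar psi rho0 u0 T rho u.

(* A lower bound on [derive1 (u t)] keeps characteristics apart, and the
   Jacobian is the limit of their difference quotients. *)
Lemma jacobian_ge_of_slope M T1 : 0 <= T1 -> (T1%:E < T)%E ->
  (forall t x, 0 <= t <= T1 -> - M <= derive1 (u t) x) ->
  forall a, expR (- M * T1) <= J T1 a.
Proof.
move=> T10 T1T uM a.
have [Z HZ] := choice (characteristic_exists sol T10 T1T).
have XZ t b : 0 <= t <= T1 -> Z b t = X t b.
  apply: (solution_flow_unique sol T10 T1T K0 crho0 rho0_supp (erefl _) ga0 dPsi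
    psi_le psi_lip (fun=> erefl _) (X := fun t b => Z b t) _ _ flowX) => [c|c s sT].
  - exact: (HZ c).1.
  - exact: (HZ c).2.
have TT : 0 <= T1 <= T1 by rewrite T10 lexx.
have spread b : a < b -> expR (- M * T1) * (b - a) <= X T1 b - X T1 a.
  move=> ab; rewrite -!XZ//.
  have := characteristics_spread sol C1u0 T1T (HZ a).2 (HZ b).2 uM _ TT.
  by rewrite (HZ a).1 (HZ b).1 subr_gt0; apply.
have dX := is_derive_flow_space iw ga0 dPsi psi_le psi_lip is_derive_damped_velocity
  normr_damped_slope flowX a T10.
apply/ler_addgt0Pr => e e0.
have [d d0 Hd] := (is_deriveP_eps _ _ _).1 dX e e0.
have h0 : 0 < d / 2 by rewrite divr_gt0.
have hE : a + d / 2 - a = d / 2 by ring.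
have := Hd (a + d / 2); rewrite hE gtr0_norm// => /(_ _)/wrap[].
  by rewrite gtr_pMr//; lra.
have := spread (a + d / 2); rewrite hE ltrDl => /(_ h0).
move: (expR _) => z; move: (X T1 _ - X T1 a) => D; move: (J T1 a) => j HD.
rewrite ler_norml => /andP[_ jD].
rewrite -(ler_pM2r h0) mulrDl; apply: le_trans HD _.
by rewrite -lerBlDl.
Qed.

End Spread.

(** The Jacobian is Lipschitz in time uniformly in the label, so half of the bound survives for a
    short time past [t0]. The condition [c <= 1] serves when the comparison time is [0], where the
    Jacobian equals [1]. *)
Lemma jacobian_extends t0 c : 0 <= t0 -> 0 < c -> c <= 1 ->
  (forall s a, 0 <= s < t0 -> c <= J s a) ->
  exists2 t, t0 < t & exists2 c', 0 < c' & forall s a, 0 <= s <= t -> c' <= J s a.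
Proof.
move=> t00 c_gt0 c1 Jc.
have t1 : 0 <= t0 + 1 by rewrite addr_ge0.
have [D D0 HD] := jacobian_time_lip iw ga0 psi_le psi_lip normr_damped_slope flowX t1.
(* The times compared are at most [2 * d] apart, so the Jacobian changes by at most [c / 2]. *)
pose d := Num.min 1 (c / 4 / (D + 1)).
have D1 : 0 < D + 1 by rewrite ltr_wpDl.
have d0 : 0 < d by rewrite lt_min ltr01 !divr_gt0.
have d1 : d <= 1 by rewrite ge_min lexx.
have Dd : D * d <= c / 4.
  apply: (@le_trans _ _ ((D + 1) * (c / 4 / (D + 1)))); last first.
    by rewrite mulrCA divff ?mulr1// gt_eqF.
  by apply: ler_pM => //; [exact: ltW|rewrite lerDl|rewrite ge_min lexx orbT].
exists (t0 + d); first by rewrite ltrDl.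
exists (c / 2) => [|s a /andP[s0 st]]; first by rewrite divr_gt0.
have [st0|t0s] := ltP s t0.
  by apply: le_trans (Jc s a _); [lra|rewrite s0].
(* The hypothesis says nothing at [t0] itself, so the comparison is made with an earlier time. *)
pose r := Num.max 0 (t0 - d).
have r0 : 0 <= r := max0_ge0 _.
have rt : r <= t0 by rewrite ge_max t00 gerBl ltW.
have rd : t0 - d <= r by rewrite le_max lexx orbT.
have Jr : c <= J r a.
  rewrite /r; have [dt|td] := leP (t0 - d) 0; first by rewrite jacobian_init.
  by apply: Jc; rewrite (ltW td) gtrBl.
have sr : `|J s a - J r a| <= c / 2.
  apply: le_trans (HD r s a r0 (le_trans rt t0s) (le_trans st _)) _.
    by rewrite lerD2l.
  apply: (@le_trans _ _ (D * (2 * d))); first by rewrite ler_wpM2l//; lra.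
  by rewrite mulrCA; lra.
by move: sr Jr; move: (J s a) (J r a) => x y; rewrite ler_norml => /andP[]; lra.
Qed.

(** The lifespan is the supremum [Tm] of [S], finite because the Jacobian of the label [x1] vanishes
    by time [- (w1 x1)^-1]. No positive lower bound holds on all of [[0, Tm[], as it would extend
    past [Tm]. A slope bounded below up to [Tm] would provide one, for any solution. *)
Lemma blow_up x1 : w1 x1 < 0 -> blows_up_in_finite_time gamma ubar psi rho0 u0.
Proof.
move=> w1x1.
pose S : set R := [set t | 0 <= t /\ exists2 c, 0 < c & forall s a, 0 <= s <= t -> c <= J s a].
have S0 : S 0.
  split => //; exists 1 => // s a /andP[s0 s0']; rewrite (_ : s = 0) ?jacobian_init//.
  by apply/eqP; rewrite eq_le s0 s0'.
have S_down s t : 0 <= s -> s <= t -> S t -> S s.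
  move=> s0 st [t0 [c c0 Hc]]; split => //; exists c => // r a /andP[r0 rs].
  by apply: Hc; rewrite r0 (le_trans rs).
have S_ub : ubound S (- (w1 x1)^-1).
  move=> t [t0 [c c0 Hc]]; rewrite leNgt; apply/negP => tw.
  have Jt := jacobian_supercritical iw ga0 rho0_ge0 psi_ge0 psi_lip flowX t0 (ltW w1x1).
  have : c <= J t x1 by apply: Hc; rewrite t0 lexx.
  apply/negP; rewrite -ltNge; apply: le_lt_trans Jt _; apply: le_lt_trans c0.
  rewrite pmulr_rle0 ?expR_gt0// -lerBrDl sub0r -(ler_nM2l (x := (w1 x1)^-1)) ?invr_lt0//.
  by rewrite mulKf ?lt_eqF// mulrN1 ltW.
have S_has : has_sup S by split; [exists 0|exists (- (w1 x1)^-1)].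
pose Tm := sup S.
have le_Tm t : S t -> t <= Tm by move=> St; exact: ub_le_sup S_has.2 _ St.
have S_below t : 0 <= t -> t < Tm -> S t.
  move=> t0 tT; have [s Ss ts] := sup_adherent (eps := Tm - t) ltac:(by rewrite subr_gt0) S_has.
  by apply: S_down t0 _ Ss; apply: ltW; move: ts; rewrite -/Tm; lra.
have no_lower c : 0 <= Tm -> 0 < c -> ~ forall s a, 0 <= s < Tm -> c <= J s a.
  move=> Tm0 c0 Hc.
  have c1 : 0 < Num.min c 1 by rewrite lt_min c0 ltr01.
  have [||t Tt Ht] := jacobian_extends Tm0 c1.
  - by rewrite ge_min lexx orbT.
  - by move=> s a sT; apply: le_trans (Hc s a sT); rewrite ge_min lexx.
  by have := le_Tm t (conj (le_trans Tm0 (ltW Tt)) Ht); rewrite leNgt Tt.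
have Tm_gt0 : 0 < Tm.
  rewrite lt_neqAle le_Tm// andbT; apply/eqP => Tm0.
  apply: (no_lower 1); rewrite // -Tm0// => s a.
  by case/andP => s0 /(le_lt_trans s0); rewrite ltxx.
have sol_no_lower T rho u M : strong_solution gamma ubar psi rho0 u0 T rho u ->
    (* The proof replaces the rate by [|M|]: as it is nonnegative, the bound at [Tm] lies below
       those at all earlier times and gives one constant on [[0, Tm[]. *)
    (Tm%:E <= T)%E -> ~ forall t x, 0 <= t < Tm -> M <= derive1 (u t) x.
  move=> sol TmT uM; apply: (no_lower (expR (- `|M| * Tm))); first exact: ltW.
    exact: expR_gt0.
  move=> s a /andP[s0 sT].
  have sT' : (s%:E < T)%E by apply: lt_le_trans TmT; rewrite lte_fin.
  apply: le_trans (@jacobian_ge_of_slope T rho u sol `|M| s s0 sT' _ a).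
    by rewrite ler_expR !mulNr lerN2 ler_wpM2l// ltW.
  move=> t x /andP[t0 ts]; apply: (@le_trans _ _ M); first by rewrite lerNl ler_normr lexx orbT.
  by apply: uM; rewrite t0 (le_lt_trans ts).
exists Tm; split => //.
- by apply: solution_of_jacobian; [rewrite lte_fin|move=> t [t0]; rewrite lte_fin => /(S_below t t0)[]].
- move=> rho u sol M; apply: contrapT => H.
  apply: (sol_no_lower _ _ _ M sol (lexx _)) => t x /andP[t0 tT].
  by rewrite leNgt; apply/negP => uM; apply: H; exists t, x.
(* A solution living beyond [Tm] has a uniform Lipschitz constant on the compact interval [[0, Tm]],
   hence a slope bounded below there. *)
- move=> T rho u TmT sol.
  have [L L0 HL] := solution_lipschitz sol TmT.
  apply: (sol_no_lower _ _ _ (- L) sol (ltW TmT)) => t x /andP[t0 /ltW tT].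
  have tT' : 0 <= t <= Tm by rewrite t0.
  have := dotW1oo_bounded_derive (fun y => solution_derivable (x := y) sol C1u0 TmT tT') (HL t tT') x.
  by rewrite ler_norml => /andP[].
Qed.

End Threshold.

Theorem theorem3p1 (R : realType) (gamma ubar : R) (psi rho0 u0 : R -> R)
    (gamma_gt0 : 0 < gamma) (psi_weight : communication_weight psi)
    (data : admissible_data rho0 u0) :
  ((exists x : R, derive1 u0 x < - convolution psi rho0 x - gamma^-1) ->
     blows_up_in_finite_time gamma ubar psi rho0 u0) /\
  ((forall x : R, - convolution psi rho0 x - gamma^-1 <= derive1 u0 x) ->
     exists rho u : R -> R -> R,
       strong_solution gamma ubar psi rho0 u0 +oo%E rho u).
Proof.
have [psiW _ psi_ge0 _ psi_mono] := psi_weight.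
have [[rho0_ge0 crho0 rho0_cpt] [u0_bd C1u0 u0W u0_unif]] := data.
have psi_le y : `|psi y| <= psi 0 by rewrite ger0_norm// psi_mono// normr0.
have [Lp _ psi_lip] := dotW1oo_lip psiW.2.
have [K K0 rho0_supp] := compactly_supported_bound rho0_cpt.
have [C _ u0_lip] := dotW1oo_lip u0W.
have du0_le := dotW1oo_bounded_derive C1u0.1 u0_lip.
have du0_unif := unif_continuous_eps u0_unif.
have [U U0 HU] := ex_strict_bound_gt0 u0_bd.
have u0_le x : `|u0 x| <= U by apply: ltW; exact: HU.
have [X flowX] := damped_flow_exists ubar K gamma_gt0 psi_le psi_lip crho0 C1u0 u0_le du0_le.
split=> [[x ux]|usub].
- apply: (blow_up gamma_gt0 psi_ge0 psi_le psi_lip K0 crho0 rho0_ge0 rho0_supp C1u0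
    u0_le du0_le du0_unif flowX (x1 := x)).
  by rewrite (damped_slopeE gamma psi u0 rho0_supp); lra.
- apply: (global_solution gamma_gt0 psi_le psi_lip K0 crho0 rho0_ge0 rho0_supp C1u0
    u0_le du0_le du0_unif flowX) => a.
  by rewrite (damped_slopeE gamma psi u0 rho0_supp); have := usub a; lra.
Qed.
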